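(* Let $\mathbb{V}^{m\times n}$ ($m\le n$) be the space of $m\times n$ real (or complex) matrices, let $\mathcal{N}\subseteq\mathbb{V}^{m\times n}$ be a nonempty open set, let $g:\mathbb{R}^m\to\mathbb{R}^m$ be absolutely symmetric on an open set $\hat{\sigma}_{\mathcal N}\subseteq\mathbb{R}^m$ containing $\sigma_{\mathcal N}=\{\sigma(X)\mid X\in\mathcal{N}\}$, and let $G:\mathcal{N}\to\mathbb{V}^{m\times n}$ be the spectral operator with respect to $g$. Let $\overline{X}\in\mathcal{N}$ have the singular value decomposition $\overline{X}=\overline{U}\,[\Sigma(\overline{X})\ \ 0]\,\overline{V}^{\mathsf T}$, and assume that $g$ is locally Lipschitz continuous near $\overline{\sigma}=\sigma(\overline{X})$ and directionally differentiable at $\overline{\sigma}$. Suppose that there exists an open neighborhood $\mathcal{B}\subseteq\mathbb{R}^m$ of $\overline{\sigma}$ in $\hat{\sigma}_{\mathcal N}$ such that $g$ is differentiable at $\sigma\in\mathcal{B}$ if and only if $g'(\overline{\sigma};\cdot)$ is differentiable at $\sigma-\overline{\sigma}$. Assume further that the function $d:\mathbb{R}^m\to\mathbb{R}^m$ defined by $$d(h)=g(\overline{\sigma}+h)-g(\overline{\sigma})-g'(\overline{\sigma};h),\quad h\in\mathbb{R}^m,$$ is strictly differentiable at zero. Then $$\partial_BG(\overline{X})=\partial_B\Psi(0)\quad\text{and}\quad\partial G(\overline{X})=\partial\Psi(0),$$ where $\Psi:=G'(\overline{X};\cdot):\mathbb{V}^{m\times n}\to\mathbb{V}^{m\times n}$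 is the directional derivative of $G$ at $\overline{X}$.
   Context: $\mathbb{V}^{m\times n}$ is regarded as a real Euclidean vector space with the Frobenius norm $\|\cdot\|$ (inner product $\mathrm{Re}\,\mathrm{tr}(X^{\mathsf T}Y)$, where $^{\mathsf T}$ means transpose in the real case and conjugate transpose in the complex case); differentiability means Fréchet differentiability over $\mathbb{R}$. For $X\in\mathbb{V}^{m\times n}$, $\sigma(X)=(\sigma_1(X),\ldots,\sigma_m(X))\in\mathbb{R}^m$ is the vector of singular values with $\sigma_1(X)\ge\cdots\ge\sigma_m(X)\ge 0$, $\Sigma(X)=\mathrm{Diag}(\sigma(X))$ is the $m\times m$ diagonal matrix with these entries, and $\mathbb{O}^{m,n}(X)$ is the set of all pairs $(U,V)$ of $m\times m$ and $n\times n$ orthogonal (unitary in the complex case) matrices with $X=U[\Sigma(X)\ \ 0]V^{\mathsf T}$; in the singular value decomposition of $\overline X$, $(\overline U,\overline V)\in\mathbb{O}^{m,n}(\overline X)$. Let $\pm\mathbb{P}^m$ be the set of $m\times m$ signed permutation matrices (exactly one nonzero entry, equal to $\pm1$, in each row and each column). The mapping $g:\mathbb{R}^m\to\mathbb{R}^m$ is absolutely symmetric (mixed symmetric with respect to $\pm\mathbb{P}^m$) on a set $\mathcal{D}\subseteq\mathbb{R}^m$ if $g(Qx)=Qg(x)$ for all $Q\in\pm\mathbb{P}^m$ and all $x\in\mathcal{D}$. The spectral operator $G:\mathcal{N}\to\mathbb{V}^{m\times n}$ with respect to $g$ is defined by $G(X)=U[\mathrm{Diag}(g(\sigma(X)))\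 \ 0]V^{\mathsf T}$, $X\in\mathcal{N}$, where $(U,V)\in\mathbb{O}^{m,n}(X)$; by the absolute symmetry of $g$ this does not depend on the choice of $(U,V)$. When $g$ is locally Lipschitz continuous near $\overline\sigma$ and directionally differentiable at $\overline\sigma$, $G$ is locally Lipschitz continuous near $\overline X$ and directionally differentiable at $\overline X$, and $\Psi$ is globally Lipschitz continuous, so all objects in the conclusion are well defined. A map is locally Lipschitz continuous near a point if it is Lipschitz continuous on some open neighborhood of that point. The directional derivative is $F'(z;h)=\lim_{t\downarrow0}\frac{F(z+th)-F(z)}{t}$, and $F$ is directionally differentiable at $z$ if this limit exists for all $h$. Under the stated assumptions on $g$, $d$ is differentiable at $0$ with $d'(0)=0$; strict differentiability of $d$ at zero means $\lim_{w,w'\to0,\ w\ne w'}\frac{d(w)-d(w')}{\|w-w'\|}=0$. For $F$ locally Lipschitz continuous on an open set $\mathcal{O}$ of a finite dimensional real Euclidean space, with values in another such space, let $\mathcal{D}_F\subseteq\mathcal{O}$ be the set of points where $F$ is differentiable. The B-subdifferential of $F$ at $z\in\mathcal{O}$ is $\partial_BF(z)=\{\lim_{k\to\infty}F'(z^k)\mid z^k\in\mathcal{D}_F,\ z^k\to z\}$ (all existing limits), and the Clarke generalized Jacobian is $\partial F(z)=\mathrm{conv}\,\partial_BF(z)$, the convex hull. *)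

(* Defs.v *)
From HB Require Import structures.
From mathcomp Require Import all_boot all_order all_algebra.
From mathcomp Require Import complex.
From mathcomp Require Import ring lra.
From mathcomp Require Import all_classical all_reals all_analysis.
Import Order.TTheory GRing.Theory Num.Theory.
Import numFieldNormedType.Exports.

Set Implicit Arguments.
Unset Strict Implicit.
Unset Printing Implicit Defensive.

Local Open Scope classical_set_scope.
Local Open Scope ring_scope.

Variant entries := RealEntries | ComplexEntries.

Section Scalar.
Context (R : realType).

Definition scalar (k : entries) : numFieldType :=
  match k with RealEntries => R | ComplexEntries => R[i] end.

Definition of_real (k : entries) : R -> scalar k :=
  match k return R -> scalar k with
  | RealEntries => id
  | ComplexEntries => real_complex R
  end.

Definition sconj (k : entries) : scalar k -> scalar k :=
  match k return scalar k -> scalar k with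
  | RealEntries => id
  | ComplexEntries => @conjc R
  end.

Definition sRe (k : entries) : scalar k -> R :=
  match k return scalar k -> R with
  | RealEntries => id
  | ComplexEntries => @complex.Re R
  end.

End Scalar.

Section ScalarTheory.
Context (R : realType) (k : entries).
Implicit Types (a b : R) (x y : scalar R k).

Fact of_real_additive : zmod_morphism (@of_real R k).
Proof. by case: k => // x y; rewrite /= raddfB. Qed.
Fact of_real_multiplicative : monoid_morphism (@of_real R k).
Proof. by case: k => //; split=> [|x y]; rewrite /= ?rmorph1 ?rmorphM. Qed.
HB.instance Definition _ :=
  GRing.isZmodMorphism.Build R (scalar R k) (@of_real R k) of_real_additive.
HB.instance Definition _ :=
  GRing.isMonoidMorphism.Build R (scalar R k) (@of_real R k)
    of_real_multiplicative.

Fact sconj_additive : zmod_morphism (@sconj R k).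
Proof. by case: k => // x y; rewrite /= raddfB. Qed.
Fact sconj_multiplicative : monoid_morphism (@sconj R k).
Proof.
split; first by case: k => //; exact: (rmorph1 (@conjc R)).
by case: k => // x y; exact: (rmorphM (@conjc R)).
Qed.
HB.instance Definition _ :=
  GRing.isZmodMorphism.Build (scalar R k) (scalar R k) (@sconj R k)
    sconj_additive.
HB.instance Definition _ :=
  GRing.isMonoidMorphism.Build (scalar R k) (scalar R k) (@sconj R k)
    sconj_multiplicative.

Fact sRe_additive : zmod_morphism (@sRe R k).
Proof. by rewrite /zmod_morphism; case: k => [x y|[a b] [c d]]. Qed.
HB.instance Definition _ :=
  GRing.isZmodMorphism.Build (scalar R k) R (@sRe R k) sRe_additive.

Lemma sReZ a x : sRe (of_real k a * x) = a * sRe x.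
Proof. by case: k x => // -[b c]; rewrite /= mul0r subr0. Qed.

Lemma sRe_conjMC x y : sRe (sconj x * y) = sRe (sconj y * x).
Proof.
case: k x y => [x y|[a b] [c d]] /=; first by rewrite mulrC.
by rewrite !mulNr mulrC [b * d]mulrC.
Qed.

Lemma sRe_conjM_ge0 x : 0 <= sRe (sconj x * x).
Proof.
case: k x => [x|[a b]] /=; first by rewrite -expr2 sqr_ge0.
by rewrite mulNr opprK addr_ge0// -expr2 sqr_ge0.
Qed.

Lemma sRe_conjM_eq0 x : sRe (sconj x * x) = 0 -> x = 0.
Proof.
case: k x => [x|[a b]] /=; first by move/eqP; rewrite mulf_eq0 orbb => /eqP.
rewrite mulNr opprK => /eqP; rewrite paddr_eq0 -?expr2 ?sqr_ge0//.
by rewrite !expf_eq0/= => /andP[/eqP-> /eqP->].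
Qed.

End ScalarTheory.

(* The alias keeps the Frobenius structure over [R] apart from the structure
   of ['M_(m, n)] in the library, where the scalars are the entries and the
   norm is the sup norm. *)
Definition Mat (R : realType) (k : entries) (m n : nat) : Type :=
  'M[scalar R k]_(m, n).

Notation Rvec R m := (Mat R RealEntries m 1).

Section Mat.
Context {R : realType} {k : entries} {m n : nat}.
Implicit Types (X Y : Mat R k m n) (a : R).

HB.instance Definition _ := GRing.Zmodule.on (Mat R k m n).

Definition mscale a X : Mat R k m n :=
  GRing.scale (of_real k a) (X : 'M[scalar R k]_(m, n)).

Fact mscaleA a b X : mscale a (mscale b X) = mscale (a * b) X.
Proof. by rewrite /mscale scalerA rmorphM. Qed.
Fact mscale1 : left_id 1 mscale.
Proof. by move=> X; rewrite /mscale rmorph1 scale1r. Qed.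
Fact mscaleDr : right_distributive mscale +%R.
Proof. by move=> a X Y; rewrite /mscale scalerDr. Qed.
Fact mscaleDl X : {morph mscale^~ X : a b / a + b}.
Proof. by move=> a b; rewrite /mscale rmorphD scalerDl. Qed.

HB.instance Definition _ := GRing.Zmodule_isLmodule.Build R (Mat R k m n)
  mscaleA mscale1 mscaleDr mscaleDl.

Definition ctr X : Mat R k n m := map_mx (@sconj R k) X^T.

Definition mdot X Y : R := sRe (\tr (ctr X *m Y)).

Definition mnorm X : R := Num.sqrt (mdot X X).

Lemma mdotE X Y : mdot X Y = \sum_j \sum_i sRe (sconj (X i j) * Y i j).
Proof.
rewrite /mdot /mxtrace raddf_sum; apply: eq_bigr => j _.
by rewrite mxE raddf_sum; apply: eq_bigr => i _; rewrite !mxE.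
Qed.

Lemma mdotC X Y : mdot X Y = mdot Y X.
Proof.
by rewrite !mdotE; do 2![apply: eq_bigr => ? _]; rewrite sRe_conjMC.
Qed.

Lemma mdotDr X Y Z : mdot X (Y + Z) = mdot X Y + mdot X Z.
Proof. by rewrite /mdot mulmxDr !raddfD. Qed.

Lemma mdotZr a X Y : mdot X (a *: Y) = a * mdot X Y.
Proof.
rewrite !mdotE mulr_sumr; apply: eq_bigr => j _.
rewrite mulr_sumr; apply: eq_bigr => i _.
by rewrite [(a *: Y) i j]mxE mulrCA sReZ.
Qed.

Lemma mdotDl X Y Z : mdot (X + Y) Z = mdot X Z + mdot Y Z.
Proof. by rewrite mdotC mdotDr !(mdotC Z). Qed.

Lemma mdotZl a X Y : mdot (a *: X) Y = a * mdot X Y.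
Proof. by rewrite mdotC mdotZr mdotC. Qed.

Lemma mdot_ge0 X : 0 <= mdot X X.
Proof. by rewrite mdotE; do 2![apply: sumr_ge0 => ? _]; exact: sRe_conjM_ge0. Qed.

Lemma mdot_eq0 X : mdot X X = 0 -> X = 0.
Proof.
rewrite mdotE => /eqP; rewrite psumr_eq0; last first.
  by move=> j _; apply: sumr_ge0 => i _; exact: sRe_conjM_ge0.
move=> /allP X0; apply/matrixP => i j; rewrite [RHS]mxE.
have /eqP := X0 j (mem_index_enum _); move/eqP; rewrite psumr_eq0; last first.
  by move=> i' _; exact: sRe_conjM_ge0.
by move=> /allP/(_ i (mem_index_enum _))/eqP/sRe_conjM_eq0.
Qed.

Lemma sqr_mnorm X : mnorm X ^+ 2 = mdot X X.
Proof. by rewrite sqr_sqrtr ?mdot_ge0. Qed.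

Lemma mdot_le X Y : mdot X Y <= mnorm X * mnorm Y.
Proof.
have [Y0|Y0] := eqVneq (mdot Y Y) 0.
  have -> : Y = 0 *: Y by rewrite (mdot_eq0 Y0) scaler0.
  by rewrite mdotZr mul0r mulr_ge0 ?sqrtr_ge0.
have Ygt0 : 0 < mdot Y Y by rewrite lt_neqAle eq_sym Y0 mdot_ge0.
have := mdot_ge0 (mdot Y Y *: X - mdot X Y *: Y).
rewrite -scaleNr mdotDl !mdotDr !mdotZl !mdotZr (mdotC Y X) => h.
have {h} : 0 <= mdot Y Y * (mdot X X * mdot Y Y - mdot X Y ^+ 2) by lra.
rewrite pmulr_rge0// subr_ge0 => h.
rewrite (le_trans (ler_norm _))// -sqrtr_sqr /mnorm -sqrtrM ?mdot_ge0//.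
by rewrite ler_wsqrtr.
Qed.

Fact mnormD X Y : mnorm (X + Y) <= mnorm X + mnorm Y.
Proof.
rewrite -(@ler_pXn2r _ 2)// ?nnegrE ?addr_ge0 ?sqrtr_ge0//.
rewrite sqrrD !sqr_mnorm mdotDl !mdotDr (mdotC Y X).
have := mdot_le X Y; lra.
Qed.

Fact mnormZ a X : mnorm (a *: X) = `|a| * mnorm X.
Proof.
rewrite /mnorm mdotZl mdotZr mulrA -expr2 sqrtrM ?sqr_ge0//.
by rewrite sqrtr_sqr.
Qed.

Fact mnorm0_eq0 X : mnorm X = 0 -> X = 0.
Proof. by move=> X0; apply: mdot_eq0; rewrite -sqr_mnorm X0 expr0n. Qed.

HB.instance Definition _ := Lmodule_isNormed.Build R (Mat R k m n)
  mnormD mnormZ mnorm0_eq0.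

End Mat.

Section Variational.
Context {R : realType} {V W : normedModType R}.
Implicit Types (F : V -> W) (z h : V).

Definition locally_lipschitz_near F z :=
  exists2 O : set V, open O /\ O z & [lipschitz F x | x in O].

Definition dir_quotient F z h (t : R) : W := t^-1 *: (F (z + t *: h) - F z).

Definition dir_differentiable F z :=
  forall h, cvg (dir_quotient F z h t @[t --> 0^'+]).

Definition dir_derivative F z h : W :=
  lim (dir_quotient F z h t @[t --> 0^'+]).

(* The subtracted linear term ['d F z (p.1 - p.2)] of the general notion of
   strict differentiability is zero here. *)
Definition strictly_differentiable_with_zero_derivative F z :=
  `|p.1 - p.2|^-1 *: (F p.1 - F p.2) @[p --> within [set p : V * V | p.1 != p.2]
                                               (nbhs (z, z))] --> (0 : W).

(* For linear maps the inner bound says that the operator norm of [A i - L] is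
   at most [e]. *)
Definition op_cvg (A : nat -> V -> W) (L : V -> W) :=
  forall e : R, 0 < e ->
    \forall i \near \oo, forall h, `|A i h - L h| <= e * `|h|.

(* The elements are plain functions; being limits of linear maps, they are
   linear. *)
Definition B_subdifferential (O : set V) F z : set (V -> W) :=
  [set L | exists zs : nat -> V,
     [/\ forall i, O (zs i) /\ differentiable F (zs i),
         zs @ \oo --> z
       & op_cvg (fun i => 'd F (zs i)) L]].

Definition convex_hull (E : lmodType R) (A : set E) : set E :=
  \bigcap_(C in [set C | convex_set C /\ A `<=` C]) C.

Definition clarke_jacobian (O : set V) F z : set (V -> W) :=
  convex_hull (B_subdifferential O F z).

End Variational.

Section Spectral.
Context {R : realType} {k : entries}.

Definition orthogonal_mx p (U : Mat R k p p) := U *m ctr U = 1%:M.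

(* This is the block matrix [Diag(s) 0] only when m <= n. *)
Definition rect_diag m n (s : Rvec R m) : Mat R k m n :=
  \matrix_(i, j) (if i == j :> nat then of_real k (s i 0) else 0).

Definition is_svd m n (X : Mat R k m n) (s : Rvec R m)
    (UV : Mat R k m m * Mat R k n n) :=
  [/\ orthogonal_mx UV.1, orthogonal_mx UV.2
    & X = UV.1 *m rect_diag n s *m ctr UV.2].

Definition sorted_nonneg m (s : Rvec R m) :=
  (forall i j : 'I_m, (i <= j)%N -> s j 0 <= s i 0 :> R) /\
  (forall i, 0 <= s i 0 :> R).

Definition sigma m n (X : Mat R k m n) : Rvec R m :=
  get [set s | sorted_nonneg s /\ exists UV, is_svd X s UV].

Definition svd_pairs m n (X : Mat R k m n) : set (Mat R k m m * Mat R k n n) :=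
  [set UV | is_svd X (sigma X) UV].

(* The value does not depend on the pair in [svd_pairs X] that is chosen when
   [g] is absolutely symmetric at [sigma X]. *)
Definition spectral_operator m n (g : Rvec R m -> Rvec R m) (X : Mat R k m n) :
    Mat R k m n :=
  let UV := get (svd_pairs X) in
  UV.1 *m rect_diag n (g (sigma X)) *m ctr UV.2.

End Spectral.

Definition signed_perm_mx (R : realType) m (Q : 'M[R]_m) :=
  [/\ forall i j, Q i j <> 0 -> Q i j = 1 \/ Q i j = -1,
      forall i, exists! j, Q i j <> 0
    & forall j, exists! i, Q i j <> 0].

Definition absolutely_symmetric (R : realType) m (g : Rvec R m -> Rvec R m)
    (D : set (Rvec R m)) :=
  forall (Q : 'M[R]_m) (x : Rvec R m),
    signed_perm_mx Q -> D x -> g (Q *m x) = Q *m g x.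

(* Main.v *)
Require Import Defs.
From HB Require Import structures.
From mathcomp Require Import all_boot all_order all_algebra all_fingroup.
From mathcomp Require Import complex.
From mathcomp Require Import ring lra.
From mathcomp Require Import all_classical all_reals all_analysis.
Import Order.TTheory GRing.Theory Num.Theory.
Import numFieldNormedType.Exports.

Set Implicit Arguments.
Unset Strict Implicit.
Unset Printing Implicit Defensive.

Local Open Scope classical_set_scope.
Local Open Scope ring_scope.

(** Write [c = sigma Xbar], [phi = g'(c; .)] and [O] for the orbit of [Xbar]
    under [X |-> U X W^H] with [U], [W] unitary. The space splits into the
    tangent space [{A Xbar - Xbar B | A, B skew}] of [O] and the normal space,
    whose elements have singular value decompositions [U rd(y) W^H] with frames
    [U], [W] shared with [Xbar] (Kostant's maximum argument; it also yields the
    existence of singular value decompositions). Since [G] commutes with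
    rotations, which are approximated to second order by Cayley transforms,
      [Psi (A Xbar - Xbar B + U rd(y) W^H)
         = A G(Xbar) - G(Xbar) B + U rd(phi y) W^H];
    so [Psi] is linear along the tangent space, and on the normal slice it is
    the spectral operator of the model [x |-> phi (x - c)]. A spectral operator
    of a Lipschitz symmetric map is differentiable exactly where the map is, so
    by the hypothesis on [g] and [phi] the map [G] is differentiable at
    [Xbar + K], [K] normal and small, iff [Psi] is differentiable at [K]. The
    two derivatives are close: in tangential directions both are commutators,
    and in normal directions they differ by the derivative of the spectral
    operator of [d], whose Lipschitz constant near [Xbar] is as small as that
    of [d] near [0]. Finally every point near [Xbar] is brought to the normal
    slice by a rotation close to the identity (compactness), and every point
    near [0] by a tangential translation, under which [Psi] changes by a
    constant. *)

(** * Moduli and matrices *)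

(** The obstacle is that the frames of a matrix are neither unique nor continuous where singular
    values repeat or vanish. Two devices avoid it. Estimates compare two decompositions through the
    overlaps [U^H U'] and [W^H W'], whose entries are controlled by the distance of the two
    matrices; the Lipschitz bounds for [sigma] and for spectral operators and, at distance zero,
    independence of the chosen decomposition come out of the same computation. And a derivative is
    assembled from linear data first ([linear_decomposition], [spectral_linear]), while the frame is
    chosen afterwards, anew for each increment. Near [c] all symmetry arguments use signed
    permutations that fix [c], since this is the symmetry that [phi] inherits from [g].
    B-subdifferentials are compared by approximation at every scale ([B_subdifferentialP]), so no
    sequence of frames has to converge. *)

Section Modulus.
Context {R : realType} {k : entries}.
Implicit Types (x y : Defs.scalar R k) (a b : R).

(** Real-valued for both kinds of entries, whereas the norm of [scalar R k] takes values in the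
    scalars themselves. *)
Definition smod x : R := Num.sqrt (sRe (sconj x * x)).

Lemma sconjK : involutive (@sconj R k).
Proof. by case: k => // x; exact: conjcK. Qed.

Lemma sconj_real a : sconj (of_real k a) = of_real k a.
Proof. by case: k => //; exact: conjc_real. Qed.

Lemma sRe_real a : sRe (of_real k a) = a.
Proof. by case: k. Qed.

Lemma sconj_fixed x : sconj x = x -> x = of_real k (sRe x).
Proof.
case: k x => // -[a b] /= [] bN; congr Complex.
lra.
Qed.

Lemma of_real_eq0 a : (of_real k a == 0) = (a == 0).
Proof.
apply/eqP/eqP => [h|->]; last by rewrite raddf0.
by have := congr1 (@sRe R k) h; rewrite sRe_real raddf0.
Qed.

Lemma smod_sqr x : smod x ^+ 2 = sRe (sconj x * x).
Proof. by rewrite sqr_sqrtr// sRe_conjM_ge0. Qed.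

Lemma conjM_smod x : sconj x * x = of_real k (smod x ^+ 2).
Proof.
rewrite smod_sqr; apply: sconj_fixed.
by rewrite rmorphM/= sconjK mulrC.
Qed.

Lemma smod_ge0 x : 0 <= smod x.
Proof. exact: sqrtr_ge0. Qed.

Lemma smodM x y : smod (x * y) = smod x * smod y.
Proof.
apply/eqP; rewrite -(@eqrXn2 _ 2)// ?mulr_ge0 ?smod_ge0//; apply/eqP.
rewrite smod_sqr rmorphM/= mulrACA conjM_smod exprMn.
by rewrite sReZ -smod_sqr.
Qed.

Lemma smod_conj x : smod (sconj x) = smod x.
Proof. by rewrite /smod sconjK mulrC. Qed.

Lemma smod_real a : smod (of_real k a) = `|a|.
Proof. by rewrite /smod sconj_real sReZ sRe_real -expr2 sqrtr_sqr. Qed.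

Lemma smodN x : smod (- x) = smod x.
Proof. by rewrite /smod rmorphN/= mulrNN. Qed.

Lemma smod0 : smod 0 = 0.
Proof. by rewrite /smod mulr0 raddf0 sqrtr0. Qed.

Lemma smod_mnorm x : smod x = mnorm (const_mx x : Mat R k 1 1).
Proof.
rewrite /smod /mnorm mdotE; congr Num.sqrt.
by rewrite !big_ord1 !mxE.
Qed.

Lemma smodD x y : smod (x + y) <= smod x + smod y.
Proof.
rewrite !smod_mnorm.
have -> : const_mx (x + y) = (const_mx x + const_mx y : Mat R k 1 1).
  by apply/matrixP => i j; rewrite !mxE.
exact: mnormD.
Qed.

Lemma smod_sum (I : Type) (r : seq I) (P : pred I) (F : I -> Defs.scalar R k) :
  smod (\sum_(i <- r | P i) F i) <= \sum_(i <- r | P i) smod (F i).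
Proof.
elim/big_ind2: _ => [|x a y b xa yb|//]; first by rewrite smod0.
by rewrite (le_trans (smodD _ _))// lerD.
Qed.

Lemma sRe_le_smod x : `|sRe x| <= smod x.
Proof.
rewrite /smod; case: k x => [x|[a b]] /=; rewrite -?expr2 ?sqrtr_sqr//.
rewrite mulNr opprK -sqrtr_sqr ler_wsqrtr// -!expr2.
by rewrite lerDl sqr_ge0.
Qed.

End Modulus.

Section MatrixAlgebra.
Context {R : realType} {k : entries}.
Implicit Types (m n p q : nat).

(* These wrappers keep the type [Mat], hence its Frobenius norm, which the
   library operations would lose. *)
Definition mmul m n p (A : Mat R k m n) (B : Mat R k n p) : Mat R k m p :=
  A *m B.
Definition idm p : Mat R k p p := 1%:M.
End MatrixAlgebra.
Arguments idm {R k p}.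
Local Notation "A ** B" := (mmul A B) (at level 40, left associativity).

Section MatrixTheory.
Context {R : realType} {k : entries}.
Implicit Types (m n p q : nat) (a : R).

Lemma mmulE m n p (A : Mat R k m n) (B : Mat R k n p) i j :
  (A ** B) i j = \sum_l A i l * B l j.
Proof. by rewrite mxE. Qed.

Lemma mmulA m n p q (A : Mat R k m n) (B : Mat R k n p) (C : Mat R k p q) :
  A ** (B ** C) = A ** B ** C.
Proof. exact: mulmxA. Qed.

Lemma mmulDl m n p (A B : Mat R k m n) (C : Mat R k n p) :
  (A + B) ** C = A ** C + B ** C.
Proof. exact: mulmxDl. Qed.

Lemma mmulDr m n p (A : Mat R k m n) (B C : Mat R k n p) :
  A ** (B + C) = A ** B + A ** C.
Proof. exact: mulmxDr. Qed.

Lemma mmulNl m n p (A : Mat R k m n) (C : Mat R k n p) :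
  (- A) ** C = - (A ** C).
Proof. exact: mulNmx. Qed.

Lemma mmulNr m n p (A : Mat R k m n) (C : Mat R k n p) :
  A ** (- C) = - (A ** C).
Proof. exact: mulmxN. Qed.

Lemma mmulBl m n p (A B : Mat R k m n) (C : Mat R k n p) :
  (A - B) ** C = A ** C - B ** C.
Proof. by rewrite mmulDl mmulNl. Qed.

Lemma mmulBr m n p (A : Mat R k m n) (B C : Mat R k n p) :
  A ** (B - C) = A ** B - A ** C.
Proof. by rewrite mmulDr mmulNr. Qed.

Lemma mmulZl m n p a (A : Mat R k m n) (C : Mat R k n p) :
  (a *: A) ** C = a *: (A ** C).
Proof. exact: (esym (scalemxAl _ _ _)). Qed.

Lemma mmulZr m n p a (A : Mat R k m n) (C : Mat R k n p) :
  A ** (a *: C) = a *: (A ** C).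
Proof. exact: (esym (scalemxAr _ _ _)). Qed.

Lemma mmul0l m n p (C : Mat R k n p) : (0 : Mat R k m n) ** C = 0.
Proof. exact: mul0mx. Qed.

Lemma mmul0r m n p (A : Mat R k m n) : A ** (0 : Mat R k n p) = 0.
Proof. exact: mulmx0. Qed.

Lemma mmul1l m n (A : Mat R k m n) : idm ** A = A.
Proof. exact: mul1mx. Qed.

Lemma mmul1r m n (A : Mat R k m n) : A ** idm = A.
Proof. exact: mulmx1. Qed.

Lemma ctrE m n (A : Mat R k m n) i j : ctr A i j = sconj (A j i).
Proof. by rewrite !mxE. Qed.

Lemma ctrK m n (A : Mat R k m n) : ctr (ctr A) = A.
Proof. by apply/matrixP => i j; rewrite !ctrE sconjK. Qed.

Lemma ctrD m n (A B : Mat R k m n) : ctr (A + B) = ctr A + ctr B.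
Proof. by apply/matrixP => i j; rewrite ctrE !mxE rmorphD. Qed.

Lemma ctrN m n (A : Mat R k m n) : ctr (- A) = - ctr A.
Proof. by apply/matrixP => i j; rewrite ctrE !mxE rmorphN. Qed.

Lemma ctrZ m n a (A : Mat R k m n) : ctr (a *: A) = a *: ctr A.
Proof.
by apply/matrixP => i j; rewrite ctrE !mxE rmorphM/= sconj_real.
Qed.

Lemma ctr1 p : ctr (idm : Mat R k p p) = idm.
Proof.
apply/matrixP => i j; rewrite ctrE !mxE eq_sym.
by rewrite rmorphMn rmorph1.
Qed.

Lemma ctrM m n p (A : Mat R k m n) (B : Mat R k n p) :
  ctr (A ** B) = ctr B ** ctr A.
Proof.
apply/matrixP => i j; rewrite ctrE !mmulE rmorph_sum.
by apply: eq_bigr => l _; rewrite /= !ctrE rmorphM mulrC.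
Qed.

Lemma ctr0 m n : ctr (0 : Mat R k m n) = 0.
Proof. by apply/matrixP => i j; rewrite ctrE !mxE rmorph0. Qed.

Lemma mdot_sum m n (A B : Mat R k m n) :
  mdot A B = \sum_i \sum_j sRe (sconj (A i j) * B i j).
Proof. by rewrite mdotE exchange_big. Qed.

Lemma mdot_mull m n p (A : Mat R k m n) (B : Mat R k n p) (C : Mat R k m p) :
  mdot (A ** B) C = mdot B (ctr A ** C).
Proof.
by rewrite /mdot -[ctr _ *m C]/(ctr (A ** B) ** C) ctrM -mmulA.
Qed.

Lemma mdot_ctr m n (A B : Mat R k m n) : mdot (ctr A) (ctr B) = mdot A B.
Proof.
rewrite mdotE mdot_sum.
do 2! apply: eq_bigr => ? _.
by rewrite !ctrE sconjK mulrC sRe_conjMC sRe_conjMC mulrC.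
Qed.

Lemma mdot_mulr m n p (A : Mat R k m n) (B : Mat R k n p) (C : Mat R k m p) :
  mdot (A ** B) C = mdot A (C ** ctr B).
Proof. by rewrite -mdot_ctr ctrM mdot_mull -mdot_ctr ctrM !ctrK. Qed.

Lemma normE m n (A : Mat R k m n) : `|A| = mnorm A.
Proof. by []. Qed.

Lemma norm_sqr m n (A : Mat R k m n) : `|A| ^+ 2 = mdot A A.
Proof. by rewrite normE sqr_mnorm. Qed.

Lemma norm_sqr_sum m n (A : Mat R k m n) :
  `|A| ^+ 2 = \sum_i \sum_j smod (A i j) ^+ 2.
Proof.
by rewrite norm_sqr mdot_sum; do 2! apply: eq_bigr => ? _; rewrite smod_sqr.
Qed.

Lemma norm_ctr m n (A : Mat R k m n) : `|ctr A| = `|A|.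
Proof. by rewrite !normE /mnorm mdot_ctr. Qed.

Lemma smod_le_norm m n (A : Mat R k m n) i j : smod (A i j) <= `|A|.
Proof.
rewrite -(@ler_pXn2r _ 2)// ?nnegrE ?smod_ge0// norm_sqr_sum.
rewrite (bigD1 i)//= (bigD1 j)//= -addrA lerDl addr_ge0// ?sumr_ge0// => *.
  by rewrite exprn_ge0 ?smod_ge0.
by rewrite sumr_ge0// => *; rewrite exprn_ge0 ?smod_ge0.
Qed.

Lemma norm_le_sum m n (A : Mat R k m n) :
  `|A| <= \sum_i \sum_j smod (A i j).
Proof.
have sum_sqr (I : finType) (F : I -> R) : (forall i, 0 <= F i) ->
    \sum_i F i ^+ 2 <= (\sum_i F i) ^+ 2.
  move=> F0; rewrite (expr2 (\sum_i F i)) mulr_suml; apply: ler_sum => i _.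
  rewrite expr2 ler_wpM2l// (bigD1 i)//= lerDl sumr_ge0//.
rewrite -(@ler_pXn2r _ 2)// ?nnegrE//; last first.
  by do 2! (apply: sumr_ge0 => ? _); exact: smod_ge0.
rewrite norm_sqr_sum; apply: le_trans (sum_sqr _ _ _); last first.
  by move=> i; apply: sumr_ge0 => *; exact: smod_ge0.
by apply: ler_sum => i _; apply: sum_sqr => j; exact: smod_ge0.
Qed.

Lemma norm_le_entries m n (A : Mat R k m n) (C : R) :
  (forall i j, smod (A i j) <= C) -> `|A| <= (m * n)%:R * C.
Proof.
move=> AC; apply: (le_trans (norm_le_sum A)).
have : \sum_(i < m) \sum_(j < n) smod (A i j) <= \sum_(i < m) \sum_(j < n) C.
  by apply: ler_sum => i _; apply: ler_sum => j _.
move/le_trans; apply.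
by rewrite !sumr_const !card_ord -mulrnA mulnC -[_ *+ _]mulr_natl.
Qed.

End MatrixTheory.

Lemma real_cauchy_schwarz (R : realType) p (a b : 'I_p -> R) :
  (\sum_i a i * b i) ^+ 2 <= (\sum_i a i ^+ 2) * (\sum_i b i ^+ 2).
Proof.
pose A : Rvec R p := \col_i a i; pose B : Rvec R p := \col_i b i.
have AB : mdot A B = \sum_i a i * b i.
  by rewrite mdotE big_ord1; apply: eq_bigr => i _; rewrite !mxE.
have AA : mdot A A = \sum_i a i ^+ 2.
  by rewrite mdotE big_ord1; apply: eq_bigr => i _; rewrite !mxE expr2.
have BB : mdot B B = \sum_i b i ^+ 2.
  by rewrite mdotE big_ord1; apply: eq_bigr => i _; rewrite !mxE expr2.
rewrite -AA -BB -AB -!sqr_mnorm -exprMn.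
have h1 := mdot_le A B; have := mdot_le (- A) B.
rewrite -[in mdot _ _]scaleN1r mdotZl mulN1r.
have -> : mnorm (- A) = mnorm A by rewrite -!normE normrN.
move=> h2.
rewrite -real_normK ?num_real// ler_pXn2r// ?nnegrE ?mulr_ge0 ?sqrtr_ge0//.
by rewrite ler_norml h1 lerNl h2.
Qed.

Lemma norm_mmul (R : realType) k m n p (A : Mat R k m n) (B : Mat R k n p) :
  `|mmul A B| <= `|A| * `|B|.
Proof.
rewrite -(@ler_pXn2r _ 2)// ?nnegrE ?mulr_ge0// exprMn !norm_sqr_sum.
rewrite mulr_suml; apply: ler_sum => i _.
rewrite [X in _ * X]exchange_big mulr_sumr; apply: ler_sum => j _.
apply: le_trans (real_cauchy_schwarz _ _).
rewrite ler_pXn2r// ?nnegrE ?smod_ge0//; last first.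
  by apply: sumr_ge0 => *; rewrite mulr_ge0 ?smod_ge0.
rewrite mmulE; apply: (le_trans (smod_sum _ _ _)).
by apply: ler_sum => l _; rewrite smodM.
Qed.

(** * Unitary matrices and a real basis *)

Section Unitary.
Context {R : realType} {k : entries}.
Implicit Types (m n p q : nat).

Lemma unitary_ctrr p (U : Mat R k p p) : orthogonal_mx U -> U ** ctr U = idm.
Proof. by []. Qed.

Lemma unitary_ctrl p (U : Mat R k p p) : orthogonal_mx U -> ctr U ** U = idm.
Proof. exact: mulmx1C. Qed.

Lemma unitary_ctr p (U : Mat R k p p) :
  orthogonal_mx U -> orthogonal_mx (ctr U).
Proof. by move=> /unitary_ctrl uU; rewrite /orthogonal_mx ctrK. Qed.

Lemma unitaryM p (U V : Mat R k p p) :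
  orthogonal_mx U -> orthogonal_mx V -> orthogonal_mx (U ** V).
Proof.
move=> uU uV; rewrite /orthogonal_mx -[LHS]/(U ** V ** ctr (U ** V)) ctrM.
by rewrite -mmulA (mmulA V) (unitary_ctrr uV) mmul1l.
Qed.

Lemma unitary1 p : orthogonal_mx (idm : Mat R k p p).
Proof. by rewrite /orthogonal_mx -[LHS]/(idm ** ctr idm) ctr1 mmul1l. Qed.

Lemma norm_unitaryl p n (U : Mat R k p p) (X : Mat R k p n) :
  orthogonal_mx U -> `|U ** X| = `|X|.
Proof.
by move=> uU; rewrite !normE /mnorm mdot_mull mmulA unitary_ctrl// mmul1l.
Qed.

Lemma norm_unitaryr p n (V : Mat R k n n) (X : Mat R k p n) :
  orthogonal_mx V -> `|X ** V| = `|X|.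
Proof.
by move=> uV; rewrite -norm_ctr ctrM norm_unitaryl ?norm_ctr//; exact: unitary_ctr.
Qed.

Lemma unitary_row p (U : Mat R k p p) i :
  orthogonal_mx U -> \sum_j smod (U i j) ^+ 2 = 1.
Proof.
move=> /unitary_ctrr/matrixP/(_ i i)/(congr1 (@sRe R k)).
rewrite mmulE raddf_sum/= => h.
rewrite (_ : 1 = sRe ((idm : Mat R k p p) i i)); last first.
  by rewrite mxE eqxx -(rmorph1 (@of_real R k)) sRe_real.
rewrite -h; apply: eq_bigr => j _.
by rewrite ctrE mulrC conjM_smod sRe_real.
Qed.

Lemma unitary_col p (U : Mat R k p p) j :
  orthogonal_mx U -> \sum_i smod (U i j) ^+ 2 = 1.
Proof.
move=> /unitary_ctr uU; rewrite -(unitary_row j uU).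
by apply: eq_bigr => i _; rewrite ctrE smod_conj.
Qed.

Lemma unitary_entry p (U : Mat R k p p) i j :
  orthogonal_mx U -> smod (U i j) <= 1.
Proof.
move=> uU; rewrite -(@ler_pXn2r _ 2)// ?nnegrE ?smod_ge0// expr1n.
rewrite -(unitary_row i uU) (bigD1 j)//= lerDl sumr_ge0// => *.
by rewrite exprn_ge0 ?smod_ge0.
Qed.

Lemma norm_unitary p (U : Mat R k p p) : orthogonal_mx U -> `|U| <= p%:R.
Proof.
move=> uU; rewrite -(@ler_pXn2r _ 2)// ?nnegrE// norm_sqr_sum.
rewrite (eq_bigr (fun=> 1)); last by move=> i _; rewrite unitary_row.
rewrite sumr_const card_ord -natrX ler_nat.
by case: p U uU => // p; rewrite expnS leq_pmulr// expn_gt0.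
Qed.

End Unitary.

Section RealBasis.
Context {R : realType} {k : entries}.

(* Over the reals the second family of basis vectors is zero. *)
Definition sunit (b : bool) : Defs.scalar R k :=
  match k return Defs.scalar R k with
  | RealEntries => (~~ b)%:R
  | ComplexEntries => if b then Complex 0 1 else 1
  end.

Lemma sunitE (x : Defs.scalar R k) :
  x = \sum_b of_real k (sRe (sconj (sunit b) * x)) * sunit b.
Proof.
rewrite big_bool/=; rewrite /sunit; case: k x => [x|[a b]] /=.
  by rewrite !mul0r mul1r mulr1 add0r.
by congr Complex => /=; ring.
Qed.

Lemma smod_sunit b : smod (sunit b) <= 1.
Proof.
rewrite /smod /sunit; case: k b => -[] /=;
  by rewrite -[X in _ <= X]sqrtr1 ler_wsqrtr//; lra.
Qed.

Definition ebasis m n (l : 'I_m * 'I_n * bool) : Mat R k m n :=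
  \matrix_(i, j) (if (i == l.1.1) && (j == l.1.2) then sunit l.2 else 0).

Lemma mdot_ebasis m n l (X : Mat R k m n) :
  mdot (ebasis l) X = sRe (sconj (sunit l.2) * X l.1.1 l.1.2).
Proof.
rewrite mdot_sum (bigD1 l.1.1)//= [X in _ + X]big1 ?addr0; last first.
  move=> i /negbTE il; apply: big1 => j _.
  by rewrite mxE il rmorph0 mul0r raddf0.
rewrite (bigD1 l.1.2)//= [X in _ + X]big1 ?addr0.
  by rewrite mxE !eqxx.
by move=> j /negbTE jl; rewrite mxE jl andbF rmorph0 mul0r raddf0.
Qed.

(** By [sunitE] the expansion holds entrywise, also over the reals, where half of the family is
    zero. So linear maps can be built and bounded through one finite family for both kinds of
    entries. *)
Lemma ebasisE m n (X : Mat R k m n) :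
  X = \sum_l mdot (ebasis l) X *: ebasis l.
Proof.
apply/matrixP => i j.
have -> : (\sum_l mdot (ebasis l) X *: ebasis l : Mat R k m n) i j =
    \sum_l (mdot (ebasis l) X *: ebasis l : Mat R k m n) i j.
  exact: summxE.
rewrite -(pair_bigA _ (fun ij b =>
  (mdot (ebasis (ij, b)) X *: ebasis (ij, b) : Mat R k m n) i j))/=.
rewrite (bigD1 (i, j))//= [X in _ + X]big1 ?addr0.
  rewrite [LHS](sunitE (X i j)); apply: eq_bigr => b _.
  by rewrite !mxE !eqxx mdot_ebasis.
move=> [i' j'] /= ij; apply: big1 => b _; rewrite !mxE/=.
have /negbTE -> : ~~ ((i == i') && (j == j')).
  by apply: contra ij => /andP[/eqP -> /eqP ->].
by rewrite mulr0.
Qed.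

Lemma norm_ebasis m n (l : 'I_m * 'I_n * bool) : `|ebasis l| <= 1.
Proof.
rewrite -(@ler_pXn2r _ 2)// ?nnegrE// expr1n norm_sqr mdot_ebasis.
rewrite mxE !eqxx/= -smod_sqr -[leRHS](expr1n _ 2).
by rewrite ler_pXn2r// ?nnegrE ?smod_ge0// smod_sunit.
Qed.

Lemma mdot_ebasis_le m n (l : 'I_m * 'I_n * bool) X :
  `|mdot (ebasis l) X| <= `|X|.
Proof.
have h Y : mdot (ebasis l) Y <= `|Y|.
  by rewrite (le_trans (mdot_le _ _))// -!normE ler_piMl// norm_ebasis.
rewrite ler_norml h andbT lerNl -mulN1r -mdotZr scaleN1r.
by rewrite (le_trans (h _))// normrN.
Qed.

Context {m n : nat} {W : normedModType R}.
Implicit Type D : Mat R k m n -> W.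

Lemma linear_sumE D : linear D ->
  forall (I : finType) (c : I -> R) (F : I -> Mat R k m n),
  D (\sum_i c i *: F i) = \sum_i c i *: D (F i).
Proof.
move=> lD I c F.
have D0 : D 0 = 0.
  by have := lD (-1) 0 0; rewrite scaler0 addr0 scaleN1r addNr.
elim: (index_enum I) => [|i s IH]; first by rewrite !big_nil.
by rewrite !big_cons lD IH.
Qed.

Lemma linear_le_basis D (C : R) : linear D -> 0 <= C ->
  (forall l, `|D (ebasis l)| <= C) ->
  forall X, `|D X| <= #|{: 'I_m * 'I_n * bool}|%:R * C * `|X|.
Proof.
move=> lD C0 DC X; rewrite {1}(ebasisE X) linear_sumE//.
apply: (le_trans (ler_norm_sum _ _ _)).
have : \sum_l `|mdot (ebasis l) X *: D (ebasis l)| <=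
    \sum_(l : 'I_m * 'I_n * bool) (C * `|X|).
  apply: ler_sum => l _; rewrite normrZ mulrC ler_pM//.
  exact: mdot_ebasis_le.
by move/le_trans; apply; rewrite sumr_const -[_ *+ _]mulr_natl mulrA.
Qed.

Lemma linear_bounded D : linear D ->
  exists2 C, 0 < C & forall X, `|D X| <= C * `|X|.
Proof.
move=> lD; pose C := \sum_l `|D (ebasis l)|.
have C0 : 0 <= C by exact: sumr_ge0.
exists (#|{: 'I_m * 'I_n * bool}|%:R * C + 1).
  by rewrite ltr_wpDl ?mulr_ge0.
move=> X; rewrite mulrDl ler_wpDr// ?mul1r//.
apply: linear_le_basis => // l.
by rewrite /C (bigD1 l)//= lerDl sumr_ge0.
Qed.

End RealBasis.
Arguments ebasis {R k m n}.

(** * Continuity, compactness and Fréchet derivatives *)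

Section Continuity.
Context {R : realType} {k : entries}.
Implicit Types (m n p q : nat).

Lemma cvg_mmul (T : Type) (F : set_system T) {FF : Filter F} m n p
    (f : T -> Mat R k m n) (g : T -> Mat R k n p) A B :
  f @ F --> A -> g @ F --> B -> (fun x => f x ** g x) @ F --> (A ** B).
Proof.
move=> fA gB.
have fA0 : (fun x => `|f x - A|) @ F --> (0 : R).
  by apply/norm_cvg0P; exact/subr_cvg0.
have gB0 : (fun x => `|g x - B|) @ F --> (0 : R).
  by apply/norm_cvg0P; exact/subr_cvg0.
apply/subr_cvg0/norm_cvg0P.
pose h x := `|f x - A| * `|g x - B| + `|A| * `|g x - B| + `|f x - A| * `|B|.
apply: (squeeze_cvgr (f := cst 0) (h := h)).
- apply: nearW => x; rewrite /cst normr_ge0/= /h.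
  have -> : f x ** g x - A ** B =
      (f x - A) ** (g x - B) + A ** (g x - B) + (f x - A) ** B.
    by rewrite -mmulDl subrK mmulBl mmulBr addrA subrK.
  apply: (le_trans (ler_normD _ _)); apply: lerD; last exact: norm_mmul.
  by apply: (le_trans (ler_normD _ _)); apply: lerD; exact: norm_mmul.
- exact: cvg_cst.
- rewrite (_ : 0 = 0 * 0 + `|A| * 0 + 0 * `|B| :> R); last by rewrite !(mul0r,mulr0) !addr0.
  apply: cvgD; first apply: cvgD.
  + exact: cvgM.
  + by apply: cvgM => //; exact: cvg_cst.
  + by apply: cvgM => //; exact: cvg_cst.
Qed.

Lemma cvg_ctr (T : Type) (F : set_system T) {FF : Filter F} m n
    (f : T -> Mat R k m n) A :
  f @ F --> A -> (fun x => ctr (f x)) @ F --> ctr A.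
Proof.
move=> fA; apply/cvgrPdist_lt => e e0.
move/cvgrPdist_lt : fA => /(_ e e0); apply: filterS => x.
by rewrite -ctrN -ctrD norm_ctr.
Qed.

Lemma cvg_mdot (T : Type) (F : set_system T) {FF : Filter F} m n
    (K : Mat R k m n) (f : T -> Mat R k m n) A :
  f @ F --> A -> (fun x => mdot K (f x)) @ F --> mdot K A.
Proof.
move=> fA; apply/cvgrPdist_lt => e e0.
have d0 : 0 < e / (`|K| + 1) by rewrite divr_gt0// ltr_wpDl.
move/cvgrPdist_lt : fA => /(_ _ d0); apply: filterS => x xd.
have h Y : mdot K Y <= `|K| * `|Y| by exact: mdot_le.
have {}h Y : `|mdot K Y| <= `|K| * `|Y|.
  by rewrite ler_norml h andbT lerNl -mulN1r -mdotZr scaleN1r (le_trans (h _)) ?normrN.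
rewrite -mulN1r -mdotZr scaleN1r -mdotDr (le_lt_trans (h _))//.
rewrite (@le_lt_trans _ _ ((`|K| + 1) * `|A - f x|))//.
  by rewrite ler_wpM2r// lerDl.
by rewrite mulrC -ltr_pdivlMr// ltr_wpDl.
Qed.

(** The coefficients of [X] in [ebasis] are at most [|X|], so the ball is a closed subset of the
    image of a cube under the continuous map [T]. *)
Lemma closed_ball_mat_compact m n (r : R) :
  compact [set X : Mat R k m n | `|X| <= r].
Proof.
pose I := ('I_m * 'I_n * bool)%type.
pose T (v : 'rV[R]_#|{: I}|) : Mat R k m n :=
  \sum_(l : I) v ord0 (enum_rank l) *: ebasis l.
have Tc : continuous T.
  rewrite /T; elim: (index_enum _) => [|l s IH].
    rewrite (_ : (fun _ => _) = fun=> 0); first exact: cst_continuous.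
    by apply/funext => v; rewrite big_nil.
  rewrite (_ : (fun _ => _) = fun v : 'rV[R]_#|{: I}| =>
    v ord0 (enum_rank l) *: ebasis l +
    \sum_(l <- s) v ord0 (enum_rank l) *: ebasis l); last first.
    by apply/funext => v; rewrite big_cons.
  have cl : continuous (fun v : 'rV[R]_#|{: I}| =>
      v ord0 (enum_rank l) *: (ebasis l : Mat R k m n)).
    move=> v; have := (@coord_continuous R 1 _ ord0 (enum_rank l)) v.
    move=> h.
    exact: (@cvgZr_tmp _ _ _ _ (nbhs_filter v) _ _ _ h).
  by move=> v; exact: cvgD (cl v) (IH v).
pose B := [set v : 'rV[R]_#|{: I}| | forall i, `[-r, r]%classic (v ord0 i)].
have cB : compact B.
  by apply: (@rV_compact _ _ (fun=> `[-r, r]%classic)) => _; exact: segment_compact.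
have cTB : compact (T @` B).
  by apply: continuous_compact => //; exact: continuous_subspaceT.
apply: (subclosed_compact _ cTB).
- apply: (@preimage_closed _ _ (fun X : Mat R k m n => `|X|) [set x : R | x <= r]).
  + by move=> X _; exact: norm_continuous.
  + exact: closed_le.
- move=> X /= Xr; exists (\row_i mdot (ebasis (enum_val i)) X).
    move=> i; rewrite /= mxE in_itv/= -ler_norml.
    exact: le_trans (mdot_ebasis_le _ _) Xr.
  rewrite /T [RHS]ebasisE; apply: eq_bigr => l _.
  by rewrite mxE enum_rankK.
Qed.

Lemma mat_closed_set1 m n (X : Mat R k m n) : closed [set X].
Proof.
by apply/accessible_closed_set1/hausdorff_accessible; exact: norm_hausdorff.
Qed.

Lemma unitary_closed p : closed [set U : Mat R k p p | orthogonal_mx U].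
Proof.
have -> : [set U : Mat R k p p | orthogonal_mx U] =
    (fun U : Mat R k p p => U ** ctr U) @^-1` [set idm] by [].
apply: preimage_closed; last exact: mat_closed_set1.
move=> U _; apply: (@cvg_mmul _ (nbhs U) (nbhs_filter U)); first exact: cvg_id.
by apply: (@cvg_ctr _ (nbhs U) (nbhs_filter U)); exact: cvg_id.
Qed.

Lemma unitary_pairs_compact p q :
  compact [set UV : Mat R k p p * Mat R k q q |
    orthogonal_mx UV.1 /\ orthogonal_mx UV.2].
Proof.
have c r : compact [set U : Mat R k r r | orthogonal_mx U].
  apply: (subclosed_compact (@unitary_closed r)
    (@closed_ball_mat_compact r r r%:R)).
  by move=> U /= /norm_unitary.
exact: compact_setX (c p) (c q).
Qed.

Lemma cvg_rotate (T : Type) (F : set_system T) {FF : Filter F} m n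
    (D : Mat R k m n) (f : T -> Mat R k m m) (g : T -> Mat R k n n) U V :
  f @ F --> U -> g @ F --> V ->
  (fun x => f x ** D ** ctr (g x)) @ F --> (U ** D ** ctr V).
Proof.
by move=> fU gV; apply: cvg_mmul; [apply: cvg_mmul => //; exact: cvg_cst|exact: cvg_ctr].
Qed.

End Continuity.

Ltac mring := apply/matrixP => ? ?; rewrite !mxE; ring.

Section Frechet.
Context {R : realType} {k k' : entries} {m n m' n' : nat}.
Local Notation V := (Mat R k m n).
Local Notation W := (Mat R k' m' n').
Implicit Types (F : V -> W) (D : V -> W).

(** The derivative is explicit data, an ordinary function with a proof of linearity; its continuity,
    which [differentiable] demands, is automatic by [linear_bounded]. *)
Definition has_diff F z D := linear D /\
  forall e : R, 0 < e -> exists2 d, 0 < d &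
    forall h, `|h| < d -> `|F (z + h) - F z - D h| <= e * `|h|.

Lemma has_diffP F z D :
  has_diff F z D <-> differentiable F z /\ 'd F z = D :> (V -> W).
Proof.
split=> [[lD FD]|[dF <-]]; last first.
  split; first exact: linearP.
  move=> e e0; have /diff_locallyxC/eqaddoEx := dF.
  have := diff_locallyP z F => -[/(_ dF)[_ +] _].
  move=> /eqaddoP/(_ e e0)/nbhs_norm0P[d d0 dh] _; exists d => // h hd.
  have := dh h hd.
  rewrite /= -![(_ + _ : _ -> _) _]/(_ + _) -![(- _ : _ -> _) _]/(- _)/=.
  by rewrite /cst /shift/= [h + z]addrC opprD addrA.
pose L0 := GRing.isLinear.Build R V W *:%R D lD.
pose L : {linear V -> W} := HB.pack D L0.
have Lc : continuous (L : V -> W).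
  apply: bounded_linear_continuous.
  have [C C0 DC] := linear_bounded lD.
  apply/linear_boundedP; exists C; split; first exact: num_real.
  move=> r Cr x; rewrite (le_trans (DC x))// ler_wpM2r// ltW//.
have FL : F \o shift z = cst (F z) + L +o_ 0 id.
  apply/eqaddoP => e e0; apply/nbhs_norm0P.
  have [d d0 dh] := FD _ e0; exists d => // h /dh.
  rewrite /= -![(_ + _ : _ -> _) _]/(_ + _) -![(- _ : _ -> _) _]/(- _)/=.
  by rewrite /cst /shift/= [h + z]addrC opprD addrA.
have dL : 'd F z = L :> (V -> W) by exact: diff_unique.
split; last by rewrite dL.
by apply/diff_locallyP; rewrite dL.
Qed.

Lemma has_diff_differentiable F z D : has_diff F z D -> differentiable F z.
Proof. by case/has_diffP. Qed.

Lemma has_diff_diff F z D : has_diff F z D -> 'd F z = D :> (V -> W).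
Proof. by case/has_diffP. Qed.

Lemma differentiable_has_diff F z : differentiable F z -> has_diff F z ('d F z).
Proof. by move=> dF; apply/has_diffP. Qed.

Lemma lin0 D : linear D -> D 0 = 0.
Proof. by move=> lD; have := lD (-1) 0 0; rewrite scaler0 addr0 scaleN1r addNr. Qed.

Lemma linZ D a x : linear D -> D (a *: x) = a *: D x.
Proof. by move=> lD; rewrite -[a *: x]addr0 lD lin0// addr0. Qed.

Lemma linD D x y : linear D -> D (x + y) = D x + D y.
Proof. by move=> lD; have := lD 1 x y; rewrite !scale1r. Qed.

Lemma linN D x : linear D -> D (- x) = - D x.
Proof. by move=> lD; rewrite -scaleN1r linZ// scaleN1r. Qed.

Lemma linB D x y : linear D -> D (x - y) = D x - D y.
Proof. by move=> lD; rewrite linD// linN. Qed.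

Lemma has_diffB F F' z D D' : has_diff F z D -> has_diff F' z D' ->
  has_diff (fun x => F x - F' x) z (fun h => D h - D' h).
Proof.
move=> [lD FD] [lD' FD']; split.
  by move=> a x y; rewrite lD lD' scalerBr opprD addrACA.
move=> e e0; have e20 : 0 < e / 2 by rewrite divr_gt0.
have [d d0 dF] := FD _ e20; have [d' d'0 dF'] := FD' _ e20.
exists (Num.min d d'); first by rewrite lt_min d0.
move=> h; rewrite lt_min => /andP[/dF h1 /dF' h2].
rewrite [e]splitr mulrDl; apply: le_trans (lerD h1 h2).
rewrite (_ : _ - _ = (F (z + h) - F z - D h) - (F' (z + h) - F' z - D' h)).
  exact: ler_normB.
mring.
Qed.

Lemma has_diff_dir F z D h e : has_diff F z D -> 0 < e ->
  exists2 d, 0 < d & forall t, 0 < t -> t < d ->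
    `|F (z + t *: h) - F z - t *: D h| <= e * t.
Proof.
move=> [lD FD] e0; have h0 : 0 < `|h| + 1 by rewrite ltr_wpDl.
have [d d0 dF] := FD _ (divr_gt0 e0 h0).
exists (d / (`|h| + 1)); first exact: divr_gt0.
move=> t t0; rewrite ltr_pdivlMr// => td.
have th : `|t *: h| = t * `|h| by rewrite normrZ gtr0_norm.
have := dF (t *: h); rewrite linZ// th => /(_ _)/le_trans; apply.
  by apply: le_lt_trans td; rewrite ler_wpM2l ?(ltW t0)// lerDl.
rewrite (_ : e / (`|h| + 1) * (t * `|h|) = e * t * (`|h| / (`|h| + 1))).
by rewrite ler_piMr ?mulr_ge0 ?(ltW e0) ?(ltW t0)// ler_pdivrMr// mul1r lerDl.
by ring.
Qed.

(** Increments along one ray are enough, so this applies where [F] is controlled merely on a set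
    containing that ray, such as the normal slice. *)
Lemma has_diff_dir_le F z D h (c d : R) : has_diff F z D -> 0 < d ->
  (forall t, 0 < t -> t < d -> `|F (z + t *: h) - F z| <= c * t) ->
  `|D h| <= c.
Proof.
move=> FD d0 Fc; apply/ler_addgt0Pr => e e0.
have [d' d'0 dF] := has_diff_dir h FD e0.
pose t := Num.min d d' / 2.
have t0 : 0 < t by rewrite divr_gt0// lt_min d0.
have : t < Num.min d d' by rewrite ltr_pdivrMr// ltr_pMr ?lt_min ?d0// ltr1n.
rewrite lt_min => /andP[/(Fc _ t0) h1 /(dF _ t0) h2].
rewrite -(@ler_pM2r _ t)// mulrDl.
rewrite -[X in _ * X](gtr0_norm t0) mulrC -normrZ.
rewrite -[t *: D h](subKr (F (z + t *: h) - F z)).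
by rewrite (le_trans (ler_normB _ _))// lerD.
Qed.

Lemma has_diff_dir_eq F z D h w (c d : R) : has_diff F z D -> 0 < d ->
  (forall t, 0 < t -> t < d -> `|F (z + t *: h) - F z - t *: w| <= c * t ^+ 2) ->
  D h = w.
Proof.
move=> FD d0 Fc; apply/subr0_eq/eqP.
rewrite -normr_le0; apply/ler_addgt0Pr => e e0; rewrite add0r.
have e20 : 0 < e / 2 by rewrite divr_gt0.
have [d' d'0 dF] := has_diff_dir h FD e20.
have c0 : 0 < `|c| + 1 by rewrite ltr_wpDl.
(* The last bound on [t] makes the quadratic error [c * t ^+ 2] at most half of [e * t]; [|c| + 1]
   keeps the denominator positive. *)
pose m1 := Num.min (Num.min d d') (e / 2 / (`|c| + 1)).
have m10 : 0 < m1 by rewrite !lt_min d0 d'0 divr_gt0.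
pose t := m1 / 2.
have t0 : 0 < t by rewrite divr_gt0.
have : t < m1 by rewrite ltr_pdivrMr// ltr_pMr// ltr1n.
rewrite !lt_min -andbA => /and3P[/(Fc _ t0) h1 /(dF _ t0) h2].
rewrite ltr_pdivlMr// => tc.
rewrite -(@ler_pM2r _ t)//.
rewrite -[X in _ * X](gtr0_norm t0) mulrC -normrZ scalerBr.
rewrite (_ : _ - _ = (F (z + t *: h) - F z - t *: w) -
  (F (z + t *: h) - F z - t *: D h)); last first.
  mring.
rewrite (le_trans (ler_normB _ _))// [e in leRHS]splitr mulrDl lerD//.
rewrite (le_trans h1)// expr2 mulrA ler_wpM2r ?(ltW t0)//.
apply/ltW; apply: le_lt_trans tc; rewrite mulrC ler_wpM2l ?(ltW t0)//.
by rewrite (le_trans (ler_norm c))// lerDl.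
Qed.

End Frechet.

(** * Rectangular diagonal matrices and Cayley transforms *)

Lemma mdotNr (R : realType) (k : entries) m n (X Y : Mat R k m n) :
  mdot X (- Y) = - mdot X Y.
Proof. by rewrite -scaleN1r mdotZr mulN1r. Qed.

Section RectDiag.
Context {R : realType} {k : entries} {m q : nat}.
Implicit Types (s x y : Rvec R m) (a : R).
Local Notation rd := (@rect_diag R k m (m + q)).

Lemma rdl s i j :
  rd s i (lshift q j) = if i == j then of_real k (s i 0) else 0.
Proof. by rewrite mxE. Qed.

Lemma rdr s i (j : 'I_q) : rd s i (rshift m j) = 0.
Proof. by rewrite mxE/= ltn_eqF// ltn_addr. Qed.

Lemma mmul_rdl p (A : Mat R k p m) s i j :
  (A ** rd s) i (lshift q j) = A i j * of_real k (s j 0).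
Proof.
rewrite mmulE (bigD1 j)//= big1 ?addr0 => [|l /negbTE lj]; rewrite rdl ?eqxx//.
by rewrite lj mulr0.
Qed.

Lemma mmul_rdr p (A : Mat R k p m) s i (j : 'I_q) :
  (A ** rd s) i (rshift m j) = 0.
Proof. by rewrite mmulE big1// => l _; rewrite rdr mulr0. Qed.

Lemma rd_mmul p (B : Mat R k (m + q) p) s i j :
  (rd s ** B) i j = of_real k (s i 0) * B (lshift q i) j.
Proof.
rewrite mmulE big_split_ord/= [X in _ + X]big1 ?addr0; last first.
  by move=> l _; rewrite rdr mul0r.
rewrite (bigD1 i)//= big1 ?addr0 => [|l li]; rewrite rdl ?eqxx//.
by rewrite eq_sym (negbTE li) mul0r.
Qed.

Lemma mmul_ctr_rd p (B : Mat R k p (m + q)) s i j :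
  (B ** ctr (rd s)) i j = B i (lshift q j) * of_real k (s j 0).
Proof.
by rewrite -[B]ctrK -ctrM ctrE rd_mmul rmorphM/= sconj_real mulrC !ctrE.
Qed.

Lemma ctr_rd_mmull p (A : Mat R k m p) s i j :
  (ctr (rd s) ** A) (lshift q i) j = of_real k (s i 0) * A i j.
Proof.
by rewrite -[A]ctrK -ctrM ctrE mmul_rdl rmorphM/= sconj_real mulrC !ctrE.
Qed.

Lemma ctr_rd_mmulr p (A : Mat R k m p) s (i : 'I_q) j :
  (ctr (rd s) ** A) (rshift m i) j = 0.
Proof. by rewrite -[A]ctrK -ctrM ctrE mmul_rdr rmorph0. Qed.

Lemma matP (X Y : Mat R k m (m + q)) :
  (forall i j, X i (lshift q j) = Y i (lshift q j)) ->
  (forall i j, X i (rshift m j) = Y i (rshift m j)) -> X = Y.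
Proof.
move=> hl hr; apply/matrixP => i j.
by case: (split_ordP j) => j' ->; rewrite ?hl ?hr.
Qed.

Lemma rd_linear : linear (rd : Rvec R m -> Mat R k m (m + q)).
Proof.
move=> a x y.
have E (X Y : Mat R k m (m + q)) i j :
    (a *: X + Y) i j = of_real k a * X i j + Y i j by rewrite !mxE.
apply/matP => i j; rewrite E ?rdr ?mulr0 ?addr0//.
rewrite !rdl !mxE; case: eqP => _; last by rewrite mulr0 addr0.
by rewrite rmorphD rmorphM.
Qed.

Lemma rdD x y : rd (x + y) = rd x + rd y.
Proof. exact/(linD _ _ rd_linear). Qed.

Lemma rdB x y : rd (x - y) = rd x - rd y.
Proof. exact/(linB _ _ rd_linear). Qed.

Lemma rdZ a x : rd (a *: x) = a *: rd x.
Proof. exact/(linZ _ _ rd_linear). Qed.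

Lemma rd0 : rd 0 = 0.
Proof. exact/(lin0 rd_linear). Qed.

Lemma norm_rd s : `|rd s| = `|s|.
Proof.
apply/eqP; rewrite -(@eqrXn2 _ 2)//; apply/eqP; rewrite !norm_sqr_sum.
apply: eq_bigr => i _; rewrite big_split_ord/= [X in _ + X]big1 ?addr0.
  rewrite (bigD1 i)//= big1 ?addr0 => [|l li].
    by rewrite rdl eqxx big_ord1 smod_real (@smod_real R RealEntries).
  by rewrite rdl eq_sym (negbTE li) smod0 expr0n.
by move=> j _; rewrite rdr smod0 expr0n.
Qed.

Definition diag_part (X : Mat R k m (m + q)) : Rvec R m :=
  \col_i sRe (X i (lshift q i)).

Lemma diag_part_linear : linear diag_part.
Proof.
move=> a X Y; apply/matrixP => i j; rewrite !mxE raddfD/=.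
by congr (_ + _); rewrite sReZ.
Qed.

Lemma diag_partK s : diag_part (rd s) = s.
Proof.
by apply/matrixP => i j; rewrite mxE rdl eqxx sRe_real (ord1 j).
Qed.

Lemma norm_diag_part X : `|diag_part X| <= `|X|.
Proof.
rewrite -(@ler_pXn2r _ 2)// ?nnegrE// !norm_sqr_sum; apply: ler_sum => i _.
rewrite big_ord1 big_split_ord/= (bigD1 i)//= -!addrA mxE.
rewrite ler_wpDr//; last first.
  rewrite ler_pXn2r// ?nnegrE ?smod_ge0//.
  by rewrite (@smod_real R RealEntries) sRe_le_smod.
by rewrite addr_ge0// sumr_ge0// => *; rewrite exprn_ge0 ?smod_ge0.
Qed.

End RectDiag.

Section Cayley.
Context {R : realType} {k : entries} {p : nat}.
Implicit Types A B C : Mat R k p p.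

Definition skew A := ctr A = - A.

Lemma skewZ a A : skew A -> skew (a *: A).
Proof. by move=> sA; rewrite /skew ctrZ sA scalerN. Qed.

Lemma skewD A B : skew A -> skew B -> skew (A + B).
Proof. by move=> sA sB; rewrite /skew ctrD sA sB opprD. Qed.

Lemma skew0 : skew 0.
Proof. by rewrite /skew ctr0 oppr0. Qed.

Lemma skew_sum (I : Type) (r : seq I) (F : I -> Mat R k p p) :
  (forall i, skew (F i)) -> skew (\sum_(i <- r) F i).
Proof.
move=> sF; elim: r => [|i r IH]; first by rewrite big_nil; exact: skew0.
by rewrite big_cons; exact: skewD.
Qed.

(** [idm - A] has trivial left kernel: [v = v A] gives [<v, v> = - <v, v>] because [A] is skew. *)
Lemma skew_unit A : skew A -> (idm - A : 'M[Defs.scalar R k]_p) \in unitmx.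
Proof.
move=> sA; rewrite -row_free_unit; apply: inj_row_free => v v0.
have {}v0 : (v : Mat R k 1 p) = (v : Mat R k 1 p) ** A.
  apply: subr0_eq; rewrite -[0 in RHS]v0.
  by rewrite -[RHS]/((v : Mat R k 1 p) ** (idm - A)) mmulBr mmul1r.
apply: mdot_eq0; have : mdot (v : Mat R k 1 p) v = - mdot (v : Mat R k 1 p) v.
  rewrite {1}v0 mdot_mulr sA mmulNr -v0.
  exact: mdotNr.
by move=> h; lra.
Qed.

(** A rational substitute for the matrix exponential: unitary for skew [A], and compatible with
    intertwining relations. The factors [2^-1] make [A] its first-order term. *)
Definition cayley A : Mat R k p p :=
  locked (invmx (idm - 2^-1 *: A : 'M[Defs.scalar R k]_p) *m (idm + 2^-1 *: A)).

Lemma cayley_inv A : skew A -> exists Pi : Mat R k p p,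
  [/\ Pi ** (idm - 2^-1 *: A) = idm, (idm - 2^-1 *: A) ** Pi = idm
    & (idm - 2^-1 *: A) ** cayley A = idm + 2^-1 *: A].
Proof.
move=> sA; exists (invmx (idm - 2^-1 *: A : 'M[Defs.scalar R k]_p)).
have u := skew_unit (skewZ 2^-1 sA).
split; [exact: mulVmx|exact: mulmxV|].
by rewrite /mmul /cayley -lock mulmxA mulmxV// mul1mx.
Qed.

Lemma cayley_unitary A : skew A -> orthogonal_mx (cayley A).
Proof.
move=> sA; have [Pi [PiP PPi PC]] := cayley_inv sA.
set P := idm - _ in PiP PPi PC; set Q := idm + _ in PC.
have cP : ctr P = Q by rewrite ctrD ctrN ctr1 ctrZ sA scalerN opprK.
have cPi : ctr P ** ctr Pi = idm by rewrite -ctrM PiP ctr1.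
have PQ : P ** Q = Q ** P.
  by rewrite /P /Q !(mmulDl, mmulDr) !mmul1l !mmul1r !mmulNl !mmulNr; mring.
rewrite /orthogonal_mx -[LHS]/(cayley A ** ctr (cayley A)).
have -> : cayley A = Pi ** Q by rewrite -PC mmulA PiP mmul1l.
rewrite ctrM -cP ctrK -mmulA (mmulA (ctr P)) cP -PQ -cP.
by rewrite -(mmulA P) cPi mmul1r PiP.
Qed.

(** Clearing the inverse gives [cayley A - idm = 2^-1 *: A (idm + cayley A)], and both unitary
    matrices have norm at most [p]. Inserting the bound into [cayley A - idm - A = 2^-1 *: A (cayley
    A - idm)] gives the second-order bound that follows. *)
Lemma cayley_dist1 A : skew A -> `|cayley A - idm| <= p%:R * `|A|.
Proof.
move=> sA; have [_ [_ _]] := cayley_inv sA.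
rewrite mmulBl mmul1l mmulZl => h.
have -> : cayley A - idm = 2^-1 *: (A ** (idm + cayley A)).
  rewrite mmulDr mmul1r scalerDr.
  by rewrite -[cayley A in LHS](subrK (2^-1 *: (A ** cayley A))) h; mring.
rewrite normrZ gtr0_norm ?invr_gt0// ler_pdivrMl//.
rewrite (le_trans (norm_mmul _ _))//.
have h1 := norm_unitary (@unitary1 R k p).
have h2 := norm_unitary (cayley_unitary sA).
have : `|idm + cayley A| <= p%:R + p%:R.
  by rewrite (le_trans (ler_normD _ _))// lerD.
by move=> /(ler_wpM2l (normr_ge0 A)) /le_trans; apply; lra.
Qed.

Lemma cayley_dist2 A : skew A -> `|cayley A - idm - A| <= p%:R * `|A| ^+ 2.
Proof.
move=> sA; have [_ [_ _]] := cayley_inv sA.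
rewrite mmulBl mmul1l mmulZl => h.
have -> : cayley A - idm - A = 2^-1 *: (A ** (cayley A - idm)).
  rewrite mmulBr mmul1r scalerBr.
  rewrite -[cayley A in LHS](subrK (2^-1 *: (A ** cayley A))) h.
  by rewrite [A in _ - A](_ : _ = 2^-1 *: A + 2^-1 *: A);
    [mring|rewrite -scalerDl (_ : 2^-1 + 2^-1 = 1 :> R) ?scale1r//; lra].
rewrite normrZ gtr0_norm ?invr_gt0// ler_pdivrMl//.
rewrite (le_trans (norm_mmul _ _))//.
have := ler_wpM2l (normr_ge0 A) (cayley_dist1 sA) => /le_trans; apply.
have := mulr_ge0 (ler0n R p) (sqr_ge0 `|A|).
by rewrite (_ : `|A| * (p%:R * `|A|) = p%:R * `|A| ^+ 2); [lra|ring].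
Qed.

End Cayley.

Section Rotation.
Context {R : realType} {k : entries} {p r : nat}.
Implicit Types (A : Mat R k p p) (B : Mat R k r r) (X D : Mat R k p r).

(** Infinitesimal symmetries integrate: a skew pair in the Lie algebra of the stabiliser of [X]
    yields a unitary pair in the stabiliser. *)
Lemma cayley_comm A B X : skew A -> skew B -> A ** X = X ** B ->
  cayley A ** X = X ** cayley B.
Proof.
move=> sA sB AB.
have [Pi [PiP _ PC]] := cayley_inv sA; have [_ [_ _ PCB]] := cayley_inv sB.
have -> : cayley A = Pi ** (idm + 2^-1 *: A) by rewrite -PC mmulA PiP mmul1l.
have -> : X ** cayley B = Pi ** (idm - 2^-1 *: A) ** (X ** cayley B).
  by rewrite PiP mmul1l.
rewrite -!mmulA; congr (_ ** _).
have -> : (idm - 2^-1 *: A) ** (X ** cayley B) =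
    X ** ((idm - 2^-1 *: B) ** cayley B).
  by rewrite !mmulA; congr (_ ** _);
    rewrite mmulBl mmulBr mmul1l mmul1r mmulZl mmulZr AB.
by rewrite PCB mmulDl mmulDr mmul1l mmul1r mmulZl mmulZr AB.
Qed.

Lemma rotate_expand A B D : skew A -> skew B ->
  `|cayley A ** D ** ctr (cayley B) - D - (A ** D - D ** B)|
    <= (p + r)%:R * `|D| * (`|A| + `|B|) ^+ 2.
Proof.
move=> sA sB; set CA := cayley A; set CB := cayley B.
have -> : CA ** D ** ctr CB - D - (A ** D - D ** B) =
    (CA - idm - A) ** D ** ctr CB + D ** ctr (CB - idm - B)
    + A ** D ** ctr (CB - idm).
  rewrite !(ctrD, ctrN) sB ctr1 !(mmulDl, mmulDr, mmulNl, mmulNr, mmul1l, mmul1r).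
  by rewrite opprK; mring.
have uB := unitary_ctr (cayley_unitary sB).
have hE1 : `|(CA - idm - A) ** D ** ctr CB| <= p%:R * `|A| ^+ 2 * `|D|.
  rewrite norm_unitaryr// (le_trans (norm_mmul _ _))// ler_wpM2r//.
  exact: cayley_dist2.
have hE2 : `|D ** ctr (CB - idm - B)| <= r%:R * `|B| ^+ 2 * `|D|.
  rewrite (le_trans (norm_mmul _ _))// norm_ctr mulrC ler_wpM2r//.
  exact: cayley_dist2.
have hE3 : `|A ** D ** ctr (CB - idm)| <= `|A| * `|D| * (r%:R * `|B|).
  rewrite (le_trans (norm_mmul _ _))// norm_ctr ler_pM//.
    exact: norm_mmul.
  exact: cayley_dist1.
rewrite (le_trans (ler_normD _ _))// (le_trans (lerD (ler_normD _ _) hE3))//.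
rewrite (le_trans (lerD (lerD hE1 hE2) (lexx _)))//.
have hp : (0 : R) <= p%:R by [].
have hr : (0 : R) <= r%:R by [].
rewrite natrD; set P := p%:R in hp *; set Q := r%:R in hr *.
have a0 := normr_ge0 A; have b0 := normr_ge0 B; have d0 := normr_ge0 D.
have h1 : 0 <= `|A| * `|D| * `|B| by rewrite !mulr_ge0.
have h2 : 0 <= `|A| ^+ 2 * `|D| by rewrite mulr_ge0// sqr_ge0.
have h3 : 0 <= `|B| ^+ 2 * `|D| by rewrite mulr_ge0// sqr_ge0.
have := mulr_ge0 hp h1; have := mulr_ge0 hr h1.
have := mulr_ge0 hr h2; have := mulr_ge0 hp h3.
nra.
Qed.

End Rotation.

(** * Normal spaces and simultaneous singular value decompositions *)

(* The normal space at [X] of the orbit of [X] under two-sided rotations. *)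
Definition normal (R : realType) (k : entries) m n (X K : Mat R k m n) :=
  X ** ctr K = K ** ctr X /\ ctr K ** X = ctr X ** K.

Section Normal.
Context {R : realType} {k : entries} {m q : nat}.
Local Notation V := (Mat R k m (m + q)).
Local Notation rd := (@rect_diag R k m (m + q)).
Implicit Types (s d : Rvec R m) (X K D : V).

Lemma normal_rd s d : normal (rd s) (rd d).
Proof.
split; apply/matrixP => i j.
  rewrite !mmul_ctr_rd !rdl; case: eqP => [->|_]; last by rewrite !mul0r.
  by rewrite mulrC.
case: (split_ordP i) => i' ->; last by rewrite !ctr_rd_mmulr.
rewrite !ctr_rd_mmull; case: (split_ordP j) => j' ->; last by rewrite !rdr !mulr0.
by rewrite !rdl; case: eqP => [->|_]; rewrite ?mulr0// mulrC.
Qed.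

Lemma normal_rotate X K (U : Mat R k m m) (W : Mat R k (m + q) (m + q)) :
  orthogonal_mx U -> orthogonal_mx W ->
  normal X K -> normal (U ** X ** W) (U ** K ** W).
Proof.
move=> uU uW [h1 h2]; split; rewrite !ctrM !mmulA.
  rewrite -!(mmulA _ W) !unitary_ctrr// !mmul1r -!mmulA.
  by rewrite (mmulA X) h1 !mmulA.
rewrite -!(mmulA _ (ctr U)) !unitary_ctrl// !mmul1r -!mmulA.
by rewrite (mmulA (ctr K)) h2 !mmulA.
Qed.

(** Entrywise, normality reads [d_i conj(K_ji) = K_ij d_j] and [conj(K_ji) d_j = d_i K_ij], hence
    [(d_j^2 - d_i^2) K_ij = 0]. Distinct positive [d_i] kill the off-diagonal entries; positivity
    makes the diagonal real and kills the last [q] columns. *)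
Lemma normal_regular_diag d K :
  (forall i, 0 < d i 0) -> (forall i j, i != j -> d i 0 != d j 0) ->
  normal (rd d) K -> K = rd (diag_part K).
Proof.
move=> d0 dI [h1 h2].
have dz i : of_real k (d i 0) != 0 by rewrite of_real_eq0 gt_eqF.
apply/matP => i j; last first.
  rewrite rdr; have /matrixP/(_ (rshift m j) (lshift q i)) := h2.
  rewrite mmul_rdl ctr_rd_mmulr => /eqP.
  rewrite ctrE mulf_eq0 (negbTE (dz i)) orbF => /eqP h.
  by rewrite -[K i _]sconjK h rmorph0.
have e1 : of_real k (d i 0) * sconj (K j (lshift q i)) =
    K i (lshift q j) * of_real k (d j 0).
  have /matrixP/(_ i j) := h1.
  by rewrite rd_mmul ctrE mmul_ctr_rd.
have e2 : sconj (K j (lshift q i)) * of_real k (d j 0) =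
    of_real k (d i 0) * K i (lshift q j).
  have /matrixP/(_ (lshift q i) (lshift q j)) := h2.
  by rewrite mmul_rdl ctrE ctr_rd_mmull.
rewrite rdl; case: eqP => [ij|/eqP ij].
  rewrite mxE; subst j; apply: sconj_fixed; apply: (mulfI (dz i)).
  by rewrite e1 mulrC.
have : K i (lshift q j) * (of_real k (d j 0 ^+ 2 - d i 0 ^+ 2)) = 0.
  rewrite rmorphB mulrBr !rmorphXn/= (expr2 (of_real k (d j 0))) mulrA -e1 -mulrA e2.
  by ring.
move/eqP; rewrite mulf_eq0 of_real_eq0 subr_sqr mulf_eq0 subr_eq0.
rewrite [d j 0 == _]eq_sym (negbTE (dI _ _ ij))/= (gt_eqF (addr_gt0 (d0 j) (d0 i))) orbF.
by move/eqP.
Qed.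

End Normal.

Lemma mdot_rotate (R : realType) (k : entries) m n (K : Mat R k m n)
    (U : Mat R k m m) (X : Mat R k m n) (W : Mat R k n n) :
  mdot (ctr U ** K ** W) X = mdot K (U ** X ** ctr W).
Proof. by rewrite mdot_mulr -mmulA mdot_mull ctrK !mmulA. Qed.

Section SimultaneousSvd.
Context {R : realType} {k : entries} {m q : nat}.
Local Notation V := (Mat R k m (m + q)).
Local Notation rd := (@rect_diag R k m (m + q)).

(** The entries [m, m - 1, ..., 1]: strictly decreasing and positive, so no nontrivial signed
    permutation fixes the vector. It is the test matrix of Kostant's argument and the weight vector
    for sorting. *)
Definition regular_diag : Rvec R m := \col_i (m - i)%:R.

Lemma regular_diag_gt0 i : 0 < regular_diag i 0.
Proof. by rewrite mxE ltr0n subn_gt0. Qed.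

Lemma regular_diag_lt (i j : 'I_m) :
  (i < j)%N -> regular_diag j 0 < regular_diag i 0.
Proof. by move=> ij; rewrite !mxE ltr_nat ltn_sub2l// (ltn_trans ij). Qed.

Lemma regular_diag_inj (i j : 'I_m) :
  i != j -> regular_diag i 0 != regular_diag j 0.
Proof.
case: (ltngtP i j) => [/regular_diag_lt h|/regular_diag_lt h|/val_inj->];
  by rewrite ?eqxx// ?(gt_eqF h) ?(lt_eqF h).
Qed.

(* Kostant's argument: at a maximiser of the linear form [<K, U D V^*>] over
   the stabiliser of [rd s], with [D] regular, the skew pair
   [(K'D^* - DK'^*, K'^*D - D^*K')] lies in the Lie algebra of the stabiliser,
   and the first-order condition in its direction says that it vanishes; so
   [K'] is normal to [D], that is, diagonal. *)
Lemma simultaneous_svd (s : Rvec R m) (K : V) : normal (rd s) K ->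
  exists U W x, [/\ orthogonal_mx U, orthogonal_mx W,
    U ** rd s ** ctr W = rd s & K = U ** rd x ** ctr W].
Proof.
move=> nK; pose D := rd regular_diag.
pose S := [set UW : Mat R k m m * Mat R k (m + q) (m + q) |
  [/\ orthogonal_mx UW.1, orthogonal_mx UW.2 & UW.1 ** rd s ** ctr UW.2 = rd s]].
have rot_cont E : continuous (fun UW : Mat R k m m * Mat R k (m + q) (m + q) =>
    UW.1 ** E ** ctr UW.2).
  move=> UW; apply: (@cvg_rotate _ _ _ (nbhs UW) (nbhs_filter UW)).
    exact: cvg_fst.
  exact: cvg_snd.
have cS : compact S.
  apply: subclosed_compact (@unitary_pairs_compact R k m (m + q)) _; last first.
    by move=> UW [].
  rewrite (_ : S = [set UW | orthogonal_mx UW.1 /\ orthogonal_mx UW.2] `&`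
      (fun UW => UW.1 ** rd s ** ctr UW.2) @^-1` [set rd s]); last first.
    by apply/seteqP; split => UW /= => [[? ? ?]|[[]]].
  apply: closedI.
    apply: compact_closed; first exact: norm_hausdorff.
    exact: unitary_pairs_compact.
  apply: preimage_closed; last exact: mat_closed_set1.
  by move=> UW _; exact: rot_cont.
have S0 : S !=set0.
  exists (idm, idm); split; rewrite /= ?mmul1l ?ctr1 ?mmul1r//;
    exact: unitary1.
have hc : {within S, continuous (fun UW => mdot K (UW.1 ** D ** ctr UW.2))}.
  apply: continuous_subspaceT => UW.
  by apply: (@cvg_mdot _ _ _ (nbhs UW) (nbhs_filter UW)); exact: rot_cont.
have [[U W] /set_mem[/= uU uW stab] maxUW] := compact_EVT_max S0 cS hc.
pose K' := ctr U ** K ** W.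
have stab' : ctr U ** rd s ** W = rd s.
  by rewrite -{1}stab !mmulA unitary_ctrl// mmul1l -mmulA unitary_ctrl// mmul1r.
have [nK1 nK2] : normal (rd s) K'.
  by rewrite -{1}stab'; apply: normal_rotate => //; exact: unitary_ctr.
have [nD1 nD2] : normal (rd s) D by exact: normal_rd.
pose A := K' ** ctr D - D ** ctr K'; pose B := ctr K' ** D - ctr D ** K'.
have sA : skew A by rewrite /skew /A ctrD ctrN !ctrM !ctrK opprB.
have sB : skew B by rewrite /skew /B ctrD ctrN !ctrM !ctrK opprB.
(* The pair [(A, B)] is tangent to the stabiliser of [rd s], so rotating by [cayley (t *: A)] and
   [cayley (t *: B)] stays in [S]. *)
have AB : A ** rd s = rd s ** B.
  rewrite /A /B mmulBl mmulBr -!mmulA nD2 nK2 !mmulA.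
  by rewrite -nK1 -nD1.
have rot_le t : mdot K' (cayley (t *: A) ** D ** ctr (cayley (t *: B))) <= mdot K' D.
  have sAt := skewZ t sA; have sBt := skewZ t sB.
  have cst : cayley (t *: A) ** rd s = rd s ** cayley (t *: B).
    by apply: cayley_comm => //; rewrite mmulZl mmulZr AB.
  have uAt := cayley_unitary sAt; have uBt := cayley_unitary sBt.
  have /mem_set/maxUW/= : S (U ** cayley (t *: A), W ** cayley (t *: B)).
    split=> /=; [exact: unitaryM|exact: unitaryM|].
    rewrite ctrM !mmulA -(mmulA U (cayley (t *: A)) (rd s)) cst !mmulA.
    rewrite -(mmulA (U ** rd s) (cayley (t *: B)) (ctr (cayley (t *: B)))).
    by rewrite unitary_ctrr// mmul1r.
  rewrite ctrM !mmulA -(mdot_rotate K U D W) -/K' -/D.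
  rewrite -(mmulA U (cayley (t *: A)) D).
  rewrite -(mmulA U (cayley (t *: A) ** D) (ctr (cayley (t *: B)))).
  by rewrite -mdot_rotate.
(* The derivative of the maximised form along [(A, B)]: by skewness the two terms of [A], and
   likewise those of [B], contribute equally to the squared norm. *)
have mu : mdot K' (A ** D - D ** B) = 2^-1 * (`|A| ^+ 2 + `|B| ^+ 2).
  rewrite mdotDr mdotNr !norm_sqr.
  have h1 : mdot A A = 2 * mdot K' (A ** D).
    rewrite [mdot K' _]mdotC mdot_mulr.
    have : mdot A (D ** ctr K') = - mdot A (K' ** ctr D).
      by rewrite -mdot_ctr sA ctrM ctrK mdotC mdotNr mdotC.
    by rewrite {2}/A mdotDr mdotNr => ->; ring.
  have h2 : mdot B B = - (2 * mdot K' (D ** B)).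
    rewrite [mdot K' _]mdotC mdot_mull.
    have : mdot B (ctr K' ** D) = - mdot B (ctr D ** K').
      by rewrite -mdot_ctr sB ctrM ctrK mdotC mdotNr mdotC.
    by rewrite {2}/B mdotDr mdotNr => ->; ring.
  by rewrite h1 h2; field.
pose a := `|A| ^+ 2 + `|B| ^+ 2.
pose C := `|K'| * ((m + (m + q))%:R * `|D| * (`|A| + `|B|) ^+ 2).
have C0 : 0 <= C by rewrite !mulr_ge0// sqr_ge0.
(* Maximality bounds the first-order gain [t * (a / 2)] by the rotation error [C * t ^+ 2]; letting
   [t] tend to zero forces [a = 0]. *)
have key t : 0 < t -> 2^-1 * a <= C * t.
  move=> t0; have := rot_le t.
  have sAt := skewZ t sA; have sBt := skewZ t sB.
  have := rotate_expand D sAt sBt.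
  move: (erefl (cayley (t *: A) ** D ** ctr (cayley (t *: B)) - D -
    (t *: A ** D - D ** (t *: B)))).
  move: {2 3}(_ - (_ - _)) => E defE hE.
  have -> : cayley (t *: A) ** D ** ctr (cayley (t *: B)) =
      D + t *: (A ** D - D ** B) + E.
    rewrite -defE mmulZl mmulZr -scalerBr; mring.
  rewrite !mdotDr mdotZr mu -/a -addrA gerDl => h.
  have hKE : - mdot K' E <= `|K'| * `|E|.
    by rewrite -mdotNr (le_trans (mdot_le _ _))// -!normE normrN.
  have hE2 : `|K'| * `|E| <= C * t ^+ 2.
    rewrite (le_trans (ler_wpM2l _ hE))// !normrZ -mulrDr gtr0_norm//.
    by rewrite exprMn /C le_eqVlt; apply/orP; left; apply/eqP; ring.
  rewrite -(@ler_pM2l _ t)//.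
  apply: le_trans (_ : C * t ^+ 2 <= _); last by rewrite expr2 mulrCA.
  by apply: le_trans hE2; apply: le_trans hKE; lra.
have a0 : a = 0.
  apply/eqP; rewrite eq_le addr_ge0 ?sqr_ge0// andbT.
  rewrite -(@pmulr_rle0 _ 2^-1) ?invr_gt0//; apply/ler_addgt0Pr => e e0.
  rewrite add0r (le_trans (key (e / (C + 1)) _))//.
    by rewrite divr_gt0// ltr_wpDl.
  by rewrite mulrCA ler_piMr ?(ltW e0)// ler_pdivrMr ?ltr_wpDl// mul1r lerDl.
have /andP[/eqP A0 /eqP B0] : (A == 0) && (B == 0).
  move/eqP: a0; rewrite paddr_eq0 ?sqr_ge0// !expf_eq0/= !normr_eq0.
  by [].
have nDK : normal D K'.
  split; first by move/subr0_eq: A0 => ->.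
  by move/subr0_eq: B0 => ->.
have K'd := normal_regular_diag regular_diag_gt0 regular_diag_inj nDK.
exists U, W, (diag_part K'); split => //.
rewrite -K'd /K' !mmulA unitary_ctrr// mmul1l -mmulA unitary_ctrr//.
by rewrite mmul1r.
Qed.

End SimultaneousSvd.

(** * Signed permutations *)

Section SignedPermutations.
Context {R : realType} {m : nat}.
Implicit Types (p : 'S_m) (e : {ffun 'I_m -> bool}) (x y : Rvec R m).

Definition sact p e x : Rvec R m := \col_i ((-1) ^+ e i * x (p i) 0).

Lemma sactE p e x i : sact p e x i 0 = (-1) ^+ e i * x (p i) 0.
Proof. by rewrite mxE. Qed.

Lemma sact_linear p e : linear (sact p e).
Proof. by move=> a x y; apply/matrixP => i j; rewrite !mxE; ring. Qed.

Lemma sact_spm p e : exists2 Q : 'M[R]_m,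
  signed_perm_mx Q & forall x, Q *m x = sact p e x.
Proof.
have sgn0 i : (-1) ^+ e i <> 0 :> R by apply/eqP; rewrite signr_eq0.
exists (\matrix_(i, j) (if j == p i then (-1) ^+ e i else 0)).
  split.
  - move=> i j; rewrite mxE; case: eqP => // _ _.
    by case: (e i); rewrite ?expr1 ?expr0; [right|left].
  - move=> i; exists (p i); split; first by rewrite mxE eqxx.
    by move=> j; rewrite mxE; case: eqP.
  - move=> j; exists ((p^-1)%g j); split.
      by rewrite mxE permKV eqxx.
    by move=> i; rewrite mxE; case: eqP => // -> _; rewrite permK.
move=> x; apply/matrixP => i j; rewrite !mxE (bigD1 (p i))//= mxE eqxx.
rewrite big1 ?addr0 ?(ord1 j)// => l /negbTE li.
by rewrite mxE li mul0r.
Qed.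

End SignedPermutations.

Section MonomialMatrices.
Context {R : realType} {k : entries}.

Definition monomial_mx r (p : 'S_r) (e : 'I_r -> bool) : Mat R k r r :=
  \matrix_(i, j) (if j == p i then of_real k ((-1) ^+ e i) else 0).

Lemma monomial_mmul r n (p : 'S_r) e (A : Mat R k r n) i j :
  (monomial_mx p e ** A) i j = of_real k ((-1) ^+ e i) * A (p i) j.
Proof.
rewrite mmulE (bigD1 (p i))//= mxE eqxx big1 ?addr0// => l /negbTE li.
by rewrite mxE li mul0r.
Qed.

Lemma monomial_unitary r (p : 'S_r) e : orthogonal_mx (monomial_mx p e).
Proof.
rewrite /orthogonal_mx -[LHS]/(_ ** _); apply/matrixP => i j.
rewrite monomial_mmul ctrE !mxE (inj_eq perm_inj); case: eqP => [->|_].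
  by rewrite sconj_real -rmorphM -expr2 sqrr_sign rmorph1.
by rewrite rmorph0 mulr0.
Qed.

Context {m q : nat}.
Local Notation rd := (@rect_diag R k m (m + q)).

Definition extend_fun (p : 'S_m) (i : 'I_(m + q)) : 'I_(m + q) :=
  match fintype.split i with inl i' => lshift q (p i') | inr i' => rshift m i' end.

Lemma extend_fun_inj p : injective (extend_fun p).
Proof.
move=> i j; rewrite /extend_fun.
case: (split_ordP i) => i' ->; case: (split_ordP j) => j' ->;
  rewrite ?(unsplitK (inl _)) ?(unsplitK (inr _)) => /eqP;
  rewrite ?eq_lshift ?eq_rshift ?eq_lrshift ?eq_rlshift// => /eqP.
  by move/perm_inj->.
by move->.
Qed.

(** The signs go into the left factor; the right factor permutes the first [m] columns and fixes the
    last [q]. A signed permutation of the diagonal can thus be absorbed into the frames. *)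
Lemma sact_rd (p : 'S_m) e : exists U W,
  [/\ orthogonal_mx U, orthogonal_mx W
    & forall x, rd (sact p e x) = U ** rd x ** ctr W].
Proof.
exists (monomial_mx p e), (monomial_mx (perm (@extend_fun_inj p)) xpred0).
split; [exact: monomial_unitary|exact: monomial_unitary|] => x.
rewrite -[RHS]ctrK ctrM ctrK; apply/matP => i j; rewrite ctrE monomial_mmul.
  rewrite permE /extend_fun (unsplitK (inl _)) expr0 rmorph1 mul1r.
  rewrite ctrE sconjK monomial_mmul !rdl (inj_eq perm_inj).
  by rewrite sactE rmorphM; case: eqP => // _; rewrite mulr0.
rewrite permE /extend_fun (unsplitK (inr _)) expr0 rmorph1 mul1r.
by rewrite ctrE sconjK monomial_mmul !rdr mulr0.
Qed.

Lemma norm_sact (p : 'S_m) e (x : Rvec R m) : `|sact p e x| = `|x|.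
Proof.
have [U [W [uU uW UW]]] := sact_rd p e.
rewrite -[LHS](@norm_rd R k m q) UW.
by rewrite norm_unitaryr ?norm_unitaryl ?norm_rd//; exact: unitary_ctr.
Qed.

End MonomialMatrices.

Section Sorting.
Context {R : realType} {m : nat}.
Implicit Types (s x : Rvec R m).

Definition stabilises (s : Rvec R m) (pe : 'S_m * {ffun 'I_m -> bool}) :=
  sact pe.1 pe.2 s == s.

Definition block_sorted s x :=
  (forall i j : 'I_m, (i < j)%N -> s i 0 = s j 0 -> x j 0 <= x i 0) /\
  (forall i, s i 0 = 0 -> 0 <= x i 0).

Lemma sact1 x : sact 1%g [ffun=> false] x = x.
Proof.
apply/matrixP => i j; rewrite mxE ffunE expr0 mul1r perm1.
by rewrite (ord1 j).
Qed.

Lemma sact_tperm (p : 'S_m) (e : {ffun 'I_m -> bool}) x i j l :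
  sact (tperm i j * p)%g [ffun l => e (tperm i j l)] x l 0 =
  sact p e x (tperm i j l) 0.
Proof. by rewrite !mxE ffunE permM. Qed.

Lemma sact_flip (p : 'S_m) (e : {ffun 'I_m -> bool}) x i l :
  sact p [ffun l => e l (+) (l == i)] x l 0 =
  (if l == i then - sact p e x l 0 else sact p e x l 0).
Proof.
rewrite !mxE ffunE signr_addb; case: eqP => _.
  by rewrite expr1 mulrN1 mulNr.
by rewrite expr0 mulr1.
Qed.

(* Maximising the pairing with a strictly decreasing positive vector over the
   stabiliser of [s] sorts [x] inside the blocks of [s]. *)
Lemma block_sort s x : exists p e, sact p e s = s /\ block_sorted s (sact p e x).
Proof.
pose d : Rvec R m := regular_diag.
pose F (pe : 'S_m * {ffun 'I_m -> bool}) :=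
  \sum_l d l 0 * sact pe.1 pe.2 x l 0.
have h1 : stabilises s (1%g, [ffun=> false]) by rewrite /stabilises sact1.
have [[p e] /eqP /= ps pmax] := Order.TotalTheory.arg_maxP F h1.
exists p, e; split => //; split.
  move=> i j ij sij.
  have /pmax : stabilises s ((tperm i j * p)%g, [ffun l => e (tperm i j l)]).
    apply/eqP/matrixP => l c; rewrite (ord1 c)/= sact_tperm ps.
    by case: tpermP => // ->.
  rewrite /F /= => h.
  have nij : j != i by rewrite neq_ltn ij orbT.
  have : \sum_l d l 0 * sact (tperm i j * p)%g [ffun l => e (tperm i j l)] x l 0
       - \sum_l d l 0 * sact p e x l 0 =
      (d i 0 - d j 0) * (sact p e x j 0 - sact p e x i 0).
    rewrite (bigD1 i)//= (bigD1 j)//= [X in _ - X](bigD1 i)//=.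
    rewrite [X in _ - (_ + X)](bigD1 j)//= !sact_tperm tpermL tpermR.
    rewrite (eq_bigr (fun l => d l 0 * sact p e x l 0)); last first.
      by move=> l /andP[li lj]; rewrite sact_tperm tpermD// eq_sym.
    ring.
  have dij : 0 < d i 0 - d j 0 by rewrite subr_gt0; exact: regular_diag_lt.
  move=> hE; rewrite -subr_le0 -(pmulr_rle0 _ dij) -hE subr_le0.
  exact: h.
move=> i si.
have /pmax : stabilises s (p, [ffun l => e l (+) (l == i)]).
  apply/eqP/matrixP => l c; rewrite (ord1 c)/= sact_flip ps.
  by case: eqP => // ->; rewrite si oppr0.
rewrite /F /= => h.
have : \sum_l d l 0 * sact p [ffun l => e l (+) (l == i)] x l 0
     - \sum_l d l 0 * sact p e x l 0 = d i 0 * (- 2 * sact p e x i 0).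
  rewrite (bigD1 i)//= [X in _ - X](bigD1 i)//= sact_flip eqxx.
  rewrite (eq_bigr (fun l => d l 0 * sact p e x l 0)); last first.
    by move=> l /negbTE li; rewrite sact_flip li.
  ring.
have di : 0 < d i 0 by exact: regular_diag_gt0.
move=> hE; have : d i 0 * (-2 * sact p e x i 0) <= 0 by rewrite -hE subr_le0.
by rewrite pmulr_rle0// mulNr oppr_le0 pmulr_rge0.
Qed.

End Sorting.

(** * Existence of singular value decompositions *)

Section SvdExistence.
Context {R : realType} {k : entries} {m q : nat}.
Local Notation rd := (@rect_diag R k m (m + q)).

(** At the zero matrix every direction is normal, so [simultaneous_svd] gives a decomposition with
    real diagonal entries of arbitrary order and sign. [block_sort] at [0] sorts them, and the
    frames absorb the signed permutation. *)
Lemma svd_exists (X : Mat R k m (m + q)) : exists s U W,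
  [/\ sorted_nonneg s, orthogonal_mx U, orthogonal_mx W
    & X = U ** rd s ** ctr W].
Proof.
have n0 : normal (rd 0) X by rewrite rd0; split;
  rewrite !(ctr0, mmul0l, mmul0r).
have [U [W [x [uU uW _ ->]]]] := simultaneous_svd n0.
have [p [e [_ [h1 h2]]]] := block_sort 0 x.
have [P [Q [uP uQ PQ]]] := @sact_rd R k m q p e.
exists (sact p e x), (U ** ctr P), (W ** ctr Q); split.
- split; last by move=> i; apply: h2; rewrite mxE.
  move=> i j; rewrite leq_eqVlt => /orP[/eqP/val_inj->//|ij].
  by apply: h1; rewrite ?mxE.
- by apply: unitaryM => //; exact: unitary_ctr.
- by apply: unitaryM => //; exact: unitary_ctr.
rewrite PQ ctrM ctrK !mmulA -(mmulA U (ctr P) P) unitary_ctrl// mmul1r.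
by rewrite -(mmulA _ (ctr Q) Q) unitary_ctrl// mmul1r.
Qed.

End SvdExistence.

(** * Comparing two singular value decompositions *)

(** The [a + 1] rows up to [a] carry total mass [a + 1], and the [a] columns before [a] hold at most
    [a] of it. Index [a] belongs to both ranges, which is what leaves the 1. *)
Lemma unitary_overlap (R : realType) (k : entries) (m q : nat)
    (Q : Mat R k (m + q) (m + q)) (a : 'I_m) : orthogonal_mx Q ->
  1 <= \sum_(i < m | (i <= a)%N) \sum_(j < m + q | (a <= j)%N)
         smod (Q (lshift q i) j) ^+ 2.
Proof.
move=> uQ; have sq0 i j : 0 <= smod (Q i j) ^+ 2 by rewrite exprn_ge0 ?smod_ge0.
have hrow : \sum_(i < m | (i <= a)%N) \sum_(j < m + q)
    smod (Q (lshift q i) j) ^+ 2 = a.+1%:R.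
  rewrite (eq_bigr (fun=> 1)); last by move=> i _; exact: unitary_row.
  rewrite -(big_ord_widen _ (fun=> 1 : R) (ltn_ord a)).
  by rewrite sumr_const card_ord.
have hcol : \sum_(i < m | (i <= a)%N) \sum_(j < m + q | ~~ (a <= j)%N)
    smod (Q (lshift q i) j) ^+ 2 <= a%:R.
  rewrite exchange_big/=.
  have h : \sum_(j < m + q | ~~ (a <= j)%N) 1 = a%:R :> R.
    under eq_bigl do rewrite -ltnNge.
    rewrite -(big_ord_widen _ (fun=> 1 : R)) ?sumr_const ?card_ord//.
    by rewrite (leq_trans (ltnW (ltn_ord a)))// leq_addr.
  rewrite -h; apply: ler_sum => j _; rewrite -(unitary_col j uQ).
  rewrite [leRHS]big_split_ord/= ler_wpDr ?sumr_ge0//.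
  rewrite [leRHS](bigID (fun i : 'I_m => (i <= a)%N))/= lerDl.
  by apply: sumr_ge0.
have : \sum_(i < m | (i <= a)%N) \sum_(j < m + q) smod (Q (lshift q i) j) ^+ 2 =
    \sum_(i < m | (i <= a)%N) \sum_(j < m + q | (a <= j)%N)
         smod (Q (lshift q i) j) ^+ 2 +
    \sum_(i < m | (i <= a)%N) \sum_(j < m + q | ~~ (a <= j)%N)
         smod (Q (lshift q i) j) ^+ 2.
  rewrite -big_split/=; apply: eq_bigr => i _.
  by rewrite (bigID (fun j : 'I_(m + q) => (a <= j)%N)).
rewrite hrow -natr1 => h; move: hcol h; lra.
Qed.

Lemma entryB (R : realType) (k : entries) m n (X Y : Mat R k m n) i j :
  (X - Y) i j = X i j - Y i j.
Proof. by rewrite !mxE. Qed.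

Section TwoSvds.
Context {R : realType} {k : entries} {m q : nat}.
Local Notation rd := (@rect_diag R k m (m + q)).
Variables (s s' : Rvec R m).
Variables (U U' : Mat R k m m) (W W' : Mat R k (m + q) (m + q)).
Hypotheses (uU : orthogonal_mx U) (uU' : orthogonal_mx U').
Hypotheses (uW : orthogonal_mx W) (uW' : orthogonal_mx W').

Let P := ctr U ** U'.
Let Q := ctr W ** W'.
Let uP : orthogonal_mx P.
Proof. by apply: unitaryM => //; exact: unitary_ctr. Qed.
Let uQ : orthogonal_mx Q.
Proof. by apply: unitaryM => //; exact: unitary_ctr. Qed.

Lemma norm_svdB (x x' : Rvec R m) :
  `|U ** rd x ** ctr W - U' ** rd x' ** ctr W'| = `|rd x ** Q - P ** rd x'|.
Proof.
rewrite -(norm_unitaryl _ (unitary_ctr uU)) -(norm_unitaryr _ uW').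
congr `|_|; rewrite mmulBr mmulBl /P /Q !mmulA unitary_ctrl// mmul1l.
by rewrite -[in X in _ - X](mmulA _ (ctr W')) unitary_ctrl// mmul1r.
Qed.

Let D := `|U ** rd s ** ctr W - U' ** rd s' ** ctr W'|.

Let D0 : 0 <= D. Proof. exact: normr_ge0. Qed.

Let ov1 i j : smod (of_real k (s i 0) * Q (lshift q i) (lshift q j) -
  P i j * of_real k (s' j 0)) <= D.
Proof.
rewrite /D norm_svdB; apply: le_trans (smod_le_norm _ i (lshift q j)).
by rewrite entryB rd_mmul mmul_rdl.
Qed.

Let ov2 i j : smod (of_real k (s i 0) * P i j -
  Q (lshift q i) (lshift q j) * of_real k (s' j 0)) <= D.
Proof.
have -> : D = `|ctr (rd s) ** P - Q ** ctr (rd s')|.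
  rewrite /D -norm_ctr ctrD ctrN !ctrM !ctrK !mmulA.
  rewrite -(norm_unitaryl _ (unitary_ctr uW)) -(norm_unitaryr _ uU').
  congr `|_|; rewrite mmulBr mmulBl /P /Q !mmulA unitary_ctrl// mmul1l.
  by rewrite -[in X in _ - X](mmulA _ (ctr U')) unitary_ctrl// mmul1r.
apply: le_trans (smod_le_norm _ (lshift q i) j).
by rewrite entryB ctr_rd_mmull mmul_ctr_rd.
Qed.

Let ov3 i (j : 'I_q) : `|s i 0| * smod (Q (lshift q i) (rshift m j)) <= D.
Proof.
rewrite /D norm_svdB; apply: le_trans (smod_le_norm _ i (rshift m j)).
rewrite entryB rd_mmul mmul_rdr oppr0 addr0.
by rewrite smodM smod_real.
Qed.

Definition weyl_const : R := 2 * (m * (m + q))%:R.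

Lemma weyl_le : sorted_nonneg s -> sorted_nonneg s' ->
  forall a, s a 0 - s' a 0 <= weyl_const * D.
Proof.
move=> [ss s0] [ss' s0'] a; set t := s a 0 - s' a 0.
have c0 : 0 <= weyl_const by rewrite mulr_ge0.
have [t0|t0] := leP t 0; first by rewrite (le_trans t0)// mulr_ge0.
(* On the block [i <= a <= j] one has [s i - s' j >= t], and adding the overlap bounds [h1] and [h2]
   gives [t |Q_ij| <= 2 D]. The columns beyond [m] behave as if [s' j] were zero. *)
have ent (i : 'I_m) (j : 'I_(m + q)) : (i <= a)%N -> (a <= j)%N -> t * smod (Q (lshift q i) j) <= 2 * D.
  move=> ia aj; have si := ss _ _ ia.
  case: (split_ordP j) aj => j' -> /= aj.
    have sj := ss' _ _ aj.
    have tij : t <= s i 0 - s' j' 0 by rewrite lerB.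
    set y := smod _; set x := smod (P i j').
    have y0 : 0 <= y by exact: smod_ge0. have x0 : 0 <= x by exact: smod_ge0.
    have h1 : s i 0 * y <= D + s' j' 0 * x.
      rewrite -lerBlDr; apply: le_trans (ov1 i j'); rewrite lerBlDr.
      have -> : s i 0 * y = smod (of_real k (s i 0) * Q (lshift q i) (lshift q j')).
        by rewrite smodM smod_real ger0_norm.
      have -> : s' j' 0 * x = smod (P i j' * of_real k (s' j' 0)).
        by rewrite smodM smod_real ger0_norm// mulrC.
      by rewrite -[X in smod X <= _](subrK (P i j' * of_real k (s' j' 0))) smodD.
    have h2 : s i 0 * x <= D + s' j' 0 * y.
      rewrite -lerBlDr; apply: le_trans (ov2 i j'); rewrite lerBlDr.
      have -> : s i 0 * x = smod (of_real k (s i 0) * P i j').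
        by rewrite smodM smod_real ger0_norm.
      have -> : s' j' 0 * y =
          smod (Q (lshift q i) (lshift q j') * of_real k (s' j' 0)).
        by rewrite smodM smod_real ger0_norm// mulrC.
      by rewrite -[X in smod X <= _](subrK
        (Q (lshift q i) (lshift q j') * of_real k (s' j' 0))) smodD.
    have h3 : 0 <= (s i 0 - s' j' 0) * x by rewrite mulr_ge0// (le_trans (ltW t0)).
    have h4 := ler_wpM2r y0 tij.
    nra.
  have h := ov3 i j'; rewrite ger0_norm// in h.
  have ti : t <= s i 0 by rewrite lerBlDr (le_trans si)// lerDl.
  have := ler_wpM2r (smod_ge0 (Q (lshift q i) (rshift m j'))) ti.
  by move: D0; lra.
(* The overlap block has mass at least 1, while each of its at most [m * (m + q)] entries has
   modulus at most [2 * D / t]; this is the source of [weyl_const]. *)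
have : t ^+ 2 <= (weyl_const * D) ^+ 2.
  have h := ler_wpM2l (sqr_ge0 t) (unitary_overlap a uQ).
  rewrite mulr1 mulr_sumr in h; apply: (le_trans h).
  apply: (@le_trans _ _ (\sum_(i < m) \sum_(j < m + q) (2 * D) ^+ 2)).
    have sum_sub (r : nat) (Pr : pred 'I_r) (F : 'I_r -> R) (G : 'I_r -> R) :
        (forall i, Pr i -> F i <= G i) -> (forall i, 0 <= G i) ->
        \sum_(i | Pr i) F i <= \sum_i G i.
      move=> FG G0; rewrite [leRHS](bigID Pr)/= ler_wpDr//.
        by rewrite sumr_ge0.
      exact: ler_sum.
    apply: (sum_sub _ _ _ _) => [i ia|i]; last by rewrite sumr_ge0// => j _; exact: sqr_ge0.
    rewrite mulr_sumr; apply: (sum_sub _ _ _ _) => [j aj|j]; last exact: sqr_ge0.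
    rewrite -exprMn ler_pXn2r ?nnegrE ?mulr_ge0 ?smod_ge0 ?(ltW t0)//.
    exact: ent.
  rewrite !sumr_const !card_ord -mulrnA mulnC -[_ *+ _]mulr_natl.
  rewrite /weyl_const exprMn [leRHS]exprMn exprMn mulrA ler_wpM2r ?sqr_ge0//.
  rewrite mulrC ler_wpM2l ?sqr_ge0// -natrX ler_nat.
  by case: (_ * _)%N => // r; rewrite expnS leq_pmulr// expn_gt0.
by rewrite ler_pXn2r ?nnegrE ?mulr_ge0// ltW.
Qed.

(** The middle clauses bound the divided differences [(f_i - f_j) / (x_i - x_j)] and
    [(f_i + f_j) / (x_i + x_j)], which carry a Lipschitz constant from vectors to matrices. With
    [i = j] the latter gives [|f_i| <= C |x_i|], as the columns beyond [m] require. *)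
Definition spectral_bounds (f : Rvec R m -> Rvec R m) (C : R) (A : set (Rvec R m)) :=
  [/\ 0 <= C,
      forall x i j, A x -> `|f x i 0 - f x j 0| <= C * `|x i 0 - x j 0|,
      forall x i j, A x -> `|f x i 0 + f x j 0| <= C * `|x i 0 + x j 0|
    & forall x y, A x -> A y -> `|f x - f y| <= C * `|x - y|].

Lemma coord_le_norm (x : Rvec R m) i : `|x i 0| <= `|x|.
Proof.
have := @smod_le_norm R RealEntries m 1 x i 0.
by rewrite -[smod _]/(@smod R RealEntries (of_real RealEntries (x i 0))) smod_real.
Qed.

(** The parameter [w] separates two uses: Weyl's bound supplies it in general, and [w = 0] with
    [s = s'] yields independence of the frames. *)
Lemma svd_lipschitz_aux f C A (w : R) : spectral_bounds f C A -> A s -> A s' ->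
  0 <= w -> `|s - s'| <= w * D ->
  `|U ** rd (f s) ** ctr W - U' ** rd (f s') ** ctr W'|
    <= (m * (m + q))%:R * (C * (2 + 4 * w) * D).
Proof.
move=> [C0 fm fp fl] As As' w0 ssD; rewrite norm_svdB.
have CwD : C * D <= C * (2 + 4 * w) * D.
  by rewrite -mulrA ler_wpM2l// ler_peMl//; lra.
apply: norm_le_entries => i j; case: (split_ordP j) => j' ->; last first.
  rewrite entryB rd_mmul mmul_rdr oppr0 addr0.
  rewrite smodM smod_real.
  have h : `|f s i 0| <= C * `|s i 0|.
    have := fp s i i As; rewrite -!mulr2n -(mulr_natl (f s i 0)) -(mulr_natl (s i 0)).
    rewrite !normrM normr_nat.
    by rewrite mulrCA ler_pM2l.
  have := ler_wpM2r (smod_ge0 (Q (lshift q i) (rshift m j'))) h.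
  move/le_trans; apply; rewrite -(mulrA C `|s i 0|); apply: (le_trans _ CwD).
  by rewrite ler_wpM2l.
rewrite entryB rd_mmul mmul_rdl.
set qij := Q _ _; set pij := P i j'.
have N0 := normr_ge0 (s - s').
have fN : `|f s j' 0 - f s' j' 0| <= C * `|s - s'|.
  apply: le_trans (fl _ _ As As').
  by have := coord_le_norm (f s - f s') j'; rewrite !mxE.
have sN : `|s j' 0 - s' j' 0| <= `|s - s'|.
  by have := coord_le_norm (s - s') j'; rewrite !mxE.
have hm : `|f s i 0 - f s' j' 0| <= C * (`|s i 0 - s' j' 0| + 2 * `|s - s'|).
  have h := fm s i j' As.
  have h2 := ler_distD (s' j' 0) (s i 0) (s j' 0).
  rewrite [`|s' j' 0 - _|]distrC in h2.
  have h3 := ler_distD (f s j' 0) (f s i 0) (f s' j' 0).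
  have h4 := ler_wpM2l C0 (le_trans h2 (lerD (lexx _) sN)).
  by move: h h3 h4 fN; rewrite !mulrDr; lra.
have hp : `|f s i 0 + f s' j' 0| <= C * (`|s i 0 + s' j' 0| + 2 * `|s - s'|).
  have h := fp s i j' As.
  have h2 : `|s i 0 + s j' 0| <= `|s i 0 + s' j' 0| + `|s j' 0 - s' j' 0|.
    apply: le_trans (ler_normD _ _); rewrite le_eqVlt; apply/orP; left.
    by apply/eqP; congr `|_|; ring.
  have h3 : `|f s i 0 + f s' j' 0| <= `|f s i 0 + f s j' 0| + `|f s j' 0 - f s' j' 0|.
    apply: le_trans (ler_normB _ _); rewrite le_eqVlt; apply/orP; left.
    by apply/eqP; congr `|_|; ring.
  have h4 := ler_wpM2l C0 (le_trans h2 (lerD (lexx _) sN)).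
  by move: h h3 h4 fN; rewrite !mulrDr; lra.
have o1 := ov1 i j'; have o2 := ov2 i j'.
rewrite -/qij -/pij in o1 o2.
have em : `|s i 0 - s' j' 0| * smod (qij + pij) <= 2 * D.
  rewrite -[X in X * _](@smod_real R k) -smodM mulr_natl mulr2n.
  apply: le_trans (lerD o1 o2); apply: le_trans (smodD _ _).
  rewrite le_eqVlt; apply/orP; left; apply/eqP; congr smod.
  by rewrite rmorphB; ring.
have ep : `|s i 0 + s' j' 0| * smod (qij - pij) <= 2 * D.
  rewrite -[X in X * _](@smod_real R k) -smodM mulr_natl mulr2n.
  rewrite -(smodN (_ * pij - _)) in o2.
  apply: le_trans (lerD o1 o2); apply: le_trans (smodD _ _).
  rewrite le_eqVlt; apply/orP; left; apply/eqP; congr smod.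
  by rewrite rmorphD; ring.
have uq : smod qij <= 1 by exact: unitary_entry.
have up : smod pij <= 1 by exact: unitary_entry.
have am : smod (qij + pij) <= 2.
  by rewrite (le_trans (smodD _ _))// (le_trans (lerD uq up)).
have ap : smod (qij - pij) <= 2.
  by rewrite (le_trans (smodD _ _))// smodN (le_trans (lerD uq up)).
(* Half-difference and half-sum pair [f s i - f s' j] with [q + p] and [f s i + f s' j] with
   [q - p], the combinations that [em] and [ep] compare with [D]. *)
have -> : of_real k (f s i 0) * qij - pij * of_real k (f s' j' 0) =
   of_real k (2^-1 * (f s i 0 - f s' j' 0)) * (qij + pij) +
   of_real k (2^-1 * (f s i 0 + f s' j' 0)) * (qij - pij).
  have -> : of_real k (f s i 0) = of_real k (2^-1 * (f s i 0 - f s' j' 0)) +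
      of_real k (2^-1 * (f s i 0 + f s' j' 0)).
    by rewrite -rmorphD; congr of_real; field.
  have -> : of_real k (f s' j' 0) = of_real k (2^-1 * (f s i 0 + f s' j' 0)) -
      of_real k (2^-1 * (f s i 0 - f s' j' 0)).
    by rewrite -rmorphB; congr of_real; field.
  by ring.
rewrite (le_trans (smodD _ _))// !smodM !smod_real !normrM.
rewrite ger0_norm ?invr_ge0//.
have k1 := ler_wpM2r (smod_ge0 (qij + pij)) hm.
have k2 := ler_wpM2r (smod_ge0 (qij - pij)) hp.
have k3 := ler_wpM2l C0 em; have k4 := ler_wpM2l C0 ep.
have k5 := ler_wpM2l (mulr_ge0 C0 N0) am.
have k6 := ler_wpM2l (mulr_ge0 C0 N0) ap.
have k7 := ler_wpM2l C0 ssD.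
move: k1 k2 k3 k4 k5 k6 k7.
rewrite !mulrDr !mulrDl !mulrA; lra.
Qed.

End TwoSvds.
Arguments weyl_const : clear implicits.

(** * Singular values and spectral operators *)

Section Sigma.
Context {R : realType} {k : entries} {m q : nat}.
Local Notation rd := (@rect_diag R k m (m + q)).
Local Notation V := (Mat R k m (m + q)).
Implicit Types (X Y : V) (s : Rvec R m).

Lemma sigma_spec X : sorted_nonneg (sigma X) /\
  exists UW, is_svd X (sigma X) UW.
Proof.
have [s [U [W [ss uU uW XE]]]] := svd_exists X.
apply: (@getPex _ [set s | sorted_nonneg s /\ exists UV, is_svd X s UV]).
by exists s; split => //; exists (U, W); split.
Qed.

Lemma sigma_sorted X : sorted_nonneg (sigma X).
Proof. by case: (sigma_spec X). Qed.

Lemma sigma_svd X : exists U W, [/\ orthogonal_mx U, orthogonal_mx W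
  & X = U ** rd (sigma X) ** ctr W].
Proof. by have [_ [[U W] [uU uW XE]]] := sigma_spec X; exists U, W; split. Qed.

Lemma weyl s s' (U U' : Mat R k m m) (W W' : Mat R k (m + q) (m + q)) :
  orthogonal_mx U -> orthogonal_mx U' -> orthogonal_mx W -> orthogonal_mx W' ->
  sorted_nonneg s -> sorted_nonneg s' ->
  `|s - s'| <= m%:R * weyl_const R m q *
    `|U ** rd s ** ctr W - U' ** rd s' ** ctr W'|.
Proof.
move=> uU uU' uW uW' ss ss'.
have := @norm_le_entries R RealEntries m 1 (s - s'); rewrite muln1.
move=> /(_ (weyl_const R m q * `|U ** rd s ** ctr W - U' ** rd s' ** ctr W'|)).
rewrite mulrA; apply=> i j; rewrite (ord1 j).
rewrite -[smod _]/(@smod R RealEntries (of_real RealEntries ((s - s') i 0))).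
rewrite smod_real entryB ler_norml weyl_le// andbT lerNl opprB.
by rewrite distrC weyl_le.
Qed.

(** Weyl's bound at distance zero; it frees [sigma] from the choice made by [get]. *)
Lemma sigma_unique X s U W : orthogonal_mx U -> orthogonal_mx W ->
  sorted_nonneg s -> X = U ** rd s ** ctr W -> sigma X = s.
Proof.
move=> uU uW ss XE; have [U' [W' [uU' uW' XE']]] := sigma_svd X.
have := weyl uU' uU uW' uW (sigma_sorted X) ss.
by rewrite -XE -XE' subrr normr0 mulr0 normr_le0 subr_eq0 => /eqP.
Qed.

Definition sigma_lip : R := m%:R * weyl_const R m q.

Lemma sigma_lip_ge0 : 0 <= sigma_lip.
Proof. by rewrite !mulr_ge0. Qed.

Lemma sigma_lipschitz X Y : `|sigma X - sigma Y| <= sigma_lip * `|X - Y|.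
Proof.
have [U [W [uU uW XE]]] := sigma_svd X.
have [U' [W' [uU' uW' YE]]] := sigma_svd Y.
by rewrite {2}XE {2}YE; apply: weyl => //; exact: sigma_sorted.
Qed.

Lemma spectral_operator_svd f X : exists U W,
  [/\ orthogonal_mx U, orthogonal_mx W, X = U ** rd (sigma X) ** ctr W
    & spectral_operator f X = U ** rd (f (sigma X)) ** ctr W].
Proof.
have [U [W [uU uW XE]]] := sigma_svd X.
have : svd_pairs X (get (svd_pairs X)).
  by apply: (@getPex _ (svd_pairs X)); exists (U, W); split.
rewrite /spectral_operator; case: (get _) => U' W' [uU' uW' XE'].
by exists U', W'.
Qed.

Definition spectral_lip (C : R) : R :=
  (m * (m + q))%:R * (C * (2 + 4 * sigma_lip)).

Lemma spectral_lip_ge0 C : 0 <= C -> 0 <= spectral_lip C.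
Proof.
by move=> C0; rewrite !mulr_ge0// addr_ge0// mulr_ge0// sigma_lip_ge0.
Qed.

Lemma spectral_operator_lipschitz f C A X Y : spectral_bounds f C A ->
  A (sigma X) -> A (sigma Y) ->
  `|spectral_operator f X - spectral_operator f Y| <= spectral_lip C * `|X - Y|.
Proof.
move=> fC AX AY.
have [U [W [uU uW XE ->]]] := spectral_operator_svd f X.
have [U' [W' [uU' uW' YE ->]]] := spectral_operator_svd f Y.
rewrite /spectral_lip -mulrA {2}XE {2}YE.
apply: (svd_lipschitz_aux _ _ _ _ fC) => //; first exact: sigma_lip_ge0.
exact: weyl (sigma_sorted X) (sigma_sorted Y).
Qed.

(** Independence of the frames is the Lipschitz estimate for two decompositions of the same
    matrix. *)
Lemma spectral_operator_sorted f C A s U W : spectral_bounds f C A -> A s ->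
  orthogonal_mx U -> orthogonal_mx W -> sorted_nonneg s ->
  spectral_operator f (U ** rd s ** ctr W) = U ** rd (f s) ** ctr W.
Proof.
move=> fC As uU uW ss; set X := _ ** ctr W.
have sX : sigma X = s by exact: sigma_unique uU uW ss _.
have [U' [W' [uU' uW' XE ->]]] := spectral_operator_svd f X.
rewrite sX in XE *; apply/eqP; rewrite -subr_eq0 -normr_le0.
have := @svd_lipschitz_aux R k m q s s U' U W' W uU' uU uW' uW f C A 0 fC As As.
rewrite -XE -/X !subrr !normr0 !mulr0; exact.
Qed.

End Sigma.
Arguments sigma_lip : clear implicits.
Arguments spectral_lip : clear implicits.

(** * Level sets of [c] and Lipschitz bounds from equivariance *)

Section Adapted.
Context {R : realType} {m : nat}.
Implicit Types (c x y : Rvec R m) (f : Rvec R m -> Rvec R m).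

Definition near_pt c (r : R) : set (Rvec R m) := [set x | `|x - c| < r].

(** The factor 3 leaves a margin of [r] after two entries have moved by less than [r] each: in
    [near_pt c r], entries from different level sets of [c] stay [r] apart and keep their order. *)
Definition gap c (r : R) := [/\ 0 < r,
  forall i j, c i 0 != c j 0 -> 3 * r <= `|c i 0 - c j 0|
  & forall i, c i 0 != 0 -> 3 * r <= `|c i 0|].

(** Restricted to the stabiliser of [c], because this is the symmetry that the directional
    derivative at [c] retains. *)
Definition stab_equivariant f c r := forall p e x,
  sact p e c = c -> near_pt c r x -> f (sact p e x) = sact p e (f x).

Lemma finite_lower_bound (I : finType) (F : I -> R) : (forall i, 0 < F i) ->
  exists2 r, 0 < r & forall i, r <= F i.
Proof.
move=> F0; pose S := \sum_i (F i)^-1 + 1.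
have S0 : 0 < S by rewrite ltr_wpDl ?sumr_ge0// => i _; rewrite invr_ge0 ltW.
exists S^-1; rewrite ?invr_gt0// => i.
rewrite -[leRHS]invrK lef_pV2 ?posrE ?invr_gt0//.
rewrite /S (bigD1 i)//= -addrA lerDl addr_ge0// sumr_ge0// => j _.
by rewrite invr_ge0 ltW.
Qed.

Lemma gap_exists c : exists r, gap c r.
Proof.
pose F (i : option ('I_m * 'I_m) + 'I_m) : R := match i with
  | inl (Some (i, j)) => if c i 0 == c j 0 then 1 else `|c i 0 - c j 0|
  | inl None => 1
  | inr i => if c i 0 == 0 then 1 else `|c i 0|
  end.
have F0 i : 0 < F i.
  case: i => [[[i j]|]|i] //=; case: ifPn => // h.
    by rewrite normr_gt0 subr_eq0.
  by rewrite normr_gt0.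
have [r r0 rF] := finite_lower_bound F0.
exists (r / 3); have r3 : 3 * (r / 3) = r by field.
split; first exact: divr_gt0.
  move=> i j /negbTE cij; rewrite r3.
  by have := rF (inl (Some (i, j))); rewrite /= cij.
move=> i /negbTE ci; rewrite r3.
by have := rF (inr i); rewrite /= ci.
Qed.

Lemma gapS c r r' : gap c r -> 0 < r' -> r' <= r -> gap c r'.
Proof.
move=> [r0 h1 h2] r'0 r'r; split => // [i j|i] h.
  by apply: le_trans (h1 _ _ h); rewrite ler_pM2l.
by apply: le_trans (h2 _ h); rewrite ler_pM2l.
Qed.

Lemma norm_two_coords y i j :
  (forall l, l != i -> l != j -> y l 0 = 0) -> `|y| <= `|y i 0| + `|y j 0|.
Proof.
move=> y0; apply: (le_trans (norm_le_sum _)).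
have E l : \sum_j smod (y l j) = `|y l 0|.
  rewrite big_ord1.
  by rewrite -[smod _]/(@smod R RealEntries (of_real RealEntries (y l 0))) smod_real.
under eq_bigr do rewrite E.
rewrite (bigD1 i)//= lerD2l.
have [ji|ji] := eqVneq j i.
  by rewrite big1// => l li; rewrite y0 ?normr0// ji.
rewrite (bigD1 j)//= big1 ?addr0// => l /andP[li lj].
by rewrite y0 ?normr0.
Qed.

Lemma near_coord c r x i : near_pt c r x -> `|x i 0 - c i 0| < r.
Proof.
by apply: le_lt_trans; have := coord_le_norm (x - c) i; rewrite entryB.
Qed.

(* Transposing two equal entries, or negating a zero entry, fixes [c]; so
   equivariance turns the Lipschitz bound into bounds for differences of
   entries of [f x]. Entries from different blocks are [r] apart. *)
Lemma equivariant_bounds c r f (L M : R) : sorted_nonneg c -> gap c r ->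
  stab_equivariant f c r -> 0 <= L -> 0 <= M ->
  (forall x y, near_pt c r x -> near_pt c r y -> `|f x - f y| <= L * `|x - y|) ->
  (forall x, near_pt c r x -> `|f x| <= M) ->
  spectral_bounds f (2 * L + 2 * (M / r)) (near_pt c r).
Proof.
move=> [_ c0] [r0 g1 g2] feq L0 M0 fL fM.
have Mr0 : 0 <= M / r by rewrite divr_ge0// ltW.
have C0 : 0 <= 2 * L + 2 * (M / r) by rewrite addr_ge0// mulr_ge0.
have near_sact p e x : sact p e c = c -> near_pt c r x -> near_pt c r (sact p e x).
  move=> pc; rewrite /near_pt /= -{2}pc -(linB _ _ (sact_linear p e)).
  by rewrite (@norm_sact R RealEntries m 0).
have block y z d : 0 <= d -> `|f y - f z| <= L * `|y - z| -> `|y - z| <= d + d ->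
    forall i, `|f y i 0 - f z i 0| <= (2 * L + 2 * (M / r)) * d.
  move=> d0 h1 h2 i; have := coord_le_norm (f y - f z) i; rewrite entryB.
  move/le_trans; apply; apply: (le_trans h1).
  apply: le_trans (ler_wpM2l L0 h2) _.
  have := mulr_ge0 Mr0 d0; rewrite mulrDl -!mulrA mulrDr; lra.
have offblock x (u d : R) : near_pt c r x -> r <= d -> `|u| <= 2 * `|f x| ->
    `|u| <= (2 * L + 2 * (M / r)) * d.
  move=> xc rd h; have := fM _ xc => h2.
  have d0 : 0 <= d by rewrite (le_trans (ltW r0)).
  have : M <= M / r * d by rewrite -mulrA ler_peMr// mulrC ler_pdivlMr// mul1r.
  have := mulr_ge0 L0 d0; rewrite mulrDl -!mulrA; move: h h2; lra.
split => //.
- move=> x i j xc; have [cij|cij] := eqVneq (c i 0) (c j 0); last first.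
    apply: (@offblock x) => //.
      have := g1 _ _ cij => g; have xi := near_coord i xc.
      have xj := near_coord j xc.
      have := ler_distD (x i 0) (c i 0) (c j 0).
      have := ler_distD (x j 0) (x i 0) (c j 0).
      by rewrite [`|c i 0 - x i 0|]distrC; move: xi xj g; lra.
    by rewrite (le_trans (ler_normB _ _))// mulr_natl mulr2n lerD// coord_le_norm.
  pose p := tperm i j; pose e := [ffun l : 'I_m => false].
  have pE y l : sact p e y l 0 = y (p l) 0.
    by rewrite mxE ffunE expr0 mul1r.
  have pc : sact p e c = c.
    apply/matrixP => l l'; rewrite (ord1 l') pE /p.
    by case: tpermP => // ->.
  have := feq _ _ _ pc xc => /matrixP/(_ i 0); rewrite pE /p tpermL => <-.
  apply: block => //; first by apply: fL => //; exact: near_sact.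
  apply: le_trans (norm_two_coords (i := i) (j := j) _) _.
    by move=> l li lj; rewrite entryB pE /p tpermD 1?eq_sym// subrr.
  by rewrite !entryB !pE /p tpermL tpermR [`|x j 0 - _|]distrC.
- move=> x i j xc.
  have [/andP[/eqP ci /eqP cj]|cij] := boolP ((c i 0 == 0) && (c j 0 == 0)); last first.
    apply: (@offblock x) => //.
      have ci0 := c0 i; have cj0 := c0 j.
      have : 3 * r <= c i 0 + c j 0.
        move: cij; rewrite negb_and => /orP[/g2|/g2]; rewrite ger0_norm//.
          by move=> h; rewrite (le_trans h)// lerDl.
        by move=> h; rewrite (le_trans h)// lerDr.
      have := near_coord i xc; have := near_coord j xc.
      rewrite !ltr_norml => /andP[h1 h2] /andP[h3 h4] h5.
      by rewrite (le_trans _ (ler_norm _))//; move: h1 h2 h3 h4 h5; lra.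
    by rewrite (le_trans (ler_normD _ _))// mulr_natl mulr2n lerD// coord_le_norm.
  (* Exchanging and negating both entries fixes [c], which vanishes there; for [i = j] this is a
     plain sign change. *)
  pose p := tperm i j; pose e := [ffun l : 'I_m => (l == i) || (l == j)].
  have pE y l : sact p e y l 0 = (-1) ^+ ((l == i) || (l == j)) * y (p l) 0.
    by rewrite mxE ffunE.
  have pc : sact p e c = c.
    apply/matrixP => l l'; rewrite (ord1 l') pE /p.
    case: tpermP => [->|->|/eqP/negbTE -> /eqP/negbTE ->].
    + by rewrite ci cj mulr0.
    + by rewrite ci cj mulr0.
    + by rewrite expr0 mul1r.
  have Ei y : sact p e y i 0 = - y j 0.
    by rewrite pE /p tpermL eqxx expr1 mulN1r.
  have Ej y : sact p e y j 0 = - y i 0.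
    by rewrite pE /p tpermR eqxx orbT expr1 mulN1r.
  have := feq _ _ _ pc xc => /matrixP/(_ i 0); rewrite Ei.
  rewrite -[in X in _ -> X](opprK (f x j 0)) => <-.
  apply: block => //; first by apply: fL => //; exact: near_sact.
  apply: le_trans (norm_two_coords (i := i) (j := j) _) _.
    move=> l li lj; rewrite entryB pE /p.
    have -> : tperm i j l = l by rewrite tpermD// eq_sym.
    by rewrite (negbTE li) (negbTE lj) expr0 mul1r subrr.
  by rewrite !entryB Ei Ej !opprK [x j 0 + _]addrC.
- move=> x y xc yc; apply: (le_trans (fL _ _ xc yc)).
  rewrite ler_wpM2r//; move: Mr0 L0; lra.
Qed.

End Adapted.

(** * Spectral operators under small rotations *)

Definition adapted (R : realType) (m : nat) (c : Rvec R m) (r : R)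
    (f : Rvec R m -> Rvec R m) (C : R) :=
  [/\ sorted_nonneg c, gap c r, stab_equivariant f c r
    & spectral_bounds f C (near_pt c r)].

Lemma block_sorted_near (R : realType) (m : nat) (c x : Rvec R m) r :
  sorted_nonneg c -> gap c r -> near_pt c r x -> block_sorted c x ->
  sorted_nonneg x.
Proof.
move=> [cs c0] [r0 g1 g2] xB [hs h0]; split=> [i j|i].
  rewrite leq_eqVlt => /orP[/eqP/val_inj ->//|ij].
  have [/(hs _ _ ij)//|cij] := eqVneq (c i 0) (c j 0).
  have := g1 _ _ cij; rewrite ger0_norm ?subr_ge0 ?cs// 1?ltnW//.
  have := near_coord i xB; have := near_coord j xB.
  by rewrite !ltr_norml => /andP[h1 h2] /andP[h3 h4] h5; move: r0; lra.
have [/h0//|ci] := eqVneq (c i 0) 0.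
have := g2 _ ci; rewrite ger0_norm//.
have := near_coord i xB.
by rewrite !ltr_norml => /andP[h1 h2] h5; move: r0; lra.
Qed.

Section Adapted.
Context {R : realType} {k : entries} {m q : nat}.
Local Notation rd := (@rect_diag R k m (m + q)).
Local Notation V := (Mat R k m (m + q)).
Implicit Types (x y s c : Rvec R m) (X : V).

Lemma norm_rotate (U : Mat R k m m) (W : Mat R k (m + q) (m + q)) X :
  orthogonal_mx U -> orthogonal_mx W -> `|U ** X ** ctr W| = `|X|.
Proof.
by move=> uU uW; rewrite norm_unitaryr ?norm_unitaryl//; exact: unitary_ctr.
Qed.

(** The entries of [x] may be out of order or negative, so [U rd(x) W^H] need not be a singular
    value decomposition. An element of the stabiliser of [c] sorts [x]; the frames absorb it,
    equivariance carries it through [f], and it preserves the distance to [c]. *)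
Lemma spectral_operator_near c r f C x U W : adapted c r f C -> near_pt c r x ->
  orthogonal_mx U -> orthogonal_mx W ->
  `|sigma (U ** rd x ** ctr W) - c| = `|x - c| /\
  spectral_operator f (U ** rd x ** ctr W) = U ** rd (f x) ** ctr W.
Proof.
move=> [cf cg feq fC] xc uU uW.
have [p [e [pc [hs h0]]]] := block_sort c x.
pose y := sact p e x; rewrite -/y in hs h0.
have yc : `|y - c| = `|x - c|.
  by rewrite -{1}pc -(linB _ _ (sact_linear p e)) (@norm_sact R RealEntries m 0).
have yB : near_pt c r y by rewrite /near_pt /= yc.
have ysort := block_sorted_near cf cg yB (conj hs h0).
have [P [Q [uP uQ PQ]]] := @sact_rd R k m q p e.
have rot z : U ** rd z ** ctr W =
    U ** ctr P ** rd (sact p e z) ** ctr (W ** ctr Q).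
  rewrite PQ ctrM ctrK !mmulA -(mmulA U (ctr P) P) unitary_ctrl// mmul1r.
  by rewrite -(mmulA _ (ctr Q) Q) unitary_ctrl// mmul1r.
have uUP : orthogonal_mx (U ** ctr P) by apply: unitaryM => //; exact: unitary_ctr.
have uWQ : orthogonal_mx (W ** ctr Q) by apply: unitaryM => //; exact: unitary_ctr.
split; first by rewrite (@sigma_unique _ _ _ _ _ _ _ _ uUP uWQ ysort (rot x)) yc.
rewrite rot (spectral_operator_sorted fC)// -/y.
by rewrite /y feq// -rot.
Qed.

(* To second order, the perturbation [AX - XB + U rd(y) W^H] of
   [X = U rd(x) W^H] rotates [U rd(x+y) W^H] by the Cayley transforms of [A]
   and [B]; the spectral operator commutes with rotations. *)
Lemma spectral_operator_expand c r f C x : adapted c r f C -> near_pt c r x ->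
  exists rho K, [/\ 0 < rho, 0 <= K &
  forall U W A B y X G, orthogonal_mx U -> orthogonal_mx W -> skew A -> skew B ->
    `|A| + `|B| + `|y| <= rho ->
    X = U ** rd x ** ctr W -> G = spectral_operator f ->
    `|G (X + (A ** X - X ** B + U ** rd y ** ctr W)) - G X
       - (A ** G X - G X ** B + U ** rd (f (x + y) - f x) ** ctr W)|
    <= K * (`|A| + `|B| + `|y|) ^+ 2].
Proof.
move=> fa xc; have [cs cg feq fC] := fa; have [C0 _ _ fl] := fC.
pose kap : R := (m + (m + q))%:R; have k0 : 0 <= kap by [].
pose N := `|x| + 1; have N0 : 0 <= N by rewrite addr_ge0.
pose Kd := kap * N + 1; have Kd0 : 0 <= Kd by rewrite addr_ge0// mulr_ge0.
pose d := r - `|x - c|; have d0 : 0 < d by rewrite subr_gt0.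
(* With this [S], the radius [rho] keeps both [x + y] and the singular values of the perturbed
   matrix within [r] of [c]. *)
pose S := 1 + sigma_lip R m q * Kd.
have S1 : 1 <= S by rewrite lerDl mulr_ge0// sigma_lip_ge0.
have S0 : 0 < S by rewrite (lt_le_trans ltr01).
pose rho := Num.min 1 (d / (2 * S)).
have rho0 : 0 < rho by rewrite lt_min ltr01 divr_gt0// mulr_gt0.
pose K := spectral_lip R m q C * Kd + kap * (`|f x| + C) + C.
have K0 : 0 <= K.
  have h := @spectral_lip_ge0 R m q C C0; have n0 := normr_ge0 (f x).
  by rewrite /K; have := mulr_ge0 h Kd0; have := mulr_ge0 k0 (addr_ge0 n0 C0); lra.
exists rho, K; split => // U W A B y X G uU uW sA sB; set t := _ + `|y| => trho XE GE.
have t0 : 0 <= t by rewrite !addr_ge0.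
have [t1 tS] : t <= 1 /\ t * (2 * S) <= d.
  move: trho; rewrite le_min => /andP[-> ]; split => //.
  by rewrite -ler_pdivlMr// mulr_gt0.
have yt : `|y| <= t by rewrite /t lerDr addr_ge0.
have ABt : `|A| + `|B| <= t by rewrite /t lerDl.
have dxy : `|x + y - c| <= `|x - c| + t.
  by rewrite addrAC (le_trans (ler_normD _ _))// lerD2l.
have tSd : t + sigma_lip R m q * Kd * t < d.
  have -> : t + sigma_lip R m q * Kd * t = t * S by rewrite /S; ring.
  by move: tS d0 (mulr_ge0 t0 (ltW S0)); lra.
have lipKd : 0 <= sigma_lip R m q * Kd by rewrite mulr_ge0// sigma_lip_ge0.
have xyc : near_pt c r (x + y).
  rewrite /near_pt /= (le_lt_trans dxy)//.
  by move: tSd (mulr_ge0 lipKd t0); rewrite /d; lra.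
pose Z := U ** rd (x + y) ** ctr W.
have ZE : Z = X + U ** rd y ** ctr W by rewrite /Z rdD mmulDr mmulDl XE.
pose H := A ** X - X ** B + U ** rd y ** ctr W.
pose Y := cayley A ** Z ** ctr (cayley B).
have uA := cayley_unitary sA; have uB := cayley_unitary sB.
have YE : Y = cayley A ** U ** rd (x + y) ** ctr (cayley B ** W).
  by rewrite /Y /Z ctrM !mmulA.
have [sY GY] := spectral_operator_near fa xyc (unitaryM uA uU) (unitaryM uB uW).
rewrite -YE -GE in sY GY.
have [_ GX] := spectral_operator_near fa xc uU uW; rewrite -XE -GE in GX.
have [_ GZ] := spectral_operator_near fa xyc uU uW; rewrite -/Z -GE in GZ.
have GYZ : G Y = cayley A ** G Z ** ctr (cayley B).
  by rewrite GY GZ ctrM !mmulA.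
have t2 : t ^+ 2 <= t by rewrite expr2 ler_piMl.
have ABt2 : (`|A| + `|B|) ^+ 2 <= t ^+ 2.
  by rewrite ler_pXn2r ?nnegrE ?addr_ge0.
have mixed (E : V) e : `|E| <= e -> `|A ** E - E ** B| <= t * e.
  move=> Ee; rewrite (le_trans (ler_normB _ _))//.
  rewrite (le_trans (lerD (norm_mmul _ _) (norm_mmul _ _)))//.
  rewrite [`|E| * _]mulrC -mulrDl ler_pM// addr_ge0//.
have ZN : `|Z| <= N.
  rewrite norm_rotate// norm_rd (le_trans (ler_normD _ _))// lerD2l.
  exact: le_trans yt t1.
(* [X + H] differs from the rotated matrix [Y] by the Cayley error and by the products of [A] and
   [B] with the [y] term, all of second order in [t]. *)
have YH : `|X + H - Y| <= Kd * t ^+ 2.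
  have -> : X + H - Y = - (Y - Z - (A ** Z - Z ** B))
      - (A ** (U ** rd y ** ctr W) - (U ** rd y ** ctr W) ** B).
    by rewrite ZE /H !(mmulDl, mmulDr); mring.
  rewrite (le_trans (ler_normB _ _))// normrN /Kd mulrDl mul1r lerD//.
    rewrite (le_trans (rotate_expand Z sA sB))// -!mulrA ler_wpM2l//.
    by rewrite ler_pM// sqr_ge0.
  have := mixed (U ** rd y ** ctr W) `|y|; rewrite norm_rotate// norm_rd.
  by move/(_ (lexx _))/le_trans; apply; rewrite expr2 ler_wpM2l.
have sXH : near_pt c r (sigma (X + H)).
  have := ler_distD (sigma Y) (sigma (X + H)) c; rewrite sY => h.
  have h2 := le_trans (sigma_lipschitz (X + H) Y)
    (ler_wpM2l (@sigma_lip_ge0 R m q) YH).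
  have h3 : sigma_lip R m q * (Kd * t ^+ 2) <= sigma_lip R m q * Kd * t.
    by rewrite mulrA ler_wpM2l.
  by rewrite /near_pt /=; move: h h2 h3 dxy tSd; rewrite /d; lra.
have sYc : near_pt c r (sigma Y) by rewrite /near_pt /= sY.
have G1 := spectral_operator_lipschitz fC sXH sYc; rewrite -GE in G1.
have fxy : `|f (x + y) - f x| <= C * `|y|.
  by rewrite (le_trans (fl _ _ xyc xc))// addrAC subrr add0r.
have GZX : G Z = G X + U ** rd (f (x + y) - f x) ** ctr W.
  by rewrite GZ GX -mmulDl -mmulDr -rdD [f x + _]addrC subrK.
have -> : G (X + H) - G X - (A ** G X - G X ** B +
     U ** rd (f (x + y) - f x) ** ctr W) =
   (G (X + H) - G Y) + (G Y - G Z - (A ** G Z - G Z ** B))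
   + (A ** (U ** rd (f (x + y) - f x) ** ctr W)
      - (U ** rd (f (x + y) - f x) ** ctr W) ** B).
  by rewrite GZX !(mmulDl, mmulDr); mring.
rewrite (le_trans (ler_normD _ _))// /K mulrDl lerD//; last first.
  apply: le_trans (mixed _ (C * t) _) _; last by rewrite expr2 mulrCA.
  rewrite norm_rotate// norm_rd; apply: (le_trans fxy).
  by rewrite ler_wpM2l.
rewrite (le_trans (ler_normD _ _))// mulrDl lerD//.
  apply: (le_trans G1); rewrite -(mulrA (spectral_lip R m q C)).
  by rewrite ler_wpM2l// spectral_lip_ge0.
rewrite GYZ; apply: (le_trans (rotate_expand (G Z) sA sB)).
rewrite -!mulrA ler_wpM2l// ler_pM// ?sqr_ge0//.
rewrite GZ norm_rotate// norm_rd.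
have -> : f (x + y) = f x + (f (x + y) - f x) by rewrite [RHS]addrC subrK.
rewrite (le_trans (ler_normD _ _))// lerD2l (le_trans fxy)//.
by rewrite ler_piMr// (le_trans yt).
Qed.

End Adapted.

(** * Tangent and normal spaces of orbits *)

Lemma mdotBr (R : realType) (k : entries) m n (X Y Z : Mat R k m n) :
  mdot X (Y - Z) = mdot X Y - mdot X Z.
Proof. by rewrite mdotDr mdotNr. Qed.

Lemma mdotBl (R : realType) (k : entries) m n (X Y Z : Mat R k m n) :
  mdot (X - Y) Z = mdot X Z - mdot Y Z.
Proof. by rewrite ![mdot _ Z]mdotC mdotBr. Qed.

Section Decomposition.
Context {R : realType} {k : entries} {m n : nat}.
Local Notation V := (Mat R k m n).
Implicit Types (X H K : V).

(** Gram-Schmidt along the list [L], inside a subspace [T]. The third clause expresses that [H - K]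
    lies in the span of [L] and is what drives the induction. *)
Lemma orthogonal_decomposition (T : V -> Prop) (L : seq V) :
  T 0 -> (forall a x y, T x -> T y -> T (a *: x + y)) -> {in L, forall v, T v} ->
  forall H, exists K, [/\ T (H - K), {in L, forall v, mdot v K = 0} &
    forall Z, {in L, forall v, mdot v Z = 0} -> mdot (H - K) Z = 0].
Proof.
move=> T0 TD; elim: L => [|v L IH] LT H.
  by exists H; split; rewrite ?subrr// => Z _; rewrite mdotC -(scale0r 0) mdotZr mul0r.
have LT' : {in L, forall w, T w} by move=> w wL; apply: LT; rewrite inE wL orbT.
have Tv : T v by apply: LT; rewrite inE eqxx.
have [K [TK KL KZ]] := IH LT' H; have [w [Tw wL wZ]] := IH LT' v.
have sub Z : {in v :: L, forall u, mdot u Z = 0} -> {in L, forall u, mdot u Z = 0}.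
  by move=> h u uL; apply: h; rewrite inE uL orbT.
have [w0|w0] := eqVneq (mdot w w) 0.
  exists K; split => // [u|Z /sub/KZ//].
  rewrite inE => /orP[/eqP->|/KL//].
  by rewrite -[v]subr0 -[in X in _ - X](mdot_eq0 w0) wZ.
pose a := mdot w K / mdot w w.
have K'L : {in L, forall u, mdot u (K - a *: w) = 0}.
  by move=> u uL; rewrite mdotBr mdotZr KL// wL// mulr0 subr0.
have HK : H - (K - a *: w) = a *: w + (H - K) by mring.
exists (K - a *: w); split.
- rewrite HK; apply: (TD _ _ _ _ TK).
  have -> : w = -1 *: (v - w) + v by mring.
  exact: TD.
- move=> u; rewrite inE => /orP[/eqP->|/K'L//].
  rewrite -[v](subrK w) mdotDl wZ// add0r mdotBr mdotZr /a divfK//.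
  by rewrite subrr.
- move=> Z vZ; rewrite HK mdotDl mdotZl KZ ?addr0; last exact: sub.
  have -> : w = v - (v - w) by mring.
  by rewrite mdotBl vZ ?inE ?eqxx// wZ ?subrr ?mulr0//; exact: sub.
Qed.

Definition tangent X H := exists A B, [/\ skew A, skew B & H = A ** X - X ** B].

(** Projects off the span of the commutators generated by [E - E^H] with [E] in [ebasis]; by
    adjunction, orthogonality to these generators says that [K X^H] and [K^H X] are Hermitian, which
    is normality. *)
Lemma tangent_normal X H : exists K, tangent X (H - K) /\ normal X K.
Proof.
pose v1 (l : 'I_m * 'I_m * bool) := (ebasis l - ctr (ebasis l)) ** X.
pose v2 (l : 'I_n * 'I_n * bool) := X ** (ctr (ebasis l) - ebasis l).
pose L := [seq v1 l | l : _] ++ [seq v2 l | l : _].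
have sC p (C : Mat R k p p) : skew (C - ctr C).
  by rewrite /skew ctrD ctrN ctrK opprB.
have [| | |K [TK KL _]] := @orthogonal_decomposition (tangent X) L _ _ _ H.
- by exists 0, 0; split; [exact: skew0|exact: skew0|rewrite mmul0l mmul0r subr0].
- move=> a x y [A [B [sA sB ->]]] [A' [B' [sA' sB' ->]]].
  exists (a *: A + A'), (a *: B + B'); split.
  + by apply: skewD => //; exact: skewZ.
  + by apply: skewD => //; exact: skewZ.
  + by rewrite mmulDl mmulDr mmulZl mmulZr; mring.
- move=> v; rewrite mem_cat => /orP[/mapP[l _ ->]|/mapP[l _ ->]].
  + exists (ebasis l - ctr (ebasis l)), 0; split => //; first exact: skew0.
    by rewrite mmul0r subr0.
  + exists 0, (ebasis l - ctr (ebasis l)); split => //; first exact: skew0.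
    by rewrite mmul0l sub0r -mmulNr opprB.
exists K; split => //; split; apply/eqP; rewrite -subr_eq0; apply/eqP.
- rewrite -opprB [X in - X](_ : _ = 0) ?oppr0//.
  rewrite [LHS]ebasisE big1// => l _.
  suff -> : mdot (ebasis l) (K ** ctr X - X ** ctr K) = 0 by rewrite scale0r.
  have := KL (v1 l); rewrite mem_cat map_f ?mem_enum// => /(_ isT).
  rewrite /v1 mdot_mulr mdotBl mdotBr => <-; congr (_ - _).
  by rewrite -[RHS]mdot_ctr ctrK ctrM ctrK.
- rewrite [LHS]ebasisE big1// => l _.
  suff -> : mdot (ebasis l) (ctr K ** X - ctr X ** K) = 0 by rewrite scale0r.
  have := KL (v2 l); rewrite mem_cat map_f ?mem_enum ?orbT// => /(_ isT).
  rewrite /v2 mdot_mull mdotBl mdotBr => <-; congr (_ - _).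
  by rewrite -[RHS]mdot_ctr ctrK ctrM ctrK.
Qed.

Lemma normal_linear X a K K' : normal X K -> normal X K' -> normal X (a *: K + K').
Proof.
move=> [h1 h2] [h1' h2']; split.
  by rewrite ctrD ctrZ mmulDl mmulDr mmulZl mmulZr h1 h1'.
by rewrite ctrD ctrZ mmulDl mmulDr mmulZl mmulZr h2 h2'.
Qed.

Lemma normal0 X : normal X 0.
Proof. by split; rewrite !(ctr0, mmul0l, mmul0r). Qed.

Lemma mdot_linear_comb (W : lmodType R) (F : 'I_m * 'I_n * bool -> W) :
  linear (fun H : V => \sum_l mdot (ebasis l) H *: F l).
Proof.
move=> a x y; rewrite scaler_sumr -big_split/=; apply: eq_bigr => l _.
by rewrite mdotDr mdotZr scalerDl scalerA.
Qed.

(** [A H] and [B H] are not unique, and choosing them separately for each [H] would lose linearity;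
    they are chosen on [ebasis] and extended through the coefficients. *)
Lemma linear_decomposition X : exists (A : V -> Mat R k m m)
    (B : V -> Mat R k n n) (P : V -> V),
  [/\ linear A, linear B, linear P & forall H,
    [/\ skew (A H), skew (B H), normal X (P H)
      & H = A H ** X - X ** B H + P H]].
Proof.
have /choice[F FE] : forall l : 'I_m * 'I_n * bool,
    exists ABK : Mat R k m m * Mat R k n n * V,
    [/\ skew ABK.1.1, skew ABK.1.2, normal X ABK.2
      & ebasis l = ABK.1.1 ** X - X ** ABK.1.2 + ABK.2].
  move=> l; have [K [[A [B [sA sB E]]] nK]] := tangent_normal X (ebasis l).
  by exists (A, B, K); split => //=; rewrite -E subrK.
exists (fun H => \sum_l mdot (ebasis l) H *: (F l).1.1),
  (fun H => \sum_l mdot (ebasis l) H *: (F l).1.2),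
  (fun H => \sum_l mdot (ebasis l) H *: (F l).2).
split; [exact: mdot_linear_comb..|] => H; split.
- by apply: skew_sum => l; apply: skewZ; case: (FE l).
- by apply: skew_sum => l; apply: skewZ; case: (FE l).
- elim/big_ind: _ => [|K K' nK nK'|l _]; first exact: normal0.
  + by rewrite -[K]scale1r; exact: normal_linear.
  + by rewrite -[_ *: _]addr0; apply: normal_linear; [case: (FE l)|exact: normal0].
have lX : linear (fun A : Mat R k m m => A ** X).
  by move=> a x y; rewrite mmulDl mmulZl.
have Xl : linear (fun B : Mat R k n n => X ** B).
  by move=> a x y; rewrite mmulDr mmulZr.
rewrite (linear_sumE lX) (linear_sumE Xl) -sumrB -big_split/= [LHS]ebasisE.
apply: eq_bigr => l _; case: (FE l) => _ _ _ {2}->.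
by rewrite -scalerBr -scalerDr.
Qed.

End Decomposition.

(** * Linear equivariant maps *)

Section LinearEquivariant.
Context {R : realType} {m : nat}.
Implicit Types (s x y : Rvec R m) (M : Rvec R m -> Rvec R m).

Definition unit_vec (j : 'I_m) : Rvec R m := \col_i (i == j)%:R.

Lemma unit_vecE x : x = \sum_j x j 0 *: unit_vec j.
Proof.
apply/matrixP => i c; rewrite (ord1 c).
rewrite [RHS](summxE _ _ (fun j => x j 0 *: unit_vec j : Rvec R m)).
rewrite (bigD1 i)//= big1 ?addr0 => [|j ji]; rewrite !mxE.
  by rewrite eqxx mulr1.
by rewrite eq_sym (negbTE ji) mulr0.
Qed.

(** Transpositions inside a level set of [s] make the matrix of [M] constant on blocks apart from
    the diagonal, and sign changes on the zero level set kill the off-diagonal entries there.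
    Splitting off the diagonal part [c] leaves [e] constant on whole blocks. *)
Lemma sact_equivariant_coeffs s M : linear M ->
  (forall p e, sact p e s = s -> forall x, M (sact p e x) = sact p e (M x)) ->
  exists (c : 'I_m -> R) (e : 'I_m -> 'I_m -> R),
  [/\ forall x i, M x i 0 = c i * x i 0 + \sum_j e i j * x j 0,
      forall i j, s i 0 = s j 0 -> c i = c j,
      forall i j l, s i 0 = s j 0 -> e i l = e j l,
      forall i j l, s i 0 = s j 0 -> e l i = e l j
    & forall i l, s i 0 = 0 -> e i l = 0 /\ e l i = 0].
Proof.
move=> lM eqM; pose a i j := M (unit_vec j) i 0.
have swap i j b d : s b 0 = s d 0 -> a (tperm b d i) (tperm b d j) = a i j.
  move=> sbd; pose p := tperm b d; pose z := [ffun l : 'I_m => false].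
  have pE y l : sact p z y l 0 = y (p l) 0 by rewrite mxE ffunE expr0 mul1r.
  have ps : sact p z s = s.
    apply/matrixP => l l'; rewrite (ord1 l') pE /p.
    by case: tpermP => // ->.
  have pj : sact p z (unit_vec (p j)) = unit_vec j.
    by apply/matrixP => l l'; rewrite (ord1 l') pE !mxE (inj_eq perm_inj).
  have := eqM _ _ ps (unit_vec (p j)) => /matrixP/(_ i 0).
  by rewrite pj pE.
have flip i j : s i 0 = 0 -> i != j -> a i j = 0 /\ a j i = 0.
  move=> si ij; pose z := [ffun l : 'I_m => l == i].
  have zE y l : sact 1%g z y l 0 = (-1) ^+ (l == i) * y l 0.
    by rewrite mxE ffunE perm1.
  have zs : sact 1%g z s = s.
    apply/matrixP => l l'; rewrite (ord1 l') zE.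
    by case: eqP => [->|_]; rewrite ?si ?mulr0// expr0 mul1r.
  have z1 : sact 1%g z (unit_vec i) = - unit_vec i.
    apply/matrixP => l l'; rewrite (ord1 l') zE !mxE.
    by case: eqP => _; rewrite ?mulr1 ?mulr0 ?oppr0.
  have z2 : sact 1%g z (unit_vec j) = unit_vec j.
    apply/matrixP => l l'; rewrite (ord1 l') zE !mxE.
    by case: eqP => [->|_]; rewrite ?expr0 ?mul1r// (negbTE ij) mulr0.
  split.
    have := eqM _ _ zs (unit_vec j) => /matrixP/(_ i 0).
    by rewrite z2 zE eqxx expr1 -/(a i j); lra.
  have := eqM _ _ zs (unit_vec i) => /matrixP/(_ j 0).
  rewrite z1 (linN _ lM) zE eq_sym (negbTE ij) expr0 mul1r mxE -/(a j i); lra.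
(* The common off-diagonal value on the level set of [i], with default 0 on the zero level set and
   on level sets with one element. *)
pose off i := if s i 0 == 0 then 0 else
  if [pick j | (j != i) && (s j 0 == s i 0)] is Some j then a i j else 0.
have offE i j : s i 0 != 0 -> j != i -> s j 0 = s i 0 -> off i = a i j.
  move=> si ji sji; rewrite /off (negbTE si); case: pickP => [l /andP[li /eqP sl]|].
    have := swap i j j l; rewrite tpermL tpermD//; apply.
    by rewrite sl.
  by move/(_ j); rewrite ji sji eqxx.
have off_eq i j : s i 0 = s j 0 -> off i = off j.
  move=> sij; have [si|si] := eqVneq (s i 0) 0.
    by rewrite /off -sij si eqxx.
  have [->//|ij] := eqVneq i j.
  have sj : s j 0 != 0 by rewrite -sij.
  have ji : j != i by rewrite eq_sym.
  rewrite (offE i j si ji (esym sij)) (offE j i sj ij sij).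
  by have := swap i j i j sij; rewrite tpermL tpermR.
pose c i := a i i - off i.
pose e i j := if (s i 0 == 0) || (s j 0 == 0) then 0 else
  if s i 0 == s j 0 then off i else a i j.
have aE i j : a i j = c i * (i == j)%:R + e i j.
  rewrite /c /e; have [si|si] /= := eqVneq (s i 0) 0.
    rewrite addr0 /off si eqxx subr0; have [->|ij] := eqVneq i j.
      by rewrite mulr1.
    by rewrite mulr0; case: (flip i j).
  have [sj|sj] /= := eqVneq (s j 0) 0.
    have ij : j != i by apply: contra_neq si => <-.
    by rewrite eq_sym (negbTE ij) mulr0 addr0; case: (flip j i).
  have [<-|ij] := eqVneq i j; first by rewrite eqxx mulr1 subrK.
  rewrite mulr0 add0r; case: eqP => // sij.
  by rewrite (offE i j)// eq_sym.
exists c, e; split.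
- move=> x i; rewrite {1}(unit_vecE x) (linear_sumE lM).
  rewrite [LHS](summxE _ _ (fun j => x j 0 *: M (unit_vec j) : Rvec R m)).
  transitivity (\sum_j a i j * x j 0).
    by apply: eq_bigr => j _; rewrite mxE mulrC.
  under eq_bigr do rewrite aE mulrDl.
  rewrite big_split/= (bigD1 i)//= eqxx mulr1 big1 ?addr0// => j ji.
  by rewrite eq_sym (negbTE ji) mulr0 mul0r.
- move=> i j sij; rewrite /c (off_eq _ _ sij).
  by have := swap i i i j sij; rewrite tpermL => ->.
- move=> i j l sij; rewrite /e sij; case: ifP => // _; case: eqP => sl.
    exact: off_eq.
  have := swap i l i j sij; rewrite tpermL tpermD//.
    by apply/eqP => il; apply: sl; rewrite -sij il.
  by apply/eqP => jl; apply: sl; rewrite jl.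
- move=> i j l sij; rewrite /e sij; case: ifP => // _; case: eqP => sl//.
  have := swap l i i j sij; rewrite tpermL tpermD//.
    by apply/eqP => il; apply: sl; rewrite -sij il.
  by apply/eqP => jl; apply: sl; rewrite jl.
- by move=> i l si; rewrite /e si eqxx orbT.
Qed.

End LinearEquivariant.

(** * Rotations that fix a diagonal matrix *)

Section BlockRotation.
Context {R : realType} {k : entries} {m q : nat}.
Local Notation rd := (@rect_diag R k m (m + q)).
Local Notation V := (Mat R k m (m + q)).
Variables (s : Rvec R m) (P : Mat R k m m) (Q : Mat R k (m + q) (m + q)).
Hypotheses (s0 : forall i, 0 <= s i 0).
Hypotheses (uP : orthogonal_mx P) (uQ : orthogonal_mx Q).
Hypothesis stab : P ** rd s ** ctr Q = rd s.

Let E1 i j : P i j * of_real k (s j 0) =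
  of_real k (s i 0) * Q (lshift q i) (lshift q j).
Proof.
have : P ** rd s = rd s ** Q.
  by rewrite -[in RHS]stab -mmulA unitary_ctrl// mmul1r.
by move/matrixP/(_ i (lshift q j)); rewrite mmul_rdl rd_mmul.
Qed.

Let E2 i j : of_real k (s i 0) * P i j =
  Q (lshift q i) (lshift q j) * of_real k (s j 0).
Proof.
have : ctr (rd s) ** P = Q ** ctr (rd s).
  rewrite -[in LHS]stab !ctrM ctrK -!mmulA unitary_ctrl// mmul1r.
  by [].
by move/matrixP/(_ (lshift q i) j); rewrite ctr_rd_mmull mmul_ctr_rd.
Qed.

Let E3 i (j : 'I_q) : s i 0 != 0 -> Q (lshift q i) (rshift m j) = 0.
Proof.
move=> si; have : P ** rd s = rd s ** Q.
  by rewrite -[in RHS]stab -mmulA unitary_ctrl// mmul1r.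
move/matrixP/(_ i (rshift m j)); rewrite mmul_rdr rd_mmul => /esym/eqP.
by rewrite mulf_eq0 of_real_eq0 (negbTE si) => /eqP.
Qed.

Let P0 i j : s i 0 != s j 0 -> P i j = 0.
Proof.
move=> sij; have : (of_real k (s i 0 ^+ 2 - s j 0 ^+ 2)) * P i j = 0.
  rewrite rmorphB mulrBl !rmorphXn/= (expr2 (of_real k (s i 0))) -mulrA E2.
  by rewrite mulrA -E1; ring.
move/eqP; rewrite mulf_eq0 of_real_eq0 subr_sqr mulf_eq0 subr_eq0 (negbTE sij).
rewrite paddr_eq0 ?s0//= => /orP[/andP[/eqP si /eqP sj]|/eqP//].
by move: sij; rewrite si sj eqxx.
Qed.

Let PQ i j : s i 0 = s j 0 -> s i 0 != 0 -> P i j = Q (lshift q i) (lshift q j).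
Proof.
move=> sij si; apply/(mulIf (_ : of_real k (s j 0) != 0)).
  by rewrite of_real_eq0 -sij.
by rewrite E1 sij mulrC.
Qed.

Let Q0 i j : s i 0 != s j 0 -> Q (lshift q i) (lshift q j) = 0.
Proof.
move=> sij; have := E1 i j; have := E2 i j; rewrite P0// mulr0 mul0r.
move=> /esym/eqP; rewrite mulf_eq0 of_real_eq0 => /orP[/eqP//|/eqP sj].
move=> /esym/eqP; rewrite mulf_eq0 of_real_eq0 => /orP[/eqP si|/eqP//].
by move: sij; rewrite si sj eqxx.
Qed.

(** [E1] and [E2] make [P] block diagonal for the level sets of [s] and equal to the matching part
    of [Q] off the zero level set, so [P rd(v) = rd(v) Q] can be read off block by block. *)
Lemma block_constant_fixed (v : Rvec R m) :
  (forall i j, s i 0 = s j 0 -> v i 0 = v j 0) ->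
  (forall i, s i 0 = 0 -> v i 0 = 0) -> P ** rd v ** ctr Q = rd v.
Proof.
move=> vb v0; suff -> : P ** rd v = rd v ** Q.
  by rewrite -mmulA unitary_ctrr// mmul1r.
apply/matP => i j.
  rewrite mmul_rdl rd_mmul; have [sij|sij] := eqVneq (s i 0) (s j 0); last first.
    by rewrite P0// Q0// mul0r mulr0.
  have [si|si] := eqVneq (s i 0) 0.
    by rewrite !v0// -?sij// raddf0 mul0r mulr0.
  by rewrite (vb _ _ sij) PQ// mulrC.
rewrite mmul_rdr rd_mmul; have [si|si] := eqVneq (s i 0) 0.
  by rewrite v0// raddf0 mul0r.
by rewrite E3// mulr0.
Qed.

Definition sq_diag (c : 'I_m -> R) : Mat R k m m :=
  \matrix_(i, j) (if i == j then of_real k (c i) else 0).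

Lemma sq_diag_mmul (c : 'I_m -> R) n (X : Mat R k m n) i j :
  (sq_diag c ** X) i j = of_real k (c i) * X i j.
Proof.
rewrite mmulE (bigD1 i)//= big1 ?addr0 => [|l li]; rewrite mxE ?eqxx//.
by rewrite eq_sym (negbTE li) mul0r.
Qed.

Lemma sq_diag_comm c : (forall i j, s i 0 = s j 0 -> c i = c j) ->
  sq_diag c ** P = P ** sq_diag c.
Proof.
move=> cb; apply/matrixP => i j; rewrite sq_diag_mmul mmulE (bigD1 j)//=.
rewrite big1 ?addr0 => [|l lj]; rewrite mxE ?eqxx; last first.
  by rewrite (negbTE lj) mulr0.
have [/cb->|sij] := eqVneq (s i 0) (s j 0); first by rewrite mulrC.
by rewrite P0// mul0r mulr0.
Qed.

End BlockRotation.
Arguments sq_diag {R k m}.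

Lemma rotK (R : realType) (k : entries) m n (U : Mat R k m m) (X : Mat R k m n)
    (W : Mat R k n n) : orthogonal_mx U -> orthogonal_mx W ->
  ctr U ** (U ** X ** ctr W) ** W = X.
Proof.
move=> uU uW; rewrite !mmulA unitary_ctrl// mmul1l -mmulA unitary_ctrl//.
by rewrite mmul1r.
Qed.

Lemma rotKV (R : realType) (k : entries) m n (U : Mat R k m m) (X : Mat R k m n)
    (W : Mat R k n n) : orthogonal_mx U -> orthogonal_mx W ->
  U ** (ctr U ** X ** W) ** ctr W = X.
Proof.
move=> uU uW; rewrite !mmulA unitary_ctrr// mmul1l -mmulA unitary_ctrr//.
by rewrite mmul1r.
Qed.

Section SpectralLinear.
Context {R : realType} {k : entries} {m q : nat}.
Local Notation rd := (@rect_diag R k m (m + q)).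
Local Notation V := (Mat R k m (m + q)).

Lemma linear_sandwich (L : V -> V) A B C D : linear L ->
  linear (fun K : V => A ** L (B ** K ** C) ** D : V).
Proof.
move=> lL a X Y; rewrite mmulDr mmulDl mmulZr mmulZl lL.
by rewrite mmulDr mmulDl mmulZr mmulZl.
Qed.

(** The candidate derivative in normal directions must not depend on the frame. The diagonal part
    [c] of [M] becomes multiplication by a matrix that is scalar on blocks and commutes with the
    stabiliser; the part [e] reads off the diagonal in the frame [U0], [W0], and its block constancy
    makes this invariant. *)
Lemma spectral_linear (s : Rvec R m) (M : Rvec R m -> Rvec R m)
    (U0 : Mat R k m m) (W0 : Mat R k (m + q) (m + q)) :
  (forall i, 0 <= s i 0) -> linear M ->
  (forall p e, sact p e s = s -> forall x, M (sact p e x) = sact p e (M x)) ->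
  orthogonal_mx U0 -> orthogonal_mx W0 ->
  exists2 L : V -> V, linear L &
    forall U W x, orthogonal_mx U -> orthogonal_mx W ->
      U ** rd s ** ctr W = U0 ** rd s ** ctr W0 ->
      L (U ** rd x ** ctr W) = U ** rd (M x) ** ctr W.
Proof.
move=> s0 lM eqM uU0 uW0.
have [c [e [ME cb eb1 eb2 e0]]] := sact_equivariant_coeffs lM eqM.
pose Ee (x : Rvec R m) : Rvec R m := \col_i \sum_j e i j * x j 0.
have lE : linear Ee.
  move=> a x y; apply/matrixP => i j; rewrite !mxE mulr_sumr -big_split/=.
  by apply: eq_bigr => l _; rewrite !mxE mulrDr mulrCA.
pose L0 (K : V) : V := sq_diag c ** K + rd (Ee (diag_part K)).
pose L (K : V) : V := U0 ** L0 (ctr U0 ** K ** W0) ** ctr W0.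
have lL0 : linear L0.
  move=> a X Y; rewrite /L0 diag_part_linear lE rdD rdZ mmulDr mmulZr.
  by rewrite scalerDr addrACA.
exists L.
  exact: linear_sandwich lL0.
move=> U W x uU uW UW.
have [P [uP UE]] : exists P, orthogonal_mx P /\ U = U0 ** P.
  exists (ctr U0 ** U); rewrite mmulA unitary_ctrr// mmul1l; split => //.
  by apply: unitaryM => //; exact: unitary_ctr.
have [Q [uQ WE]] : exists Q, orthogonal_mx Q /\ W = W0 ** Q.
  exists (ctr W0 ** W); rewrite mmulA unitary_ctrr// mmul1l; split => //.
  by apply: unitaryM => //; exact: unitary_ctr.
have frameE y : U ** rd y ** ctr W = U0 ** (P ** rd y ** ctr Q) ** ctr W0.
  by rewrite UE WE ctrM !mmulA.
have frame y : ctr U0 ** (U ** rd y ** ctr W) ** W0 = P ** rd y ** ctr Q.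
  by rewrite frameE rotK.
have stab : P ** rd s ** ctr Q = rd s by rewrite -frame UW rotK.
have fix_ v := block_constant_fixed (v := v) s0 uP uQ stab.
(* Each row of [e] is a vector [w] whose [rd w] is fixed by the stabiliser, so pairing with it does
   not see the rotation by [P] and [Q]. *)
have EeK : Ee (diag_part (P ** rd x ** ctr Q)) = Ee x.
  apply/matrixP => i j; rewrite !mxE {j}.
  pose w : Rvec R m := \col_r e i r.
  have wE y : \sum_r e i r * (y : Rvec R m) r 0 = mdot (rd w) (rd y).
    rewrite mdot_sum; apply: eq_bigr => r _; rewrite big_split_ord/=.
    rewrite [X in _ + X]big1 ?addr0; last first.
      by move=> l _; rewrite !rdr mulr0 raddf0.
    rewrite (bigD1 r)//= big1 ?addr0.
      by rewrite !rdl eqxx sconj_real -rmorphM sRe_real mxE.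
    by move=> l lr; rewrite !rdl eq_sym (negbTE lr) mulr0 raddf0.
  have dE (X : V) : mdot (rd w) (rd (diag_part X)) = mdot (rd w) X.
    rewrite !mdot_sum; apply: eq_bigr => r _; rewrite !big_split_ord/=.
    congr (_ + _); apply: eq_bigr => l _; last by rewrite !rdr rmorph0 !mul0r.
    rewrite !rdl; case: eqP => [<-|_]; last by rewrite rmorph0 !mul0r.
    by rewrite sconj_real !sReZ sRe_real; congr (_ * _); rewrite mxE.
  rewrite !wE dE; rewrite -[in LHS](fix_ w).
  + by rewrite -mdot_rotate rotK.
  + by move=> a b sab; rewrite !mxE (eb2 _ _ _ sab).
  + by move=> a sa; rewrite mxE; case: (e0 a i sa).
rewrite /L frame /L0 EeK.
have -> : rd (M x) = sq_diag c ** rd x + rd (Ee x).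
  have -> : M x = \col_i (c i * x i 0) + Ee x.
    by apply/matrixP => i j; rewrite (ord1 j) ME !mxE.
  rewrite rdD; congr (_ + _); apply/matP => i j; rewrite sq_diag_mmul ?rdr ?mulr0//.
  by rewrite !rdl mxE; case: eqP => _; rewrite ?mulr0 ?rmorphM.
rewrite -[in LHS](fix_ (Ee x)); last 2 first.
- move=> a b sab; rewrite !mxE; apply: eq_bigr => r _.
  by rewrite (eb1 _ _ _ sab).
- move=> a sa; rewrite mxE big1// => r _; case: (e0 a r sa) => -> _.
  by rewrite mul0r.
rewrite !mmulA (sq_diag_comm s0 uP uQ stab cb) -!(mmulA P) -mmulDr -mmulDl.
by rewrite UE WE ctrM !mmulA.
Qed.

End SpectralLinear.

(** * Differentiability of spectral operators *)

Section Stabiliser.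
Context {R : realType} {m : nat}.
Implicit Types (c s x : Rvec R m).

Lemma norm_sactR p e x : `|sact p e x| = `|x|.
Proof. exact: (@norm_sact R RealEntries m 0). Qed.

(** A signed permutation fixing a point within [r] of [c] moves [c] by less than [2 * r], while
    distinct entries of [c] are at least [3 * r] apart and nonzero ones at least [3 * r] large. *)
Lemma stabiliser_near c r s p e : sorted_nonneg c -> gap c r -> near_pt c r s ->
  sact p e s = s -> sact p e c = c.
Proof.
move=> [_ c0] [r0 g1 g2] sc ps.
have d : `|sact p e c - c| < 2 * r.
  have -> : sact p e c - c = sact p e (c - s) + (s - c).
    by rewrite (linB _ _ (sact_linear p e)) ps addrA subrK.
  rewrite (le_lt_trans (ler_normD _ _))// norm_sactR distrC.
  by move: sc; rewrite /near_pt /=; lra.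
apply/matrixP => i j; rewrite (ord1 j) => {j}.
have := coord_le_norm (sact p e c - c) i; rewrite entryB sactE => h.
have {}h := le_lt_trans h d.
case: (e i) h => /=; rewrite ?expr1 ?mulN1r ?expr0 ?mul1r => h; last first.
  have [//|/g1] := eqVneq (c (p i) 0) (c i 0); move: h r0; lra.
have hp : c (p i) 0 + c i 0 < 2 * r.
  by move: h; rewrite -normrN opprB opprK ger0_norm ?addr_ge0// addrC.
have z l : c l 0 < 2 * r -> c l 0 = 0.
  move=> hl; have [//|/g2] := eqVneq (c l 0) 0.
  by rewrite ger0_norm//; move: hl r0; lra.
have := c0 i; have := c0 (p i) => h1 h2.
have e1 : c i 0 = 0 by apply: z; move: h1 h2 hp; lra.
have e2 : c (p i) 0 = 0 by apply: z; move: h1 h2 hp; lra.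
by rewrite e1 e2 oppr0.
Qed.

Lemma derivative_equivariant c r f C s M : adapted c r f C -> near_pt c r s ->
  has_diff f s M ->
  forall p e, sact p e s = s -> forall x, M (sact p e x) = sact p e (M x).
Proof.
move=> [cs cg feq fC] sc fM p e ps x; have [lM _] := fM.
have pc := stabiliser_near cs cg sc ps.
have lp := @sact_linear R m p e.
apply/eqP; rewrite -subr_eq0 -normr_le0; apply/ler_addgt0Pr => eps eps0.
rewrite add0r; have e20 : 0 < eps / 2 by rewrite divr_gt0.
have [d1 d10 h1] := has_diff_dir (sact p e x) fM e20.
have [d2 d20 h2] := has_diff_dir x fM e20.
have x0 : 0 < `|x| + 1 by rewrite ltr_wpDl.
pose d3 := (r - `|s - c|) / (`|x| + 1).
have d30 : 0 < d3 by rewrite divr_gt0// subr_gt0.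
pose d := Num.min (Num.min d1 d2) d3; pose t := d / 2.
have d0 : 0 < d by rewrite !lt_min d10 d20.
have t0 : 0 < t by rewrite divr_gt0.
have : t < d by rewrite ltr_pdivrMr// ltr_pMr// ltr1n.
rewrite !lt_min -andbA => /and3P[/(h1 _ t0) k1 /(h2 _ t0) k2 td3].
have near_t : near_pt c r (s + t *: x).
  rewrite /near_pt /= addrAC (le_lt_trans (ler_normD _ _))// normrZ gtr0_norm//.
  have : t * `|x| <= t * (`|x| + 1) by rewrite ler_pM2l// lerDl.
  by move: td3; rewrite ltr_pdivlMr//; lra.
have E : s + t *: sact p e x = sact p e (s + t *: x).
  by rewrite (linD _ _ lp) (linZ _ _ lp) ps.
rewrite E feq// -[in X in _ - X - _]ps feq// in k1.
have k3 : `|sact p e (f (s + t *: x) - f s - t *: M x)| <= eps / 2 * t.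
  by rewrite norm_sactR.
rewrite !(linB _ _ lp) (linZ _ _ lp) in k3.
rewrite -(@ler_pM2r _ t)// -[X in _ * X](gtr0_norm t0) mulrC -normrZ.
rewrite [eps in leRHS]splitr mulrDl; apply: le_trans (lerD k3 k1).
rewrite scalerBr; apply: le_trans (ler_normB _ _).
by rewrite le_eqVlt; apply/orP; left; apply/eqP; congr `|_|; mring.
Qed.

End Stabiliser.

Section Differentiability.
Context {R : realType} {k : entries} {m q : nat}.
Local Notation rd := (@rect_diag R k m (m + q)).
Local Notation V := (Mat R k m (m + q)).

Lemma normal_frame (s : Rvec R m) (U : Mat R k m m) (W : Mat R k (m + q) (m + q))
    (K : V) : orthogonal_mx U -> orthogonal_mx W ->
  normal (U ** rd s ** ctr W) K -> exists U' W' x,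
  [/\ orthogonal_mx U', orthogonal_mx W', U ** rd s ** ctr W = U' ** rd s ** ctr W'
    & K = U' ** rd x ** ctr W'].
Proof.
move=> uU uW nK.
have nK' : normal (rd s) (ctr U ** K ** W).
  by rewrite -(rotK (rd s) uU uW); apply: normal_rotate => //; exact: unitary_ctr.
have [P [Q [x [uP uQ stab KE]]]] := simultaneous_svd nK'.
exists (U ** P), (W ** Q), x; split.
- exact: unitaryM.
- exact: unitaryM.
- by rewrite -{1}stab ctrM !mmulA.
- by rewrite -[K](rotKV _ uU uW) KE ctrM !mmulA.
Qed.

(** The candidate is a commutator along the tangent space plus [L] along the normal space. For each
    [H] a frame shared by [X] and [P H] is chosen; the expansion applies in it, and [L] acts by [M]
    in every such frame. *)
Lemma spectral_operator_has_diff c r f C s M U W : adapted c r f C ->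
  near_pt c r s -> sorted_nonneg s -> has_diff f s M ->
  orthogonal_mx U -> orthogonal_mx W ->
  exists D, has_diff (spectral_operator f : V -> V) (U ** rd s ** ctr W) D.
Proof.
move=> fa sc [ss s0] fM uU uW; have [lM fMo] := fM.
have Meq := derivative_equivariant fa sc fM.
have [L lL LE] := spectral_linear s0 lM Meq uU uW.
set X := U ** rd s ** ctr W in LE *; pose G := spectral_operator f : V -> V.
have [A [B [P [lA lB lP dec]]]] := linear_decomposition X.
have lD : linear (fun H => A H ** G X - G X ** B H + L (P H)).
  move=> a x y; rewrite lA lB lP lL mmulDl mmulDr mmulZl mmulZr.
  by move: (A x ** _) (A y ** _) (_ ** B x) (_ ** B y) (L _) (L _) => *; mring.
exists (fun H => A H ** G X - G X ** B H + L (P H)); split => // e e0.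
have [a a0 Aa] := linear_bounded lA; have [b b0 Bb] := linear_bounded lB.
have [p p0 Pp] := linear_bounded lP.
pose l := a + b + p; have l0 : 0 < l by rewrite !addr_gt0.
have [rho [K [rho0 K0 exp]]] := @spectral_operator_expand R k m q c r f C s fa sc.
have [d1 d10 fd1] := fMo (e / (2 * p)) (divr_gt0 e0 (mulr_gt0 (ltr0Sn R 1) p0)).
(* Half of [e] pays for the second-order term, at most [K * (l * |H|)^2], and half for the
   differentiability of [f], scaled by the bound [p] on [P]. *)
pose S := 2 * (K * l ^+ 2 + 1).
have S0 : 0 < S by rewrite mulr_gt0// ltr_wpDl// mulr_ge0// sqr_ge0.
pose d := Num.min (Num.min (rho / l) (d1 / p)) (e / S).
exists d; first by rewrite !lt_min !divr_gt0.
move=> H; rewrite !lt_min -andbA !ltr_pdivlMr// => /and3P[Hrho Hd1 He].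
have [sA sB nP HE] := dec H.
have [U' [W' [y [uU' uW' XE PE]]]] := normal_frame uU uW nP.
have yP : `|y| = `|P H|.
  by rewrite PE norm_unitaryr ?norm_unitaryl ?norm_rd//; exact: unitary_ctr.
have tl : `|A H| + `|B H| + `|y| <= l * `|H|.
  by rewrite yP /l !mulrDl !lerD.
have tr : `|A H| + `|B H| + `|y| <= rho.
  by rewrite (le_trans tl)// mulrC ltW.
have := exp U' W' (A H) (B H) y X G uU' uW' sA sB tr XE erefl.
rewrite -PE -HE => h1.
have LPE : L (P H) = U' ** rd (M y) ** ctr W' by rewrite PE LE.
have yd : `|y| < d1.
  by rewrite yP (le_lt_trans (Pp H))// mulrC.
have h2 : `|U' ** rd (f (s + y) - f s - M y) ** ctr W'| <= e / 2 * `|H|.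
  rewrite norm_unitaryr ?norm_unitaryl ?norm_rd//; last exact: unitary_ctr.
  rewrite (le_trans (fd1 _ yd))//.
  have := Pp H; rewrite -yP => h.
  have := ler_wpM2l (ltW (divr_gt0 e0 (mulr_gt0 (ltr0Sn R 1) p0))) h => /le_trans.
  by apply; rewrite le_eqVlt; apply/orP; left; apply/eqP; field; rewrite gt_eqF.
rewrite LPE.
have -> : G (X + H) - G X - (A H ** G X - G X ** B H + U' ** rd (M y) ** ctr W') =
  (G (X + H) - G X -
    (A H ** G X - G X ** B H + U' ** rd (f (s + y) - f s) ** ctr W')) +
  U' ** rd (f (s + y) - f s - M y) ** ctr W'.
  by rewrite [rd (_ - M y)]rdB mmulBr mmulBl !opprD !addrA subrK.
rewrite (le_trans (ler_normD _ _))// [e]splitr mulrDl lerD//.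
rewrite (le_trans h1)//.
have t0 : 0 <= `|A H| + `|B H| + `|y| by rewrite !addr_ge0.
have h3 : K * (`|A H| + `|B H| + `|y|) ^+ 2 <= K * (l * `|H|) ^+ 2.
  by rewrite ler_wpM2l// ler_pXn2r ?nnegrE// mulr_ge0// ltW.
apply: (le_trans h3).
have -> : K * (l * `|H|) ^+ 2 = (K * l ^+ 2 * `|H|) * `|H| by ring.
rewrite ler_wpM2r//; move: He; rewrite /S; have := normr_ge0 H; lra.
Qed.

(** The converse passage: restricting to a diagonal slice and compressing by [diag_part] turns a
    derivative of [F] into one of [f]. Only increments of [F] enter, so it serves both [G] and
    [Psi]. *)
Lemma has_diff_diagonal (F : V -> V) (Z : V) D (f : Rvec R m -> Rvec R m) x d U W :
  orthogonal_mx U -> orthogonal_mx W -> 0 < d ->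
  (forall y : Rvec R m, `|y| < d -> F (Z + U ** rd y ** ctr W) - F Z =
    U ** rd (f (x + y) - f x) ** ctr W) ->
  has_diff F Z D -> exists M, has_diff f x M.
Proof.
move=> uU uW d0 Ff [lD FD].
pose M (y : Rvec R m) := diag_part (ctr U ** D (U ** rd y ** ctr W) ** W).
have lM : linear M.
  move=> a y z; rewrite /M rdD rdZ mmulDr mmulDl mmulZr mmulZl lD.
  by rewrite mmulDr mmulDl mmulZr mmulZl diag_part_linear.
exists M; split => // e e0; have [d' d'0 Fd'] := FD _ e0.
exists (Num.min d d'); first by rewrite lt_min d0.
move=> y; rewrite lt_min => /andP[yd yd'].
have nE z : `|U ** rd z ** ctr W| = `|z|.
  by rewrite norm_unitaryr ?norm_unitaryl ?norm_rd//; exact: unitary_ctr.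
have := Fd' (U ** rd y ** ctr W); rewrite nE Ff// => /(_ yd').
apply: le_trans; set E := D _.
have -> : f (x + y) - f x - M y =
    diag_part (ctr U ** (U ** rd (f (x + y) - f x) ** ctr W - E) ** W).
  rewrite mmulBr mmulBl rotK// (linB _ _ (@diag_part_linear R k m q)).
  by rewrite diag_partK.
rewrite (le_trans (norm_diag_part _))// norm_unitaryr// norm_unitaryl//.
exact: unitary_ctr.
Qed.

End Differentiability.

(** * Directional derivatives and B-subdifferentials *)

Section DirectionalDerivative.
Context {R : realType} {V W : normedModType R}.
Implicit Types (F : V -> W) (z h : V).

Lemma dir_quotientB F z h (t : R) w : 0 < t ->
  `|w - dir_quotient F z h t| = t^-1 * `|F (z + t *: h) - F z - t *: w|.
Proof.
move=> t0; have t_neq0 : t != 0 by rewrite gt_eqF.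
rewrite -[t^-1 in RHS](@gtr0_norm _ t^-1) ?invr_gt0// -normrZ distrC.
by rewrite /dir_quotient [in RHS]scalerBr scalerA mulVf// scale1r.
Qed.

Lemma dir_quotient_cvg F z h w :
  (forall e : R, 0 < e -> exists2 d, 0 < d & forall t, 0 < t -> t < d ->
    `|F (z + t *: h) - F z - t *: w| <= e * t) ->
  dir_quotient F z h t @[t --> 0^'+] --> w.
Proof.
move=> Fw; apply/cvgrPdist_le => e e0; have [d d0 dF] := Fw _ e0.
near=> t.
have t0 : 0 < t by near: t; exact: nbhs_right_gt.
have td : t < d by near: t; exact: nbhs_right_lt.
by rewrite dir_quotientB// mulrC ler_pdivrMr// dF.
Unshelve. all: by end_near. Qed.

Lemma dir_derivativeE F z h w :
  (forall e : R, 0 < e -> exists2 d, 0 < d & forall t, 0 < t -> t < d ->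
    `|F (z + t *: h) - F z - t *: w| <= e * t) ->
  dir_derivative F z h = w.
Proof.
by move/dir_quotient_cvg/cvg_lim; apply; exact: norm_hausdorff.
Qed.

Lemma dir_differentiable_expand F z h : dir_differentiable F z ->
  forall e : R, 0 < e -> exists2 d, 0 < d & forall t, 0 < t -> t < d ->
    `|F (z + t *: h) - F z - t *: dir_derivative F z h| <= e * t.
Proof.
move=> /(_ h) Fh e e0; have /cvgrPdist_le/(_ _ e0) := Fh.
move=> [d d0 dF]; exists d => // t t0 td.
have := dF t; rewrite /= sub0r normrN gtr0_norm// => /(_ td t0).
by rewrite dir_quotientB// mulrC ler_pdivrMr.
Qed.

Lemma strictly_differentiable0P F z :
  strictly_differentiable_with_zero_derivative F z ->
  forall e : R, 0 < e -> exists2 d, 0 < d & forall x y,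
    `|x - z| < d -> `|y - z| < d -> `|F x - F y| <= e * `|x - y|.
Proof.
move=> /cvgrPdist_le Fz e e0; have := Fz _ e0.
move=> /nbhs_ballP[d d0 dF]; exists d => // x y xd yd.
have [->|xy] := eqVneq x y; first by rewrite !subrr !normr0 mulr0.
have n0 : 0 < `|x - y| by rewrite normr_gt0 subr_eq0.
have := dF (x, y); rewrite /= sub0r normrN normrZ normfV normr_id.
have zd : ball (z, z) d (x, y).
  by split; rewrite -ball_normE /= distrC.
by move=> /(_ zd xy); rewrite mulrC ler_pdivrMr.
Qed.

Lemma locally_lipschitz_nearP F z : locally_lipschitz_near F z ->
  exists d L, [/\ 0 < d, 0 <= L & forall x y,
    `|x - z| < d -> `|y - z| < d -> `|F x - F y| <= L * `|x - y|].
Proof.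
move=> [ O [oO Oz] /pinfty_ex_gt0 [L L0 FL]].
have /nbhs_ballP[d d0 dO] : nbhs z O by exact: open_nbhs_nbhs.
exists d, L; split => //; first exact: ltW.
move=> x y xd yd; apply: (FL (x, y)); split; apply: dO;
  by rewrite -ball_normE /= distrC.
Qed.

End DirectionalDerivative.

Section SubdifferentialCharacterisation.
Context {R : realType} {k : entries} {m n : nat}.
Local Notation V := (Mat R k m n).
Implicit Types (F L D : V -> V) (O : set V).

(** Replaces sequences by approximation at every scale; a sequence is recovered with the tolerances
    [1 / (i + 1)]. *)
Lemma B_subdifferentialP O F z L : B_subdifferential O F z L <->
  forall e : R, 0 < e -> exists x D, [/\ O x, `|x - z| < e, has_diff F x D
    & forall h, `|D h - L h| <= e * `|h|].
Proof.
split=> [[zs [Ozs zsz zsL]] e e0|FL].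
  have /cvgrPdist_lt/(_ _ e0) zse := zsz.
  have [i [ze Le]] := filter_ex (filterI zse (zsL _ e0)).
  have [Oi /differentiable_has_diff di] := Ozs i.
  by exists (zs i), ('d F (zs i)); split => //; rewrite distrC.
have /choice[zD zDP] : forall i : nat, exists xD : V * (V -> V),
    [/\ O xD.1, `|xD.1 - z| < i.+1%:R^-1, has_diff F xD.1 xD.2
      & forall h, `|xD.2 h - L h| <= i.+1%:R^-1 * `|h|].
  move=> i; have i0 : (0 : R) < i.+1%:R^-1 by rewrite invr_gt0.
  by have [x [D [h1 h2 h3 h4]]] := FL _ i0; exists (x, D).
exists (fun i => (zD i).1); split.
- by move=> i; have [h1 _ /has_diff_differentiable h3 _] := zDP i.
- apply/cvgrPdist_lt => e e0; near=> i.
  have [_ + _ _] := zDP i; rewrite distrC => /lt_trans; apply.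
  by near: i; exact: near_infty_natSinv_lt (PosNum e0).
- move=> e e0; near=> i; have [_ _ /has_diff_diff -> h4] := zDP i => h.
  rewrite (le_trans (h4 h))// ler_wpM2r// ltW//.
  by near: i; exact: near_infty_natSinv_lt (PosNum e0).
Unshelve. all: by end_near. Qed.

Lemma has_diff_translate F z a D : has_diff F (z + a) D ->
  has_diff (fun x => F (z + x)) a D.
Proof.
move=> [lD FD]; split => // e /FD[d d0 dF].
by exists d => // h /dF; rewrite addrA.
Qed.

End SubdifferentialCharacterisation.

(** * The first-order model *)

Section LocalModel.
Context {R : realType} {m : nat}.
Variables (c : Rvec R m) (g : Rvec R m -> Rvec R m).
Hypothesis c_sorted : sorted_nonneg c.
Hypothesis g_eq : exists2 r, 0 < r & stab_equivariant g c r.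
Hypothesis g_lip : locally_lipschitz_near g c.
Hypothesis g_dir : dir_differentiable g c.

Local Notation phi := (dir_derivative g c).

Definition model_error (x : Rvec R m) := g x - g c - phi (x - c).

Hypothesis d_small : forall e : R, 0 < e -> exists2 d, 0 < d & forall x y,
  near_pt c d x -> near_pt c d y ->
  `|model_error x - model_error y| <= e * `|x - y|.

Lemma dir_derivative0 : phi 0 = 0.
Proof.
apply: dir_derivativeE => e e0; exists 1 => // t t0 _.
by rewrite !scaler0 addr0 subrr subr0 normr0 mulr_ge0// ltW.
Qed.

Lemma dir_derivative_equivariant p e : sact p e c = c ->
  forall h, phi (sact p e h) = sact p e (phi h).
Proof.
move=> pc h; have [r r0 geq] := g_eq; have lp := @sact_linear R m p e.
apply: dir_derivativeE => eps eps0.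
have [d d0 dg] := dir_differentiable_expand h g_dir eps0.
have h0 : 0 < `|h| + 1 by rewrite ltr_wpDl.
exists (Num.min d (r / (`|h| + 1))); first by rewrite lt_min d0 divr_gt0.
move=> t t0; rewrite lt_min => /andP[td].
rewrite ltr_pdivlMr// => tr.
have cB : near_pt c r c by rewrite /near_pt /= subrr normr0.
have tB : near_pt c r (c + t *: h).
  rewrite /near_pt /= addrAC subrr add0r normrZ gtr0_norm//.
  by apply: le_lt_trans tr; rewrite ler_pM2l// lerDl.
have -> : c + t *: sact p e h = sact p e (c + t *: h).
  by rewrite (linD _ _ lp) (linZ _ _ lp) pc.
rewrite geq// -[in X in _ - X - _]pc geq// -(linZ _ _ lp) -!(linB _ _ lp).
by rewrite norm_sactR; exact: dg.
Qed.

Lemma near_ptS r r' : r <= r' -> near_pt c r `<=` near_pt c r'.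
Proof. by move=> rr' x; rewrite /near_pt /= => /lt_le_trans; apply. Qed.

Lemma adaptedS r r' f C : 0 < r' -> r' <= r -> adapted c r f C -> adapted c r' f C.
Proof.
move=> r'0 rr' [cs cg feq [C0 f1 f2 f3]]; have sub := near_ptS rr'; split => //.
- exact: gapS rr'.
- by move=> p e x pc /sub; exact: feq.
- split => //.
  + by move=> x i j /sub; exact: f1.
  + by move=> x i j /sub; exact: f2.
  + by move=> x y /sub xc /sub; exact: f3.
Qed.

(** The constant comes from [|f| <= |f c| + L * r] in [equivariant_bounds]. For [model_error], which
    vanishes at [c], only [4 * L] remains, so it can be made arbitrarily small. *)
Lemma adapted_lipschitz f r L : gap c r -> stab_equivariant f c r -> 0 <= L ->
  (forall x y, near_pt c r x -> near_pt c r y -> `|f x - f y| <= L * `|x - y|) ->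
  adapted c r f (4 * L + 2 * (`|f c| / r)).
Proof.
move=> cg feq L0 fL; have [r0 _ _] := cg.
have cB : near_pt c r c by rewrite /near_pt /= subrr normr0.
split => //.
have -> : 4 * L + 2 * (`|f c| / r) = 2 * L + 2 * ((`|f c| + L * r) / r).
  by field; rewrite gt_eqF.
apply: equivariant_bounds => //.
  by rewrite addr_ge0// mulr_ge0// ltW.
move=> x xc; rewrite -[f x](subrK (f c)) addrC (le_trans (ler_normD _ _))//.
rewrite lerD2l (le_trans (fL _ _ xc cB))// ler_wpM2l// ltW//.
Qed.

Lemma model_error_center : model_error c = 0.
Proof. by rewrite /model_error !subrr dir_derivative0 subr0. Qed.

Lemma adapted_g : exists r C, adapted c r g C.
Proof.
have [r1 r10 geq] := g_eq.
have [r2 [L [r20 L0 gL]]] := locally_lipschitz_nearP g_lip.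
have [r3 cg] := gap_exists c; have [r30 _ _] := cg.
pose r := Num.min (Num.min r1 r2) r3.
have r0 : 0 < r by rewrite !lt_min r10 r20.
have [rr1 rr2 rr3] : [/\ r <= r1, r <= r2 & r <= r3] by rewrite !ge_min !lexx ?orbT.
exists r, (4 * L + 2 * (`|g c| / r)); apply: adapted_lipschitz => //.
- exact: gapS cg _ _.
- by move=> p e x pc /(near_ptS rr1); exact: geq.
- by move=> x y /(near_ptS rr2) xc /(near_ptS rr2) yc; exact: gL.
Qed.

Lemma model_equivariant : stab_equivariant (fun x => phi (x - c)) c 1.
Proof.
move=> p e x pc _; rewrite -(dir_derivative_equivariant pc).
by rewrite (linB _ _ (@sact_linear R m p e)) pc.
Qed.

Lemma model_error_equivariant r : stab_equivariant g c r -> 0 < r ->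
  stab_equivariant model_error c r.
Proof.
move=> geq r0 p e x pc xc; have lp := @sact_linear R m p e.
have cB : near_pt c r c by rewrite /near_pt /= subrr normr0.
have e1 : sact p e (phi (x - c)) = phi (sact p e x - c).
  by rewrite -(dir_derivative_equivariant pc) (linB _ _ lp) pc.
have e2 : sact p e (g c) = g c by rewrite -geq// pc.
by rewrite /model_error (linB _ _ lp) (linB _ _ lp) e1 e2 geq.
Qed.

Lemma adapted_error e : 0 < e -> exists2 r, 0 < r & adapted c r model_error e.
Proof.
move=> e0; have e40 : 0 < e / 4 by rewrite divr_gt0.
have [r1 r10 geq] := g_eq; have [r2 r20 dL] := d_small e40.
have [r3 cg] := gap_exists c; have [r30 _ _] := cg.
pose r := Num.min (Num.min r1 r2) r3.
have r0 : 0 < r by rewrite !lt_min r10 r20.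
have [rr1 rr2 rr3] : [/\ r <= r1, r <= r2 & r <= r3] by rewrite !ge_min !lexx ?orbT.
exists r => //.
have -> : e = 4 * (e / 4) + 2 * (`|model_error c| / r).
  by rewrite model_error_center normr0 mul0r mulr0 addr0 mulrC divfK.
apply: adapted_lipschitz => //.
- exact: gapS cg _ _.
- apply: model_error_equivariant => // p z x pc /(near_ptS rr1); exact: geq.
- exact: ltW.
- by move=> x y /(near_ptS rr2) xc /(near_ptS rr2) yc; exact: dL.
Qed.

(** [phi (x - c)] is [g x] minus a constant and the error, so near [c] it has the Lipschitz constant
    [L] of [g] plus 1 for the error. *)
Lemma adapted_model : exists r C, adapted c r (fun x => phi (x - c)) C.
Proof.
have [r2 [L [r20 L0 gL]]] := locally_lipschitz_nearP g_lip.
have [r1 r10 dL] := d_small (@ltr01 R).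
have [r3 cg] := gap_exists c; have [r30 _ _] := cg.
pose r := Num.min (Num.min r1 r2) (Num.min r3 1).
have r0 : 0 < r by rewrite !lt_min r10 r20 r30 ltr01.
have [rr1 rr2 rr3 rr4] : [/\ r <= r1, r <= r2, r <= r3 & r <= 1].
  by rewrite !ge_min !lexx ?orbT.
pose f x := phi (x - c).
exists r, (4 * (L + 1) + 2 * (`|f c| / r)); apply: adapted_lipschitz.
- exact: gapS cg _ _.
- by move=> p e x pc /(near_ptS rr4); exact: model_equivariant.
- exact: addr_ge0.
- move=> x y xc yc; have := dL x y (near_ptS rr1 xc) (near_ptS rr1 yc).
  have := gL x y (near_ptS rr2 xc) (near_ptS rr2 yc) => h1 h2.
  rewrite mulrDl; apply: le_trans (lerD h1 h2).
  apply: le_trans (ler_normB _ _).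
  rewrite le_eqVlt; apply/orP; left; apply/eqP; congr `|_|.
  by rewrite /model_error; move: (phi _) (phi _) => *; mring.
Qed.

End LocalModel.

(** * The directional derivative on the normal slice *)

(** Normality makes [H X^H] and [X^H H] Hermitian, and Hermitian matrices are orthogonal to skew
    ones; so [H] is orthogonal to its own tangential expression. *)
Lemma tangent_normal_eq0 (R : realType) (k : entries) m n (X H : Mat R k m n) :
  tangent X H -> normal X H -> H = 0.
Proof.
move=> [A [B [sA sB HE]]] [n1 n2]; apply: mdot_eq0.
rewrite [in X in mdot X _]HE mdotBl mdot_mulr mdot_mull.
have sh p (C S : Mat R k p p) : skew C -> ctr S = S -> mdot C S = 0.
  move=> sC sS; have : mdot C S = - mdot C S.
    by rewrite -{1}mdot_ctr sC sS mdotC mdotNr mdotC.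
  by move=> h; lra.
by rewrite (sh _ A) ?ctrM ?ctrK// (sh _ B) ?ctrM ?ctrK// subrr.
Qed.

Lemma has_diff_shift (R : realType) (k : entries) m n (k' : entries) m' n'
    (F : Mat R k m n -> Mat R k' m' n') c y D :
  has_diff F y D <-> has_diff (fun x => F (x - c)) (c + y) D.
Proof.
have E h : c + y + h - c = y + h by mring.
have E0 : c + y - c = y by mring.
split=> -[lD FD]; (split; first exact: lD) => e /FD[d d0 dF];
  exists d => // h /dF; by rewrite (E h) E0.
Qed.

(* Unification would otherwise try to unfold these definitions. *)
Local Opaque spectral_operator sigma dir_derivative.

Section Frames.
Context {R : realType} {k : entries} {m q : nat}.
Local Notation rd := (@rect_diag R k m (m + q)).
Local Notation V := (Mat R k m (m + q)).
Implicit Types (Xbar : V).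

Definition frame Xbar (U : Mat R k m m) (W : Mat R k (m + q) (m + q)) :=
  [/\ orthogonal_mx U, orthogonal_mx W & Xbar = U ** rd (sigma Xbar) ** ctr W].

Lemma dir_derivative_frame g Xbar A B U W y :
  (exists r C, adapted (sigma Xbar) r g C) -> dir_differentiable g (sigma Xbar) ->
  skew A -> skew B -> frame Xbar U W ->
  dir_derivative (spectral_operator g) Xbar (A ** Xbar - Xbar ** B + U ** rd y ** ctr W) =
  A ** spectral_operator g Xbar - spectral_operator g Xbar ** B +
    U ** rd (dir_derivative g (sigma Xbar) y) ** ctr W.
Proof.
move=> [r [C ga]] g_dir sA sB [uU uW XE].
set c := sigma Xbar in ga g_dir XE *; set G := spectral_operator g.
set phi := dir_derivative g c.
have [_ [r0 _ _] _ _] := ga.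
have cc : near_pt c r c by rewrite /near_pt /= subrr normr0.
have [rho [K [rho0 K0 exp]]] := @spectral_operator_expand R k m q c r g C c ga cc.
apply: dir_derivativeE => e e0; have e20 : 0 < e / 2 by rewrite divr_gt0.
have [d d0 dg] := dir_differentiable_expand y g_dir e20; rewrite -/phi in dg.
pose T := `|A| + `|B| + `|y|; have T0 : 0 <= T by rewrite !addr_ge0.
have T1 : 0 < T + 1 by rewrite ltr_wpDl.
have KT0 : 0 <= K * T ^+ 2 by rewrite mulr_ge0// sqr_ge0.
have KT1 : 0 < K * T ^+ 2 + 1 by rewrite ltr_wpDl.
exists (Num.min (Num.min d (rho / (T + 1))) (e / 2 / (K * T ^+ 2 + 1))).
  by rewrite !lt_min d0 !divr_gt0.
move=> t t0; rewrite !lt_min -andbA => /and3P[td].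
rewrite !ltr_pdivlMr// => trho te.
have TE : `|t *: A| + `|t *: B| + `|t *: y| = t * T.
  by rewrite !normrZ gtr0_norm// -!mulrDr.
have tT : `|t *: A| + `|t *: B| + `|t *: y| <= rho.
  by rewrite TE (le_trans _ (ltW trho))// ler_pM2l// lerDl.
have := exp U W _ _ _ Xbar G uU uW (skewZ t sA) (skewZ t sB) tT XE erefl.
rewrite TE; set E1 := (X in `|X| <= _) => h1.
have h2 : `|U ** rd (g (c + t *: y) - g c - t *: phi y) ** ctr W| <= e / 2 * t.
  by rewrite norm_rotate// norm_rd dg.
have -> : G (Xbar + t *: (A ** Xbar - Xbar ** B + U ** rd y ** ctr W)) - G Xbar
    - t *: (A ** G Xbar - G Xbar ** B + U ** rd (phi y) ** ctr W) =
    E1 + U ** rd (g (c + t *: y) - g c - t *: phi y) ** ctr W.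
  rewrite /E1 [rd (_ - t *: _)]rdB !rdZ !(mmulZl, mmulZr) mmulBr mmulBl.
  rewrite !(mmulZl, mmulZr) !scalerDr !scalerN.
  by move: (G _) (_ ** ctr W) (A ** G _) => *; mring.
rewrite (le_trans (ler_normD _ _))// [e in leRHS]splitr mulrDl lerD//.
rewrite (le_trans h1)// exprMn.
have -> : K * (t ^+ 2 * T ^+ 2) = t * (K * T ^+ 2) * t by ring.
rewrite ler_wpM2r ?(ltW t0)//.
have : t * (K * T ^+ 2) <= t * (K * T ^+ 2 + 1) by rewrite ler_pM2l// lerDl.
by move: te; lra.
Qed.

End Frames.

(** * Comparison of [G] and [Psi] on the normal slice *)

Section Core.
Context {R : realType} {k : entries} {m q : nat}.
Local Notation rd := (@rect_diag R k m (m + q)).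
Local Notation V := (Mat R k m (m + q)).
Variables (Xbar : V) (g : Rvec R m -> Rvec R m).
Local Notation c := (sigma Xbar).
Variables (phi : Rvec R m -> Rvec R m) (Psi : V -> V).
Let model x := phi (x - c).
Let error x := g x - g c - phi (x - c).
Hypothesis g_adapted : exists r C, adapted c r g C.
Hypothesis model_adapted : exists r C, adapted c r model C.
Hypothesis error_adapted : forall e, 0 < e -> exists2 r, 0 < r & adapted c r error e.
Hypothesis g_diff : exists2 d, 0 < d & forall y, `|y| < d ->
  (exists M, has_diff g (c + y) M) <-> (exists M, has_diff phi y M).

Local Notation G := (spectral_operator g : V -> V).

Hypothesis Psi_frame : forall A B U W y, skew A -> skew B -> frame Xbar U W ->
  Psi (A ** Xbar - Xbar ** B + U ** rd y ** ctr W) =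
  A ** G Xbar - G Xbar ** B + U ** rd (phi y) ** ctr W.

Lemma Psi_diag U W y : frame Xbar U W -> Psi (U ** rd y ** ctr W) = U ** rd (phi y) ** ctr W.
Proof.
move=> fr; have := Psi_frame y (@skew0 R k m) (@skew0 R k (m + q)) fr.
by rewrite !(mmul0l, mmul0r, subr0, add0r).
Qed.

Lemma frame_normal K : normal Xbar K ->
  exists U W y, frame Xbar U W /\ K = U ** rd y ** ctr W.
Proof.
move=> nK; have [U [W [uU uW XE]]] := sigma_svd Xbar.
rewrite XE in nK; have [U' [W' [y [uU' uW' E KE]]]] := normal_frame uU uW nK.
by exists U', W', y; split => //; split => //; rewrite -E.
Qed.

Lemma Psi_decomposition A B K : skew A -> skew B -> normal Xbar K ->
  Psi (A ** Xbar - Xbar ** B + K) = A ** G Xbar - G Xbar ** B + Psi K.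
Proof.
move=> sA sB /frame_normal[U [W [y [fr ->]]]].
by rewrite Psi_frame// Psi_diag.
Qed.

Lemma PsiD_tangent Z A B : skew A -> skew B ->
  Psi (Z + (A ** Xbar - Xbar ** B)) = Psi Z + (A ** G Xbar - G Xbar ** B).
Proof.
move=> sA sB; have [K [[A' [B' [sA' sB' ZE]]] nK]] := tangent_normal Xbar Z.
have -> : Z = A' ** Xbar - Xbar ** B' + K by rewrite -ZE subrK.
have -> : A' ** Xbar - Xbar ** B' + K + (A ** Xbar - Xbar ** B) =
    (A' + A) ** Xbar - Xbar ** (B' + B) + K.
  by rewrite mmulDl mmulDr; move: (_ ** _) (_ ** B') (_ ** _) (_ ** B) => *; mring.
rewrite !Psi_decomposition//; [|exact: skewD..].
rewrite mmulDl mmulDr.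
by move: (A' ** _) (_ ** B') (A ** _) (_ ** B) (Psi _) => *; mring.
Qed.

(** [spectral_operator_has_diff] is available at sorted diagonals, but a normal direction comes with
    an unsorted [y]; sorting by the stabiliser of [c] changes the frame and [y], not the matrix. *)
Lemma frame_sorted U W y : frame Xbar U W -> exists U' W' y',
  [/\ frame Xbar U' W', `|y'| = `|y|, U' ** rd y' ** ctr W' = U ** rd y ** ctr W
    & block_sorted c (c + y')].
Proof.
move=> [uU uW XE]; have [p [e [pc bs]]] := block_sort c y.
have [P [Q [uP uQ PQ]]] := @sact_rd R k m q p e.
have rot z : U ** ctr P ** rd (sact p e z) ** ctr (W ** ctr Q) =
    U ** rd z ** ctr W.
  rewrite PQ ctrM ctrK !mmulA -(mmulA U (ctr P) P) unitary_ctrl// mmul1r.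
  by rewrite -(mmulA _ (ctr Q) Q) unitary_ctrl// mmul1r.
exists (U ** ctr P), (W ** ctr Q), (sact p e y); split => //.
- split; first by apply: unitaryM => //; exact: unitary_ctr.
    by apply: unitaryM => //; exact: unitary_ctr.
  by rewrite -[in RHS]pc rot.
- exact: norm_sactR.
- have [h1 h2] := bs; split=> [i j ij cij|i ci]; rewrite !mxE.
    by rewrite cij lerD2l; have := h1 _ _ ij cij; rewrite !mxE.
  by rewrite ci add0r; have := h2 _ ci; rewrite mxE.
Qed.

Lemma near_center y r : `|y| < r -> near_pt c r (c + y).
Proof. by rewrite /near_pt /= addrAC subrr add0r. Qed.

Lemma frame_shift U W y : frame Xbar U W ->
  Xbar + U ** rd y ** ctr W = U ** rd (c + y) ** ctr W.
Proof. by case=> _ _ XE; rewrite rdD mmulDr mmulDl -XE. Qed.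

Lemma model_has_diff y M : has_diff phi y M <-> has_diff model (c + y) M.
Proof.
exact: has_diff_shift.
Qed.

(* On the slice [Xbar + normal space] the map [Psi] is the spectral operator
   of the first-order model of [g]; along the tangent space of the orbit it is
   linear. *)
Lemma Psi_has_diff r C U W y D : adapted c r model C ->
  frame Xbar U W -> `|y| < r ->
  has_diff (spectral_operator model : V -> V) (U ** rd (c + y) ** ctr W) D ->
  exists D', has_diff Psi (U ** rd y ** ctr W) D'.
Proof.
move=> fa fr yr [lD FD]; have [uU uW XE] := fr.
have [A [B [P [lA lB lP dec]]]] := linear_decomposition Xbar.
pose F := spectral_operator model : V -> V.
(* A formula for [Psi] near [K]: a linear map plus [F] after an affine one. Its derivative is then
   given by the chain rule. *)
have PsiF Z : `|P Z| < r ->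
    Psi Z = A Z ** G Xbar - G Xbar ** B Z + F (Xbar + P Z).
  move=> Zr; have [sA sB nP ZE] := dec Z.
  rewrite {1}ZE Psi_decomposition//; congr (_ + _).
  have [U' [W' [z [fr' PE]]]] := frame_normal nP.
  have [uU' uW' _] := fr'.
  have zr : `|z| < r by move: Zr; rewrite PE norm_rotate// norm_rd.
  rewrite PE Psi_diag// frame_shift//.
  have [_ FE] := spectral_operator_near fa (near_center zr) uU' uW'.
  have cz : c + z - c = z by mring.
  by rewrite /F FE /model cz.
set K := U ** rd y ** ctr W.
have Kr : `|K| < r by rewrite norm_rotate// norm_rd.
have nK : normal Xbar K.
  rewrite {1}XE; apply: normal_rotate => //; last exact: normal_rd.
  exact: unitary_ctr.
(* Although [P] comes from a choice, it fixes normal vectors: [P K - K] is both tangent and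
   normal. *)
have PK : P K = K.
  have [sA sB nP KE] := dec K; apply/eqP; rewrite -subr_eq0; apply/eqP.
  apply: (@tangent_normal_eq0 R k m (m + q) Xbar).
    exists (- A K), (- B K); split.
    - by rewrite -scaleN1r; exact: skewZ.
    - by rewrite -scaleN1r; exact: skewZ.
    - by rewrite mmulNl mmulNr {2}KE; move: (_ ** _) (_ ** B K) => *; mring.
  by rewrite addrC -scaleN1r; exact: normal_linear.
have [p p0 Pp] := linear_bounded lP.
exists (fun h => A h ** G Xbar - G Xbar ** B h + D (P h)); split.
  move=> a x z; rewrite lA lB lP lD mmulDl mmulDr mmulZl mmulZr.
  by move: (A x ** _) (A z ** _) (_ ** B x) (_ ** B z) (D _) (D _) => *; mring.
move=> e e0; have [d d0 dF] := FD (e / p) (divr_gt0 e0 p0).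
exists (Num.min (d / p) ((r - `|K|) / p)).
  by rewrite lt_min !divr_gt0// subr_gt0.
move=> h; rewrite lt_min !ltr_pdivlMr// => /andP[hd hr].
have Phr : `|P h| <= `|h| * p by rewrite mulrC.
have PKh : P (K + h) = K + P h by rewrite (linD _ _ lP) PK.
rewrite PsiF ?PKh; last first.
  by rewrite (le_lt_trans (ler_normD _ _))//; move: hr Phr; lra.
rewrite PsiF ?PK// (linD _ _ lA) (linD _ _ lB).
have := dF (P h) (le_lt_trans Phr hd); rewrite -/F -frame_shift// -/K -(addrA Xbar K).
move=> h1; apply: (@le_trans _ _ (e / p * `|P h|)); last first.
  by rewrite mulrAC ler_pdivrMr// -mulrA ler_wpM2l// ltW.
apply: le_trans h1; rewrite mmulDl mmulDr.
rewrite le_eqVlt; apply/orP; left; apply/eqP; congr `|_|.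
move: (A K ** _) (A h ** _) (_ ** B K) (_ ** B h) (F _) (F _) (D _) => *.
by mring.
Qed.

Lemma slice_differentiable : exists2 d, 0 < d & forall U W y,
  frame Xbar U W -> `|y| < d ->
  (exists D, has_diff G (Xbar + U ** rd y ** ctr W) D) <->
  (exists D, has_diff Psi (U ** rd y ** ctr W) D).
Proof.
have [rg [Cg ga]] := g_adapted; have [rf [Cf fa]] := model_adapted.
have [rd0 rd00 gd] := g_diff.
have [cs cg _ _] := ga; have [rg0 _ _] := cg; have [_ [rf0 _ _] _ _] := fa.
exists (Num.min (Num.min rg rf) rd0); first by rewrite !lt_min rg0 rf0.
move=> U0 W0 y0 fr0; rewrite !lt_min -andbA => yr.
have [U [W [y [fr yE <- bs]]]] := frame_sorted y0 fr0.
move: yr; rewrite -yE => /and3P[yg yf yd].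
have [uU uW _] := fr.
have sy : sorted_nonneg (c + y).
  exact: block_sorted_near cs cg (near_center yg) bs.
rewrite frame_shift//; split=> -[D FD].
  have [M gM] : exists M, has_diff g (c + y) M.
    apply: (has_diff_diagonal uU uW (d := rg - `|y|) _ _ FD).
      by rewrite subr_gt0.
    move=> y' y'r; rewrite -mmulDl -mmulDr -rdD.
    have n1 : near_pt c rg (c + y + y').
      rewrite -addrA; apply: near_center.
      by rewrite (le_lt_trans (ler_normD _ _))//; move: y'r; lra.
    have [_ ->] := spectral_operator_near ga n1 uU uW.
    have [_ ->] := spectral_operator_near ga (near_center yg) uU uW.
    by rewrite -mmulBl -mmulBr -rdB.
  have /(gd _ yd)[M' /model_has_diff phiM] : exists M, has_diff g (c + y) M by exists M.
  have [D' FD'] := spectral_operator_has_diff fa (near_center yf) sy phiM uU uW.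
  exact: Psi_has_diff fa fr yf FD'.
have [M /(ex_intro (fun M => has_diff phi y M))/(gd _ yd)[M' gM]] :
    exists M, has_diff phi y M.
  apply: (has_diff_diagonal uU uW (d := 1) _ _ FD) => // y' _.
  by rewrite -mmulDl -mmulDr -rdD !Psi_diag// -mmulBl -mmulBr -rdB.
exact: spectral_operator_has_diff ga (near_center yg) sy gM uU uW.
Qed.

Lemma spectral_derivative_le r C f X D : adapted c r f C ->
  near_pt c r (sigma X) -> has_diff (spectral_operator f : V -> V) X D ->
  forall h, `|D h| <= spectral_lip R m q C * `|h|.
Proof.
move=> [_ _ _ fC] Xc FD h; have lip0 := @sigma_lip_ge0 R m q.
pose S := sigma_lip R m q * `|h| + 1.
have S0 : 0 < S by rewrite ltr_wpDl// mulr_ge0.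
apply: (has_diff_dir_le (d := (r - `|sigma X - c|) / S) FD).
  by rewrite divr_gt0// subr_gt0.
move=> t t0; rewrite ltr_pdivlMr// => td.
have tE : X + t *: h - X = t *: h by mring.
have Xt : near_pt c r (sigma (X + t *: h)).
  have h1 := ler_distD (sigma X) (sigma (X + t *: h)) c.
  have := sigma_lipschitz (X + t *: h) X; rewrite tE normrZ gtr0_norm// => h2.
  rewrite /near_pt /= (le_lt_trans h1)//; move: h2 td; rewrite /S.
  have -> : sigma_lip R m q * (t * `|h|) = t * (sigma_lip R m q * `|h|) by ring.
  by move: t0; lra.
apply: (le_trans (spectral_operator_lipschitz fC Xt Xc)).
by rewrite tE normrZ gtr0_norm// -mulrA [t * _]mulrC.
Qed.

(** Differentiates the equivariance of [G] under rotations of [X] itself, given to second order by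
    the expansion with zero diagonal increment. *)
Lemma slice_derivative_rotation r C U W y D A B : adapted c r g C ->
  frame Xbar U W -> `|y| < r -> skew A -> skew B ->
  has_diff G (U ** rd (c + y) ** ctr W) D ->
  let X := U ** rd (c + y) ** ctr W in
  D (A ** X - X ** B) = A ** G X - G X ** B.
Proof.
move=> ga [uU uW _] yr sA sB FD X; rewrite -/X in FD.
have [rho [K [rho0 K0 exp]]] :=
  @spectral_operator_expand R k m q c r g C _ ga (near_center yr).
pose T := `|A| + `|B|; have T0 : 0 <= T by rewrite addr_ge0.
have T1 : 0 < T + 1 by rewrite ltr_wpDl.
apply: (has_diff_dir_eq (c := K * T ^+ 2) (d := rho / (T + 1)) FD).
  exact: divr_gt0.
move=> t t0; rewrite ltr_pdivlMr// => td.
have TE : `|t *: A| + `|t *: B| + `|0 : Rvec R m| = t * T.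
  by rewrite !normrZ gtr0_norm// normr0 addr0 -mulrDr.
have tT : `|t *: A| + `|t *: B| + `|0 : Rvec R m| <= rho.
  by rewrite TE (le_trans _ (ltW td))// ler_pM2l// lerDl.
have := exp U W _ _ _ X G uU uW (skewZ t sA) (skewZ t sB) tT erefl erefl.
have -> : t *: (A ** X - X ** B) =
    (t *: A) ** X - X ** (t *: B) + U ** rd 0 ** ctr W.
  by rewrite rd0 mmul0r mmul0l addr0 mmulZl mmulZr scalerBr.
have -> : t *: (A ** G X - G X ** B) =
    (t *: A) ** G X - G X ** (t *: B) + U ** rd (g (c + y + 0) - g (c + y)) ** ctr W.
  by rewrite addr0 subrr rd0 mmul0r mmul0l addr0 mmulZl mmulZr scalerBr.
by rewrite TE exprMn [t ^+ 2 * _]mulrC mulrA.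
Qed.

(** In a frame shared with [Xbar] every term is diagonal, and the claim is the definition of
    [error]. The constant [G Xbar] drops out of increments along the slice. *)
Lemma slice_error r C C' Z : adapted c r error C -> adapted c r g C' ->
  normal Xbar Z -> `|Z| < r ->
  near_pt c r (sigma (Xbar + Z)) /\
  G (Xbar + Z) - Psi Z = G Xbar + spectral_operator error (Xbar + Z).
Proof.
move=> ea ga /frame_normal[U [W [z [fr ->]]]] Zr; have [uU uW XE] := fr.
have zr : `|z| < r by move: Zr; rewrite norm_rotate// norm_rd.
have r0 : 0 < r by rewrite (le_lt_trans _ zr).
have cc : near_pt c r c by rewrite /near_pt /= subrr normr0.
rewrite frame_shift//.
have [s1 e1] := spectral_operator_near ea (near_center zr) uU uW.
have [_ e2] := spectral_operator_near ga (near_center zr) uU uW.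
have [_ e3] := spectral_operator_near ga cc uU uW; rewrite -XE in e3.
split; first by rewrite /near_pt /= s1; exact: near_center.
have cz : c + z - c = z by mring.
rewrite e1 e2 e3 Psi_diag// /error cz -mmulBl -mmulBr -rdB -mmulDl -mmulDr -rdD.
by congr (_ ** rd _ ** _); mring.
Qed.

Lemma spectral_lipM C : spectral_lip R m q C = C * spectral_lip R m q 1.
Proof. by rewrite /spectral_lip mul1r mulrCA. Qed.

Lemma slice_close e : 0 < e -> exists2 d, 0 < d & forall U W y D1 D2,
  frame Xbar U W -> `|y| < d ->
  has_diff G (Xbar + U ** rd y ** ctr W) D1 ->
  has_diff Psi (U ** rd y ** ctr W) D2 ->
  forall h, `|D1 h - D2 h| <= e * `|h|.
Proof.
move=> e0; have [rg [Cg ga]] := g_adapted.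
have [cs cg geq gC] := ga; have [rg0 _ _] := cg; have [Cg0 _ _ _] := gC.
have [A [B [P [lA lB lP dec]]]] := linear_decomposition Xbar.
have [a a0 Aa] := linear_bounded lA; have [b b0 Bb] := linear_bounded lB.
have [p p0 Pp] := linear_bounded lP.
have [L1 L1E] : exists L, L = spectral_lip R m q 1 by exists (spectral_lip R m q 1).
have L10 : 0 <= L1 by rewrite L1E; exact: spectral_lip_ge0.
pose Lg := spectral_lip R m q Cg; have Lg0 : 0 <= Lg by exact: spectral_lip_ge0.
(* Chosen so that [spectral_lip R m q e1 * p <= e / 2], which is possible because [spectral_lip] is
   linear in its constant. *)
pose e1 := e / 2 / (p * L1 + 1).
have pL1 : 0 < p * L1 + 1 by rewrite ltr_wpDl// mulr_ge0// ltW.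
have e10 : 0 < e1 by rewrite !divr_gt0.
have [re re0 ea] := error_adapted e10.
pose S := 2 * Lg * (a + b) + 1.
have S0 : 0 < S.
  by rewrite ltr_wpDl// mulr_ge0 ?(ltW (addr_gt0 a0 b0))// mulr_ge0.
pose r := Num.min rg re.
have r0 : 0 < r by rewrite lt_min rg0.
have [rrg rre] : r <= rg /\ r <= re by split; rewrite ge_min lexx ?orbT.
have ga' : adapted c r g Cg by exact: adaptedS ga.
have ea' : adapted c r error e1 by exact: adaptedS ea.
exists (Num.min r (e / 2 / S)); first by rewrite lt_min r0 !divr_gt0.
move=> U W y D1 D2 fr; rewrite lt_min => /andP[yr yS] FD1 FD2 h.
have [uU uW XE] := fr.
have [lD1 _] := FD1; have [lD2 _] := FD2.
have [K KE] : exists K, K = U ** rd y ** ctr W by exists (U ** rd y ** ctr W).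
rewrite -KE in FD1 FD2; have FD1' := FD1.
have [X XK] : exists X, X = Xbar + K by exists (Xbar + K).
rewrite -XK in FD1'.
have XE' : X = U ** rd (c + y) ** ctr W by rewrite XK KE frame_shift.
have nK : normal Xbar K.
  by rewrite {1}XE KE; apply: normal_rotate => //; [exact: unitary_ctr|exact: normal_rd].
have Ky : `|K| = `|y| by rewrite KE norm_rotate// norm_rd.
have Kr : `|K| < r by rewrite Ky.
have [sA sB nP hE] := dec h.
have [sX _] := slice_error ea' ga' nK Kr; rewrite -XK in sX.
have D1le := spectral_derivative_le ga' sX FD1'.
pose T := A h ** Xbar - Xbar ** B h.
have D2T : D2 T = A h ** G Xbar - G Xbar ** B h.
  apply: (has_diff_dir_eq (c := 0) (d := 1) FD2) => // t t0 _.
  have -> : t *: T = (t *: A h) ** Xbar - Xbar ** (t *: B h).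
    by rewrite /T scalerBr mmulZl mmulZr.
  rewrite PsiD_tangent; [|exact: skewZ..].
  by rewrite mmulZl mmulZr -scalerBr mul0r [Psi _ + _]addrC addrK subrr normr0.
(* At [X] the derivative of [G] is known along [A X - X B] rather than [A Xbar - Xbar B]; the
   difference [A K - K B] is small with [K]. *)
have D1T : D1 T = A h ** G X - G X ** B h - D1 (A h ** K - K ** B h).
  rewrite XE' in FD1'; have := slice_derivative_rotation ga' fr yr sA sB FD1'.
  rewrite -XE' => <-; rewrite -(linB _ _ lD1) /T XK mmulDl mmulDr.
  congr D1; move: (A h ** Xbar) (Xbar ** B h) (A h ** K) (K ** B h) => *.
  by mring.
have GX : `|G X - G Xbar| <= Lg * `|K|.
  have cc : near_pt c r (sigma Xbar) by rewrite /near_pt /= subrr normr0.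
  have [_ _ _ gC'] := ga'.
  have := spectral_operator_lipschitz gC' sX cc.
  by rewrite (_ : X - Xbar = K)//; rewrite XK; mring.
have com (C : Mat R k m m) (E : Mat R k (m + q) (m + q)) (Z : V) z :
    0 <= z -> `|C| <= a * `|h| -> `|E| <= b * `|h| -> `|Z| <= z ->
    `|C ** Z - Z ** E| <= (a + b) * `|h| * z.
  move=> z0 hC hE' hZ; rewrite (le_trans (ler_normB _ _))//.
  rewrite (le_trans (lerD (norm_mmul _ _) (norm_mmul _ _)))//.
  by rewrite !mulrDl lerD// ?[`|Z| * _]mulrC ler_pM.
have comB (C : Mat R k m m) (E : Mat R k (m + q) (m + q)) (Z Z' Y : V) :
    C ** Z - Z ** E - Y - (C ** Z' - Z' ** E) =
    C ** (Z - Z') - (Z - Z') ** E - Y.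
  rewrite mmulBr mmulBl; move: (C ** Z) (Z ** E) (C ** Z') (Z' ** E) => *.
  by mring.
have hT : `|D1 T - D2 T| <= e / 2 * `|h|.
  rewrite D1T D2T.
  rewrite comB.
  rewrite (le_trans (ler_normB _ _))//.
  have h1 := com _ _ _ _ (mulr_ge0 Lg0 (normr_ge0 K)) (Aa h) (Bb h) GX.
  have h2 := com _ _ _ _ (normr_ge0 K) (Aa h) (Bb h) (lexx _).
  have h3 := le_trans (D1le _) (ler_wpM2l Lg0 h2).
  rewrite (le_trans (lerD h1 h3))//.
  have -> : (a + b) * `|h| * (Lg * `|K|) + Lg * ((a + b) * `|h| * `|K|) =
      (2 * Lg * (a + b) * `|K|) * `|h| by ring.
  rewrite ler_wpM2r// Ky; move: yS; rewrite ltr_pdivlMr// mulrC => /ltW.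
  by apply: le_trans; rewrite ler_wpM2r// lerDl.
(* [slice_error] controls [G (Xbar + Z) - Psi Z] for normal [Z]; the ray from [K] along [P h] stays
   normal, so the ray bound applies. *)
have hN : `|D1 (P h) - D2 (P h)| <= e / 2 * `|h|.
  have dF : has_diff (fun Z => G (Xbar + Z) - Psi Z) K (fun h => D1 h - D2 h).
    exact: has_diffB (has_diff_translate FD1) FD2.
  have Ph := Pp h.
  have cancel (Y Z Z' : V) : Y + Z - (Y + Z') = Z - Z' by mring.
  apply: (@le_trans _ _ (spectral_lip R m q e1 * `|P h|)).
    pose d := (r - `|K|) / (`|P h| + 1).
    have P0 : 0 < `|P h| + 1 by rewrite ltr_wpDl.
    apply: (has_diff_dir_le (d := d) dF); first by rewrite divr_gt0// subr_gt0.
    move=> t t0; rewrite ltr_pdivlMr// => td.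
    have nKt : normal Xbar (K + t *: P h).
      by rewrite addrC; exact: normal_linear.
    have Ktr : `|K + t *: P h| < r.
      rewrite (le_lt_trans (ler_normD _ _))// normrZ gtr0_norm//.
      have : t * `|P h| <= t * (`|P h| + 1) by rewrite ler_pM2l// lerDl.
      by move: td; lra.
    have [s1 E1] := slice_error ea' ga' nKt Ktr.
    have [s2 E2] := slice_error ea' ga' nK Kr.
    cbv beta; rewrite [X in X - _]E1 [X in _ - X]E2.
    have [_ _ _ eC] := ea'.
    rewrite cancel.
    apply: (le_trans (spectral_operator_lipschitz eC s1 s2)).
    have -> : Xbar + (K + t *: P h) - (Xbar + K) = t *: P h by mring.
    by rewrite normrZ gtr0_norm// -mulrA [t * _]mulrC.
  rewrite spectral_lipM -L1E.
  have := ler_wpM2l (mulr_ge0 (ltW e10) L10) Ph => /le_trans; apply.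
  rewrite !mulrA ler_wpM2r// /e1.
  have -> : e / 2 / (p * L1 + 1) * L1 * p = e / 2 * (p * L1) / (p * L1 + 1).
    by ring.
  rewrite (ler_pdivrMr _ _ pL1) ler_wpM2l ?lerDl//.
  by rewrite ltW// divr_gt0.
have -> : D1 h - D2 h = (D1 T - D2 T) + (D1 (P h) - D2 (P h)).
  have hE' : h = T + P h := hE.
  have E1 : D1 h = D1 T + D1 (P h) by rewrite {1}hE' (linD _ _ lD1).
  have E2 : D2 h = D2 T + D2 (P h) by rewrite {1}hE' (linD _ _ lD2).
  rewrite E1 E2.
  by move: (D1 T) (D2 T) (D1 _) (D2 _) => *; mring.
rewrite (le_trans (ler_normD _ _))//; move: hT hN; lra.
Qed.

(** [P K] differs from [K] by a tangent vector, so [D2] is also the derivative of [Psi] at [P K],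
    where the slice comparison applies. *)
Lemma Psi_to_G e : 0 < e -> exists2 d, 0 < d & forall K D2, `|K| < d ->
  has_diff Psi K D2 -> exists X D1, [/\ `|X - Xbar| < e, has_diff G X D1 &
    forall h, `|D1 h - D2 h| <= e * `|h|].
Proof.
move=> e0; have [d1 d10 eqv] := slice_differentiable.
have [d2 d20 close] := slice_close e0.
have [A [B [P [lA lB lP dec]]]] := linear_decomposition Xbar.
have [p p0 Pp] := linear_bounded lP.
exists (Num.min (Num.min d1 d2) e / p); first by rewrite divr_gt0// !lt_min d10 d20.
move=> K D2; rewrite ltr_pdivlMr// => Kd FD2.
have [sA sB nP KE] := dec K.
have FP : has_diff Psi (P K) D2.
  have [lD2 F2] := FD2; split; first exact: lD2.
  move=> eps eps0; have [d d0 Fd] := F2 _ eps0.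
  exists d; first exact: d0.
  move=> h hd; have := Fd h hd; have E Z : Psi (Z + (A K ** Xbar - Xbar ** B K)) =
    Psi Z + (A K ** G Xbar - G Xbar ** B K) by exact: PsiD_tangent.
  have -> : K + h = P K + h + (A K ** Xbar - Xbar ** B K).
    by rewrite {1}KE addrC addrA [h + _]addrC -addrA [_ + P K]addrC addrC addrA [_ + h]addrC.
  have -> : Psi K = Psi (P K + (A K ** Xbar - Xbar ** B K)).
    by congr Psi; rewrite {1}KE addrC.
  by rewrite !E opprD addrACA subrr addr0.
have [U [W [y [fr PE]]]] := frame_normal nP.
have [uU uW _] := fr.
have yE : `|y| = `|P K| by rewrite PE norm_rotate// norm_rd.
have : `|y| < Num.min (Num.min d1 d2) e.
  by rewrite yE (le_lt_trans (Pp K))// mulrC.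
rewrite !lt_min -andbA => /and3P[y1 y2 ye]; rewrite PE in FP.
have [D1 FD1] : exists D, has_diff G (Xbar + U ** rd y ** ctr W) D.
  by apply/(eqv _ _ _ fr y1); exists D2.
exists (Xbar + U ** rd y ** ctr W), D1; split => //.
  by rewrite addrAC subrr add0r norm_rotate// norm_rd.
exact: close fr y2 FD1 FP.
Qed.

End Core.

(** * Points off the slice *)

Section NearbyFrames.
Context {R : realType} {k : entries} {m q : nat}.
Local Notation rd := (@rect_diag R k m (m + q)).
Local Notation V := (Mat R k m (m + q)).
Variable Xbar : V.

(* The unitary pairs that are [eta]-far from the frames of [Xbar] form a compact
   set, on which [U rd(sigma Xbar) W^H] stays away from [Xbar]. *)
Lemma frame_near (eta : R) : 0 < eta -> exists2 d, 0 < d & forall X U W,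
  `|X - Xbar| < d -> orthogonal_mx U -> orthogonal_mx W ->
  X = U ** rd (sigma X) ** ctr W ->
  exists U' W', [/\ frame Xbar U' W', `|U' - U| < eta & `|W' - W| < eta].
Proof.
move=> eta0; pose MM := (Mat R k m m * Mat R k (m + q) (m + q))%type.
pose T : set MM := \bigcup_(p in [set p : MM | frame Xbar p.1 p.2]) ball p eta.
have oT : open T by apply: bigcup_open => p _; exact: ball_open.
pose S := [set UW : MM | orthogonal_mx UW.1 /\ orthogonal_mx UW.2] `&` ~` T.
have cS : compact S.
  apply: compact_closedI; first exact: unitary_pairs_compact.
  exact: open_closedC.
have inT U W : T (U, W) ->
    exists U' W', [/\ frame Xbar U' W', `|U' - U| < eta & `|W' - W| < eta].
  move=> [[U' W'] /= fr [/= h1 h2]]; exists U', W'.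
  by split.
(* If there are no far pairs, every unitary pair is close to a frame and any radius works. *)
have [S0|S0] := pselect (S !=set0); last first.
  exists 1 => // X U W _ uU uW _; apply: inT; apply: contrapT => nT.
  by apply: S0; exists (U, W).
pose h (UW : MM) := `|UW.1 ** rd (sigma Xbar) ** ctr UW.2 - Xbar|.
have hc : {within S, continuous h}.
  apply: continuous_subspaceT => UW.
  have rc : (fun UW : MM => UW.1 ** rd (sigma Xbar) ** ctr UW.2 - Xbar) @ UW
      --> (UW.1 ** rd (sigma Xbar) ** ctr UW.2 - Xbar).
    apply: (@cvgB _ _ _ (nbhs UW) (nbhs_filter UW)); last exact: cvg_cst.
    apply: (@cvg_rotate _ _ _ (nbhs UW) (nbhs_filter UW)); first exact: cvg_fst.
    exact: cvg_snd.
  exact: (@cvg_norm _ _ _ (nbhs UW) (nbhs_filter UW) _ _ rc).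
have [[U0 W0] /set_mem S00 hmin] := compact_EVT_min S0 cS hc.
have h0 : 0 < h (U0, W0).
  rewrite /h normr_gt0 subr_eq0; apply/eqP => /= E.
  have [[/= uU0 uW0] nT] := S00; apply: nT.
  by exists (U0, W0); [split|exact: ballxx].
have lip0 := @sigma_lip_ge0 R m q.
have lip1 : 0 < sigma_lip R m q + 1 by rewrite ltr_wpDl.
exists (h (U0, W0) / (sigma_lip R m q + 1)); first exact: divr_gt0.
move=> X U W; rewrite ltr_pdivlMr// => Xd uU uW XE.
apply: inT; apply: contrapT => nT.
have := hmin (U, W) (mem_set (conj (conj uU uW) nT)).
apply/negP; rewrite -ltNge; apply: le_lt_trans Xd.
rewrite /h [(U, W).1]/= [(U, W).2]/=.
have h1 := ler_distD X (U ** rd (sigma Xbar) ** ctr W) Xbar.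
apply: (le_trans h1); rewrite [leRHS]mulrDr mulr1 lerD2r {1}XE.
rewrite -mmulBl -mmulBr -rdB norm_rotate// norm_rd mulrC distrC.
exact: sigma_lipschitz.
Qed.

Lemma spectral_operator_rotate f C A (Z : V) U W : spectral_bounds f C A ->
  A (sigma Z) -> orthogonal_mx U -> orthogonal_mx W ->
  spectral_operator f (U ** Z ** ctr W) = U ** spectral_operator f Z ** ctr W.
Proof.
move=> fC AZ uU uW; have [U' [W' [uU' uW' ZE ->]]] := spectral_operator_svd f Z.
rewrite [in LHS]ZE.
have -> : U ** (U' ** rd (sigma Z) ** ctr W') ** ctr W =
    (U ** U') ** rd (sigma Z) ** ctr (W ** W') by rewrite ctrM !mmulA.
rewrite (spectral_operator_sorted fC)//; first by rewrite ctrM !mmulA.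
- exact: unitaryM.
- exact: unitaryM.
- exact: sigma_sorted.
Qed.

Lemma rotate_dist (Z : V) U W : orthogonal_mx U -> orthogonal_mx W ->
  `|U ** Z ** ctr W - Z| <= (`|U - idm| + `|W - idm|) * `|Z|.
Proof.
move=> uU uW; have -> : U ** Z ** ctr W - Z =
    (U - idm) ** Z ** ctr W + Z ** ctr (W - idm).
  rewrite ctrD ctrN ctr1 mmulDr mmulNr mmul1r !mmulDl mmulNl mmul1l mmulNl.
  by move: (U ** Z ** _) (Z ** _) => *; mring.
rewrite (le_trans (ler_normD _ _))// mulrDl lerD//.
  by rewrite norm_unitaryr ?norm_mmul//; exact: unitary_ctr.
by rewrite (le_trans (norm_mmul _ _))// norm_ctr mulrC.
Qed.

End NearbyFrames.

Section Transfer.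
Context {R : realType} {k : entries} {m q : nat}.
Local Notation rd := (@rect_diag R k m (m + q)).
Local Notation V := (Mat R k m (m + q)).
Variables (Xbar : V) (g : Rvec R m -> Rvec R m) (Psi : V -> V).
Local Notation c := (sigma Xbar).
Local Notation G := (spectral_operator g : V -> V).
Hypothesis g_adapted : exists r C, adapted c r g C.
Hypothesis slice_diff : exists2 d, 0 < d & forall U W y,
  frame Xbar U W -> `|y| < d ->
  (exists D, has_diff G (Xbar + U ** rd y ** ctr W) D) <->
  (exists D, has_diff Psi (U ** rd y ** ctr W) D).
Hypothesis slice_approx : forall e, 0 < e -> exists2 d, 0 < d & forall U W y D1 D2,
  frame Xbar U W -> `|y| < d ->
  has_diff G (Xbar + U ** rd y ** ctr W) D1 ->
  has_diff Psi (U ** rd y ** ctr W) D2 ->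
  forall h, `|D1 h - D2 h| <= e * `|h|.

Lemma has_diff_rotate r C X D U W : adapted c r g C -> near_pt c r (sigma X) ->
  orthogonal_mx U -> orthogonal_mx W -> has_diff G X D ->
  has_diff G (U ** X ** ctr W) (fun h => U ** D (ctr U ** h ** W) ** ctr W).
Proof.
move=> [_ _ _ gC] sX uU uW [lD FD]; split; first exact: linear_sandwich lD.
move=> e e0; have [d d0 Fd] := FD e e0; have lip0 := @sigma_lip_ge0 R m q.
have lip1 : 0 < sigma_lip R m q + 1 by rewrite ltr_wpDl.
exists (Num.min d ((r - `|sigma X - c|) / (sigma_lip R m q + 1))).
  by rewrite lt_min d0 divr_gt0// subr_gt0.
move=> h; rewrite lt_min ltr_pdivlMr// => /andP[hd hr].
pose h' := ctr U ** h ** W.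
have h'E : `|h'| = `|h|.
  by rewrite norm_unitaryr// norm_unitaryl//; exact: unitary_ctr.
have hE : h = U ** h' ** ctr W by rewrite rotKV.
have tE : X + h' - X = h' by mring.
have sXh : near_pt c r (sigma (X + h')).
  have h1 := ler_distD (sigma X) (sigma (X + h')) c.
  have := sigma_lipschitz (X + h') X; rewrite tE h'E => h2.
  rewrite /near_pt /= (le_lt_trans h1)//.
  by move: h2 hr (normr_ge0 h); rewrite mulrDr mulr1 mulrC; lra.
have -> : U ** X ** ctr W + h = U ** (X + h') ** ctr W.
  by rewrite [in LHS]hE mmulDr mmulDl.
rewrite (spectral_operator_rotate gC sXh uU uW).
rewrite (spectral_operator_rotate gC sX uU uW) -/h'.
have fac (Y Z T : V) : U ** Y ** ctr W - U ** Z ** ctr W - U ** T ** ctr W =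
    U ** (Y - Z - T) ** ctr W by rewrite !(mmulBr, mmulBl).
by rewrite fac norm_rotate// -h'E; apply: Fd; rewrite h'E.
Qed.

(** [O1] and [O2] carry the frame of [X] to a nearby frame of [Xbar], hence [X] to the slice point
    with [y = sigma X - c]. Being within [eta] of the identity, they change the derivative by at
    most [4 * L * eta], where [L] bounds derivatives of [G] near [Xbar]. *)
Lemma G_to_Psi e : 0 < e -> exists2 d, 0 < d & forall X D1, `|X - Xbar| < d ->
  has_diff G X D1 -> exists K D2, [/\ `|K| < e, has_diff Psi K D2 &
    forall h, `|D2 h - D1 h| <= e * `|h|].
Proof.
move=> e0; have [r [C ga]] := g_adapted.
have [_ [r0 _ _] _ gC] := ga; have [C0 _ _ _] := gC.
have [d1 d10 eqv] := slice_diff.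
have e20 : 0 < e / 2 by rewrite divr_gt0.
have [d2 d20 close] := slice_approx e20.
have [L LE] : exists L, L = spectral_lip R m q C by exists (spectral_lip R m q C).
have L0 : 0 <= L by rewrite LE; exact: spectral_lip_ge0.
have L1 : 0 < 4 * L + 1 by rewrite ltr_wpDl// mulr_ge0.
pose eta := e / 2 / (4 * L + 1).
have eta0 : 0 < eta by rewrite !divr_gt0.
have [d3 d30 fn] := frame_near Xbar eta0.
have lip0 := @sigma_lip_ge0 R m q.
have lip1 : 0 < sigma_lip R m q + 1 by rewrite ltr_wpDl.
pose mm := Num.min (Num.min r e) (Num.min d1 d2).
have mm0 : 0 < mm by rewrite !lt_min r0 e0 d10 d20.
exists (Num.min d3 (mm / (sigma_lip R m q + 1))).
  by rewrite lt_min d30 divr_gt0.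
move=> X D1; rewrite lt_min ltr_pdivlMr// => /andP[Xd Xm] FD1.
have [U [W [uU uW XE]]] := sigma_svd X.
have [U' [W' [fr UU' WW']]] := fn X U W Xd uU uW XE.
have [uU' uW' _] := fr.
pose y := sigma X - c.
have : `|y| < mm.
  apply: le_lt_trans Xm; rewrite mulrDr mulr1 mulrC.
  by rewrite (le_trans (sigma_lipschitz _ _))// lerDl.
rewrite !lt_min -!andbA => /and4P[yr ye y1 y2].
pose O1 := U' ** ctr U; pose O2 := W' ** ctr W.
have uO1 : orthogonal_mx O1 by apply: unitaryM => //; exact: unitary_ctr.
have uO2 : orthogonal_mx O2 by apply: unitaryM => //; exact: unitary_ctr.
have XE' : O1 ** X ** ctr O2 = Xbar + U' ** rd y ** ctr W'.
  rewrite frame_shift// (_ : c + y = sigma X); last by rewrite /y; mring.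
  by rewrite [X in _ ** X ** _]XE /O1 /O2 ctrM ctrK -[in RHS](rotK (rd _) uU uW) !mmulA.
have FD1' := has_diff_rotate ga yr uO1 uO2 FD1; rewrite XE' in FD1'.
have [D2 FD2] : exists D, has_diff Psi (U' ** rd y ** ctr W') D.
  by apply/(eqv _ _ _ fr y1); exists (fun h => O1 ** D1 (ctr O1 ** h ** O2) ** ctr O2).
exists (U' ** rd y ** ctr W'), D2; split => //.
  by rewrite norm_rotate// norm_rd.
move=> h; have h1 := close _ _ _ _ _ fr y2 FD1' FD2 h; cbv beta in h1.
have D1le := spectral_derivative_le ga yr FD1; rewrite -LE in D1le.
have [lD1 _] := FD1.
have dist p (A B : Mat R k p p) : orthogonal_mx B -> `|A - B| < eta ->
    `|A ** ctr B - idm| <= eta.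
  move=> uB AB; rewrite -(unitary_ctrr uB) -mmulBl norm_unitaryr ?ltW//.
  exact: unitary_ctr.
have o1 : `|O1 - idm| <= eta by exact: dist.
have o2 : `|O2 - idm| <= eta by exact: dist.
have rot_le Z : `|O1 ** Z ** ctr O2 - Z| <= (eta + eta) * `|Z|.
  by rewrite (le_trans (rotate_dist _ uO1 uO2))// ler_wpM2r// lerD.
pose h' := ctr O1 ** h ** O2.
have h'h : `|h' - h| <= (eta + eta) * `|h|.
  have := rot_le h'; rewrite rotKV// distrC; move/le_trans; apply.
  by rewrite norm_unitaryr// norm_unitaryl//; exact: unitary_ctr.
have h'E : `|h'| = `|h|.
  by rewrite norm_unitaryr// norm_unitaryl//; exact: unitary_ctr.
have h2 : `|O1 ** D1 h' ** ctr O2 - D1 h'| <= (eta + eta) * (L * `|h|).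
  rewrite (le_trans (rot_le _))// ler_wpM2l ?addr_ge0 ?(ltW eta0)//.
  by rewrite -h'E.
have h3 : `|D1 h' - D1 h| <= L * ((eta + eta) * `|h|).
  by rewrite -(linB _ _ lD1) (le_trans (D1le _))// ler_wpM2l.
have -> : D2 h - D1 h = - (O1 ** D1 h' ** ctr O2 - D2 h) +
    ((O1 ** D1 h' ** ctr O2 - D1 h') + (D1 h' - D1 h)).
  by move: (O1 ** D1 h' ** ctr O2) (D1 h') (D1 h) (D2 h) => *; mring.
rewrite (le_trans (ler_normD _ _))// normrN [e]splitr mulrDl lerD//.
rewrite (le_trans (ler_normD _ _))// (le_trans (lerD h2 h3))//.
have -> : (eta + eta) * (L * `|h|) + L * ((eta + eta) * `|h|) =
  (eta * (4 * L)) * `|h| by ring.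
rewrite ler_wpM2r// /eta mulrAC ler_pdivrMr// ler_wpM2l ?lerDl//.
by rewrite ltW.
Qed.

End Transfer.

(** * The main theorem *)

Lemma differentiableE (R : realType) (k k' : entries) m n m' n'
    (F : Mat R k m n -> Mat R k' m' n') z :
  (exists D, has_diff F z D) <-> differentiable F z.
Proof.
split=> [[D /has_diff_differentiable//]|dF].
by exists ('d F z); exact: differentiable_has_diff.
Qed.

(** At each scale a derivative of one map is traded for one of the other at a nearby point, each of
    the two errors costing at most [e / 2]. Towards [F] the new point must also land in [N], hence
    the minimum with the radius [r]. *)
Lemma B_subdifferential_eq (R : realType) (k : entries) m n
    (F F' : Mat R k m n -> Mat R k m n) N z : open N -> N z ->
  (forall e : R, 0 < e -> exists2 d, 0 < d & forall x D, `|x - z| < d ->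
    has_diff F x D -> exists y D', [/\ `|y| < e, has_diff F' y D' &
      forall h, `|D' h - D h| <= e * `|h|]) ->
  (forall e : R, 0 < e -> exists2 d, 0 < d & forall y D, `|y| < d ->
    has_diff F' y D -> exists x D', [/\ `|x - z| < e, has_diff F x D' &
      forall h, `|D' h - D h| <= e * `|h|]) ->
  B_subdifferential N F z = B_subdifferential setT F' 0.
Proof.
move=> oN Nz FF' F'F.
have chain (D D' L : Mat R k m n -> Mat R k m n) (e1 e2 e : R) : e1 + e2 <= e ->
    (forall h, `|D' h - D h| <= e1 * `|h|) -> (forall h, `|D h - L h| <= e2 * `|h|) ->
    forall h, `|D' h - L h| <= e * `|h|.
  move=> ee h1 h2 h; rewrite (le_trans (ler_distD (D h) _ _))//.
  by rewrite (le_trans (lerD (h1 h) (h2 h)))// -mulrDl ler_wpM2r.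
apply/seteqP; split=> L /B_subdifferentialP HL; apply/B_subdifferentialP => e e0.
  have e20 : 0 < e / 2 by rewrite divr_gt0.
  have [d d0 dF] := FF' _ e20.
  have m0 : 0 < Num.min d (e / 2) by rewrite lt_min d0.
  have [x [D [_ xz FD DL]]] := HL _ m0.
  have xd : `|x - z| < d by rewrite (lt_le_trans xz)// ge_min lexx.
  have [y [D' [ye FD' D'D]]] := dF _ _ xd FD.
  exists y, D'; split => //.
    by rewrite subr0 (lt_le_trans ye)// ler_pdivrMr// ler_peMr ?(ltW e0)// ler1n.
  apply: chain D'D DL; rewrite [leRHS]splitr lerD2l.
  by rewrite ge_min lexx orbT.
have /nbhs_ballP[r r0 rN] : nbhs z N by exact: open_nbhs_nbhs.
pose e' := Num.min (e / 2) r.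
have e'0 : 0 < e' by rewrite lt_min divr_gt0.
have [d d0 dF] := F'F _ e'0.
have m0 : 0 < Num.min d (e / 2) by rewrite lt_min d0 divr_gt0.
have [y [D [_ yz FD DL]]] := HL _ m0.
have yd : `|y| < d by rewrite -[y]subr0 (lt_le_trans yz)// ge_min lexx.
have [x [D' [xe FD' D'D]]] := dF _ _ yd FD.
move: xe; rewrite lt_min => /andP[xe xr].
exists x, D'; split => //.
- by apply: rN; rewrite -ball_normE /= distrC.
- by rewrite (lt_le_trans xe)// ler_pdivrMr// ler_peMr ?(ltW e0)// ler1n.
apply: chain D'D DL; rewrite [leRHS]splitr lerD//.
  by rewrite ge_min lexx.
by rewrite ge_min lexx orbT.
Qed.

Theorem theorem6p2 (R : realType) (k : entries) (m n : nat) (m_le_n : (m <= n)%N)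
  (N : set (Mat R k m n)) (N_open : open N) (N_nonempty : N !=set0)
  (sigma_hat_N : set (Rvec R m)) (sigma_hat_N_open : open sigma_hat_N)
  (sigma_N_sub : [set sigma X | X in N] `<=` sigma_hat_N)
  (g : Rvec R m -> Rvec R m) (g_sym : absolutely_symmetric g sigma_hat_N)
  (Xbar : Mat R k m n) (N_Xbar : N Xbar)
  (Ubar : Mat R k m m) (Vbar : Mat R k n n)
  (Xbar_svd : svd_pairs Xbar (Ubar, Vbar))
  (g_lip : locally_lipschitz_near g (sigma Xbar))
  (g_dir : dir_differentiable g (sigma Xbar))
  (g_diff : exists B : set (Rvec R m),
     [/\ open B, B (sigma Xbar), B `<=` sigma_hat_N
       & forall s, B s ->
           (differentiable g s <->
            differentiable (dir_derivative g (sigma Xbar)) (s - sigma Xbar))])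
  (d_strict : let d := fun h : Rvec R m =>
       g (sigma Xbar + h) - g (sigma Xbar) - dir_derivative g (sigma Xbar) h in
     strictly_differentiable_with_zero_derivative d 0) :
  let G : Mat R k m n -> Mat R k m n := spectral_operator g in
  let Psi : Mat R k m n -> Mat R k m n := dir_derivative G Xbar in
  B_subdifferential N G Xbar = B_subdifferential setT Psi 0 /\
  clarke_jacobian N G Xbar = clarke_jacobian setT Psi 0.
Proof.
move=> G Psi.
(* With [n = m + q] the columns split by [lshift] and [rshift], as in all preceding sections on
   [rect_diag]. *)
have [q nE] : exists q, n = (m + q)%N by exists (n - m)%N; rewrite subnKC.
subst n; rewrite -/Psi.
pose c := sigma Xbar; pose phi := dir_derivative g c.
have [r0 r00 rS] : exists2 r, 0 < r & near_pt c r `<=` sigma_hat_N.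
  have /nbhs_ballP[r r0 rS] : nbhs c sigma_hat_N.
    by apply: open_nbhs_nbhs; split => //; apply: sigma_N_sub; exists Xbar.
  exists r; first exact: r0.
  by move=> x xc; apply: rS; rewrite -ball_normE /= distrC.
have g_eq : exists2 r, 0 < r & stab_equivariant g c r.
  exists r0; first exact: r00.
  move=> p e x _ /rS xS; have [Q sQ QE] := @sact_spm R m p e.
  by rewrite -!QE; exact: g_sym.
have d_small e : 0 < e -> exists2 d, 0 < d & forall x y,
    near_pt c d x -> near_pt c d y ->
    `|model_error c g x - model_error c g y| <= e * `|x - y|.
  move=> e0; have [d d0 dd] := strictly_differentiable0P d_strict e0.
  exists d; first exact: d0.
  move=> x y xc yc.
  have cE z : c + (z - c) = z by mring.
  have := dd (x - c) (y - c); rewrite !subr0 => /(_ xc yc).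
  rewrite -/c (cE x) (cE y) (_ : x - c - (y - c) = x - y); last by mring.
  by [].
have cs : sorted_nonneg c by exact: sigma_sorted.
have ga := adapted_g cs g_eq g_lip.
have ma := adapted_model cs g_eq g_lip g_dir d_small.
have ea := @adapted_error R m c g cs g_eq g_dir d_small.
have gd : exists2 d, 0 < d & forall y, `|y| < d ->
    (exists M, has_diff g (c + y) M) <-> (exists M, has_diff phi y M).
  have [B [oB Bc _ gB]] := g_diff.
  have /nbhs_ballP[r r0' rB] : nbhs c B by exact: open_nbhs_nbhs.
  exists r; first exact: r0'.
  move=> y yr; have By : B (c + y).
    by apply: rB; rewrite -ball_normE /= distrC addrAC subrr add0r.
  have := gB _ By; rewrite (_ : c + y - sigma Xbar = y); last by rewrite /c; mring.
  move=> gphi; apply: (iff_trans (differentiableE _ _)).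
  by apply: (iff_trans gphi); apply: iff_sym; exact: differentiableE.
have Pf A B U W y : skew A -> skew B -> frame Xbar U W ->
    Psi (A ** Xbar - Xbar ** B + U ** rect_diag (m + q) y ** ctr W) =
    A ** G Xbar - G Xbar ** B + U ** rect_diag (m + q) (phi y) ** ctr W.
  exact: dir_derivative_frame.
suff BE : B_subdifferential N G Xbar = B_subdifferential setT Psi 0.
  by split; [exact: BE|rewrite /clarke_jacobian BE].
have sd := slice_differentiable ga ma gd Pf.
have sc := slice_close ga ea Pf.
apply: (B_subdifferential_eq N_open N_Xbar).
- exact: (G_to_Psi ga sd sc).
- exact: (Psi_to_G ga ma ea gd Pf).
Qed.
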